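(* Let $m$ be a positive integer and $r$ a positive rational number such that $\sqrt{r}$ is not a rational number with an even denominator. Then $\psi_{2m}(\sqrt{r})\in\pi^{2m}\mathbb{Q}$.
   Context: The secant Dirichlet series is $\psi_s(\tau)=\sum_{n=1}^{\infty}\frac{\sec(\pi n\tau)}{n^s}$; here it is evaluated at the real number $\tau=\sqrt{r}$, where for $s\ge2$ the series converges. *)

(* Defs.v *)
From Stdlib Require Import Reals QArith Qreals ZArith.
From Coquelicot Require Import Coquelicot.
Open Scope R_scope.

Definition sec (x : R) : R := / cos x.

(* [Series] sums from index 0, so index [n] holds the term of [S n]. *)
Definition psi_term (s : nat) (tau : R) (n : nat) : R :=
  sec (PI * INR (S n) * tau) / INR (S n) ^ s.

(* Meaningful when [psi_term s tau] is summable: [Series] is total. *)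
Definition psi (s : nat) (tau : R) : R := Series (psi_term s tau).

(* [Q] allows unreduced fractions, hence [Qred]. *)
Definition rational_with_even_denominator (x : R) : Prop :=
  exists q : Q, x = Q2R q /\ Z.Even (Zpos (Qden (Qred q))).

(* Main.v *)
Require Import Defs.
From Stdlib Require Import Reals QArith Qreals ZArith Lra Lia Psatz Classical.
From Coquelicot Require Import Coquelicot.
Open Scope R_scope.

(** Let tau = sqrt r be irrational, s = 2 m, and expand [sec (PI n tau)] in partial
    fractions over the odd integers: up to a factor, psi is the sum of
    [chi(v) / (n(v)^s l(v))] over lattice vectors v = (n, k), k odd, n <> 0, where chi is
    the character mod 4 of k and l = k - 2 n tau.  A solution of Pell's equation gives
    an integral matrix A preserving chi with l o A = eps l; put n' = n o A.  As n, n', l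
    are linear forms in two variables,
    [1 / (n^s (n' - a n)) - a^s / (n'^s (n' - a n)) = sum_(j < s) a^j / (n^(s-j) n'^(j+1))],
    where n' - a n is a multiple of l.  Summing against chi, both terms on the left give
    multiples of psi, so [(1 - a^(s-1)) psi] is a combination over Q(tau) of the sums of
    [chi / (n^p n'^q)] with p + q = s + 1.  By finite Fourier inversion these are
    combinations of products of [sum cos (PI n w) / n^p] and [sum sin (PI n w) / n^p],
    w rational, hence lie in PI^(s+1) Q.  So psi / PI^s is in Q(tau), and as psi is even
    in tau it equals its conjugate.  Exchanging the summations is harmless since the
    partial sums of the expansion of [sec (PI n tau)] are [O(|sec (PI n tau)|)] and
    [sum |sec (PI n tau)| / n^2] converges, tau being badly approximable.  If tau is
    rational with odd denominator, [sec (PI n tau)] is a finite rational combination of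
    [cos (PI n w)] with w rational. *)

(** * Finite sums and limits *)

(** The lattice sums need not converge absolutely, so the identities between them are proved exactly
    on the box 0 < |n|, |n'| <= N and the limit is taken afterwards. The box is invariant under
    exchange of n and n', and this exchange is the reciprocity: with n' = x n + b k one has n' - a n
    = b l for a = x + 2 b tau; the swap replaces a by a' = x - 2 b tau = 1 / a and changes the sign
    of chi, and the box for a' leads to psi at - tau. The price is the missing column n' = 0, a
    one-dimensional sum of weight s + 1 handled separately. In the coordinates (n, n'), chi is an
    odd function of n' - x n of period 4 b. Its finite Fourier expansion has only sines, and the
    addition formula separates n from n'. The symmetry n -> - n then keeps exactly the parities for
    which the trigonometric series are polynomials. The conditions x = 1 mod 4, x^2 - 4 g b = 1 and
    g = b tau^2 say that A = (x, b; 4 g, x) has determinant 1, preserves chi and multiplies l by a'.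
    Since the box limits do not involve tau, the same rational numbers serve tau and - tau, which is
    what makes conjugation possible. *)

Fixpoint psum (f : nat -> R) (n : nat) : R :=
  match n with O => 0 | S k => psum f k + f k end.

Lemma psum_ext (f g : nat -> R) (n : nat) :
  (forall i, (i < n)%nat -> f i = g i) -> psum f n = psum g n.
Proof.
  induction n as [|n IH]; intros H; simpl; [easy|].
  rewrite IH, H; auto with arith.
Qed.

Lemma psum_plus (f g : nat -> R) (n : nat) :
  psum (fun i => f i + g i) n = psum f n + psum g n.
Proof. induction n as [|n IH]; simpl; [lra|rewrite IH; lra]. Qed.

Lemma psum_scal (c : R) (f : nat -> R) (n : nat) :
  psum (fun i => c * f i) n = c * psum f n.
Proof. induction n as [|n IH]; simpl; [lra|rewrite IH; lra]. Qed.

Lemma psum_swap (f : nat -> nat -> R) (n m : nat) :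
  psum (fun i => psum (f i) m) n = psum (fun j => psum (fun i => f i j) n) m.
Proof.
  induction n as [|n IH]; simpl.
  - induction m as [|m IHm]; simpl; [easy|rewrite <- IHm; lra].
  - now rewrite IH, psum_plus.
Qed.

Lemma psum_Rabs (f : nat -> R) (n : nat) :
  Rabs (psum f n) <= psum (fun i => Rabs (f i)) n.
Proof.
  induction n as [|n IH]; simpl; [rewrite Rabs_R0; lra|].
  eapply Rle_trans; [apply Rabs_triang|lra].
Qed.

Lemma psum_le (f g : nat -> R) (n : nat) :
  (forall i, (i < n)%nat -> f i <= g i) -> psum f n <= psum g n.
Proof.
  induction n as [|n IH]; intros H; simpl; [lra|].
  apply Rplus_le_compat; auto with arith.
Qed.

Lemma psum_add (f : nat -> R) (n m : nat) :
  psum f (n + m) = psum f n + psum (fun i => f (n + i)%nat) m.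
Proof.
  induction m as [|m IH].
  - rewrite Nat.add_0_r; simpl; lra.
  - rewrite Nat.add_succ_r; simpl; rewrite IH; lra.
Qed.

Lemma psum_const (c : R) (n : nat) : psum (fun _ => c) n = INR n * c.
Proof.
  induction n as [|n IH]; [simpl; lra|].
  rewrite S_INR; simpl; rewrite IH; lra.
Qed.

Lemma psum_nonneg (f : nat -> R) (n : nat) : (forall i, 0 <= f i) -> 0 <= psum f n.
Proof.
  intros H; induction n as [|n IH]; simpl; [lra|specialize (H n); lra].
Qed.

Lemma psum_mono (f : nat -> R) (n m : nat) :
  (forall i, 0 <= f i) -> (n <= m)%nat -> psum f n <= psum f m.
Proof.
  intros H Hnm; replace m with (n + (m - n))%nat by lia; rewrite psum_add.
  pose proof (psum_nonneg (fun i => f (n + i)%nat) (m - n) (fun i => H _)); lra.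
Qed.

Lemma is_lim_seq_eq (u : nat -> R) (a b : R) :
  is_lim_seq u a -> is_lim_seq u b -> a = b.
Proof.
  intros Ha Hb; apply is_lim_seq_unique in Ha, Hb; rewrite Ha in Hb; now injection Hb.
Qed.

Lemma is_lim_seq_psum (u : nat -> nat -> R) (l : nat -> R) (n : nat) :
  (forall i, (i < n)%nat -> is_lim_seq (fun N => u N i) (l i)) ->
  is_lim_seq (fun N => psum (u N) n) (psum l n).
Proof.
  induction n as [|n IH]; intros H; simpl.
  - apply is_lim_seq_const.
  - apply is_lim_seq_plus'; auto with arith.
Qed.

Lemma is_derive_psum (f df : nat -> R -> R) (v : R) (n : nat) :
  (forall i, (i < n)%nat -> is_derive (f i) v (df i v)) ->
  is_derive (fun w => psum (fun i => f i w) n) v (psum (fun i => df i v) n).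
Proof.
  induction n as [|n IH]; intros H; simpl.
  - apply (is_derive_const (0 : R)).
  - apply (is_derive_plus (fun w => psum (fun i => f i w) n) (f n)); auto with arith.
Qed.

Lemma sum_n_psum (a : nat -> R) (n : nat) : sum_n a n = psum a (S n).
Proof.
  induction n as [|n IH]; [rewrite sum_O; simpl; lra|].
  rewrite sum_Sn, IH; reflexivity.
Qed.

Lemma is_series_psum (a : nat -> R) (l : R) :
  is_series a l <-> is_lim_seq (psum a) l.
Proof.
  split; intros H.
  - apply is_lim_seq_incr_1; eapply is_lim_seq_ext; [|exact H].
    intros n; apply sum_n_psum.
  - apply is_lim_seq_incr_1 in H; unfold is_series.
    change (is_lim_seq (sum_n a) l); eapply is_lim_seq_ext; [|exact H].
    intros n; symmetry; apply sum_n_psum.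
Qed.

Lemma ex_series_psum_bounded (a : nat -> R) (B : R) :
  (forall i, 0 <= a i) -> (forall n, psum a n <= B) -> ex_series a.
Proof.
  intros Ha HB.
  destruct (ex_finite_lim_seq_incr (psum a) B) as [l Hl]; [|easy|].
  - intros n; simpl; specialize (Ha n); lra.
  - exists l; now apply is_series_psum.
Qed.

Lemma ex_series_inv_pow (s : nat) :
  (2 <= s)%nat -> ex_series (fun n => / INR (S n) ^ s).
Proof.
  intros Hs; apply ex_series_psum_bounded with 2.
  - intros i; left; apply Rinv_0_lt_compat, pow_lt, lt_0_INR; lia.
  (* The telescoping majorant: 2 / k - 2 / (k + 1) = 2 / (k (k + 1)) >= 1 / k^2 for k >= 1. *)
  - intros n; apply Rle_trans with (2 - 2 * / INR (S n)).
    2: { pose proof (Rinv_0_lt_compat (INR (S n)) (lt_0_INR (S n) ltac:(lia))); lra. }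
    induction n as [|n IH]; [simpl; lra|]; cbn [psum].
    assert (Hk : 1 <= INR (S n)) by (rewrite S_INR; pose proof (pos_INR n); lra).
    assert (Hp : / INR (S n) ^ s <= / INR (S n) ^ 2).
    { apply Rinv_le_contravar; [apply pow_lt; lra|apply Rle_pow; [lra|easy]]. }
    rewrite (S_INR (S n)) in *; set (k := INR (S n)) in *.
    assert (Hd : 2 * / k - 2 * / (k + 1) - / k ^ 2 = (k - 1) * / (k ^ 2 * (k + 1)))
      by (field; lra).
    assert (0 <= (k - 1) * / (k ^ 2 * (k + 1))).
    { apply Rmult_le_pos; [lra|left; apply Rinv_0_lt_compat; nra]. }
    lra.
Qed.

(** Tannery's theorem in diagonal form: terms and truncation both move with N. A fixed head
    converges termwise, and the tail is controlled by [g] uniformly in N. This is the tool for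
    exchanging the two lattice summations. *)
Lemma is_lim_seq_dominated (u : nat -> nat -> R) (l g : nat -> R) :
  (forall N i, Rabs (u N i) <= g i) -> ex_series g ->
  (forall i, is_lim_seq (fun N => u N i) (l i)) ->
  ex_series l /\ is_lim_seq (fun N => psum (u N) N) (Series l).
Proof.
  intros Hd Hg Hl.
  assert (Hlg : forall i, Rabs (l i) <= g i).
  { intros i.
    apply (is_lim_seq_le (fun N => Rabs (u N i)) (fun _ => g i) (Rabs (l i)) (g i)).
    - intros N; apply Hd.
    - apply (is_lim_seq_abs _ (l i)), Hl.
    - apply is_lim_seq_const. }
  assert (Hex : ex_series l) by (now apply (ex_series_le l g)).
  split; [exact Hex|].
  pose proof (proj1 (is_series_psum _ _) (Series_correct _ Hex)) as HL.
  destruct Hg as [G HG]; apply is_series_psum in HG.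
  apply is_lim_seq_spec; intros eps.
  assert (He : 0 < eps / 4) by (pose proof (cond_pos eps); lra).
  apply is_lim_seq_spec in HL, HG.
  destruct (HG (mkposreal _ He)) as [N1 H1]; destruct (HL (mkposreal _ He)) as [N2 H2].
  simpl in H1, H2; set (M := (N1 + N2)%nat).
  assert (Hfin : is_lim_seq (fun N => psum (u N) M) (psum l M))
    by (apply is_lim_seq_psum; auto).
  apply is_lim_seq_spec in Hfin; destruct (Hfin (mkposreal _ He)) as [N3 H3]; simpl in H3.
  exists (M + N3)%nat; intros N HN.
  replace N with (M + (N - M))%nat at 2 by lia; rewrite psum_add.
  assert (Htail : Rabs (psum (fun i => u N (M + i)%nat) (N - M)) < eps / 2).
  { eapply Rle_lt_trans; [apply psum_Rabs|].
    eapply Rle_lt_trans; [apply psum_le; intros i _; apply Hd|].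
    pose proof (psum_add g M (N - M)) as Ha; replace (M + (N - M))%nat with N in Ha by lia.
    assert (HA := H1 N ltac:(lia)); assert (HB := H1 M ltac:(lia)).
    apply Rabs_def2 in HA, HB; lra. }
  assert (HA := H3 N ltac:(lia)); assert (HB := H2 M ltac:(lia)).
  apply Rabs_def2 in HA, HB, Htail; apply Rabs_def1; lra.
Qed.

(** The index 0 is left out because both lattice coordinates will stand in denominators; pairing n
    with - n lets terms of odd parity cancel at every finite N. *)
Definition tsum (g : Z -> R) (N : nat) : R :=
  psum (fun i => g (Z.of_nat (S i)) + g (- Z.of_nat (S i))%Z) N.

Definition zsum (g : Z -> R) (a : Z) (n : nat) : R :=
  psum (fun i => g (a + Z.of_nat i)%Z) n.

Lemma tsum_ext (f g : Z -> R) (N : nat) :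
  (forall n, n <> 0%Z -> f n = g n) -> tsum f N = tsum g N.
Proof. intros H; apply psum_ext; intros i _; rewrite !H; [easy|lia|lia]. Qed.

Lemma tsum_plus (f g : Z -> R) (N : nat) :
  tsum (fun n => f n + g n) N = tsum f N + tsum g N.
Proof. unfold tsum; rewrite <- psum_plus; apply psum_ext; intros; lra. Qed.

Lemma tsum_scal (c : R) (f : Z -> R) (N : nat) :
  tsum (fun n => c * f n) N = c * tsum f N.
Proof. unfold tsum; rewrite <- psum_scal; apply psum_ext; intros; lra. Qed.

Lemma tsum_psum (f : Z -> nat -> R) (N m : nat) :
  tsum (fun n => psum (f n) m) N = psum (fun j => tsum (fun n => f n j) N) m.
Proof.
  unfold tsum; rewrite <- psum_swap.
  apply psum_ext; intros i _; now rewrite psum_plus.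
Qed.

Lemma tsum_swap (f : Z -> Z -> R) (N M : nat) :
  tsum (fun n => tsum (f n) M) N = tsum (fun m => tsum (fun n => f n m) N) M.
Proof.
  unfold tsum at 2; rewrite tsum_psum; apply psum_ext; intros i _.
  now rewrite tsum_plus.
Qed.

Lemma zsum_tsum (g : Z -> R) (N : nat) :
  zsum g (- Z.of_nat N) (2 * N + 1) = tsum g N + g 0%Z.
Proof.
  induction N as [|N IH]; [unfold zsum, tsum; simpl; lra|].
  unfold zsum, tsum in *.
  replace (2 * S N + 1)%nat with (1 + ((2 * N + 1) + 1))%nat by lia.
  rewrite (psum_add _ 1), (psum_add _ (2 * N + 1) 1); cbn [psum].
  rewrite (psum_ext _ (fun i => g (- Z.of_nat N + Z.of_nat i)%Z)), IH
    by (intros i _; f_equal; lia).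
  replace (- Z.of_nat (S N) + Z.of_nat 0)%Z with (- Z.of_nat (S N))%Z by lia.
  replace (- Z.of_nat (S N) + Z.of_nat (1 + (2 * N + 1 + 0))%nat)%Z with (Z.of_nat (S N)) by lia.
  lra.
Qed.

(** * Rational real numbers *)

Definition is_rat (x : R) : Prop := exists q : Q, x = Q2R q.

Lemma is_rat_plus (x y : R) : is_rat x -> is_rat y -> is_rat (x + y).
Proof. intros [p ->] [q ->]; exists (p + q)%Q; now rewrite Q2R_plus. Qed.

Lemma is_rat_mult (x y : R) : is_rat x -> is_rat y -> is_rat (x * y).
Proof. intros [p ->] [q ->]; exists (p * q)%Q; now rewrite Q2R_mult. Qed.

Lemma is_rat_opp (x : R) : is_rat x -> is_rat (- x).
Proof. intros [p ->]; exists (- p)%Q; now rewrite Q2R_opp. Qed.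

Lemma is_rat_minus (x y : R) : is_rat x -> is_rat y -> is_rat (x - y).
Proof. intros Hx Hy; apply is_rat_plus; [easy|now apply is_rat_opp]. Qed.

Lemma is_rat_IZR (n : Z) : is_rat (IZR n).
Proof. exists (inject_Z n); unfold Q2R; simpl; lra. Qed.

Lemma is_rat_inv (x : R) : is_rat x -> is_rat (/ x).
Proof.
  intros [p ->]; destruct (Qeq_dec p 0) as [H|H].
  (* The inverse of 0 in [R] is 0, hence rational. *)
  - rewrite (Qeq_eqR _ _ H), RMicromega.Q2R_0, Rinv_0; apply (is_rat_IZR 0).
  - exists (/ p)%Q; now rewrite Q2R_inv.
Qed.

Lemma is_rat_div (x y : R) : is_rat x -> is_rat y -> is_rat (x / y).
Proof. intros Hx Hy; apply is_rat_mult; [easy|now apply is_rat_inv]. Qed.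

Lemma is_rat_INR (n : nat) : is_rat (INR n).
Proof. rewrite INR_IZR_INZ; apply is_rat_IZR. Qed.

Lemma is_rat_pow (x : R) (n : nat) : is_rat x -> is_rat (x ^ n).
Proof.
  intros Hx; induction n as [|n IH]; [apply (is_rat_IZR 1)|now apply is_rat_mult].
Qed.

Lemma is_rat_psum (f : nat -> R) (n : nat) :
  (forall i, (i < n)%nat -> is_rat (f i)) -> is_rat (psum f n).
Proof.
  induction n as [|n IH]; intros H; simpl; [apply (is_rat_IZR 0)|].
  apply is_rat_plus; auto with arith.
Qed.

(** * Values of trigonometric series at rational points *)

Lemma sin_IZR_PI (k : Z) : sin (IZR k * PI) = 0.
Proof. apply sin_eq_0_1; now exists k. Qed.

Lemma cos_2IZR_PI (k : Z) : cos (2 * (IZR k * PI)) = 1.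
Proof. rewrite cos_2a_sin, sin_IZR_PI; lra. Qed.

Lemma cos_shift_period (x : R) (k : Z) : cos (x + 2 * (IZR k * PI)) = cos x.
Proof. rewrite cos_plus, cos_2IZR_PI, sin_2a, sin_IZR_PI; lra. Qed.

Lemma sin_shift_period (x : R) (k : Z) : sin (x + 2 * (IZR k * PI)) = sin x.
Proof. rewrite sin_plus, cos_2IZR_PI, sin_2a, sin_IZR_PI; lra. Qed.

Lemma IZR_of_nat (n : nat) : IZR (Z.of_nat n) = INR n.
Proof. now rewrite INR_IZR_INZ. Qed.

Lemma sin_INR_PI (n : nat) : sin (PI * INR n) = 0.
Proof. rewrite Rmult_comm, <- IZR_of_nat; apply sin_IZR_PI. Qed.

Definition cos_sum (p : nat) (v : R) (N : nat) : R :=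
  psum (fun i => cos (PI * INR (S i) * v) / INR (S i) ^ p) N.

Definition sin_sum (p : nat) (v : R) (N : nat) : R :=
  psum (fun i => sin (PI * INR (S i) * v) / INR (S i) ^ p) N.

Lemma INR_S_pos (i : nat) : 0 < INR (S i).
Proof. apply lt_0_INR; lia. Qed.

Lemma INR_S_pow_pos (i p : nat) : 0 < INR (S i) ^ p.
Proof. apply pow_lt, INR_S_pos. Qed.

Lemma is_derive_sin_sum (p : nat) (v : R) (N : nat) :
  is_derive (fun w => sin_sum (S p) w N) v (PI * cos_sum p v N).
Proof.
  unfold sin_sum, cos_sum; rewrite <- psum_scal.
  apply (is_derive_psum (fun i w => sin (PI * INR (S i) * w) / INR (S i) ^ S p)
    (fun i w => PI * (cos (PI * INR (S i) * w) / INR (S i) ^ p))).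
  intros i _; pose proof (INR_S_pos i); pose proof (INR_S_pow_pos i p).
  set (k := INR (S i)) in *; clearbody k; auto_derive; [easy|]; cbn [pow]; field; lra.
Qed.

Lemma is_derive_cos_sum (p : nat) (v : R) (N : nat) :
  is_derive (fun w => cos_sum (S p) w N) v (- PI * sin_sum p v N).
Proof.
  unfold sin_sum, cos_sum; rewrite <- psum_scal.
  apply (is_derive_psum (fun i w => cos (PI * INR (S i) * w) / INR (S i) ^ S p)
    (fun i w => - PI * (sin (PI * INR (S i) * w) / INR (S i) ^ p))).
  intros i _; pose proof (INR_S_pos i); pose proof (INR_S_pow_pos i p).
  set (k := INR (S i)) in *; clearbody k; auto_derive; [easy|]; cbn [pow]; field; lra.
Qed.

(** The instances that matter are, up to scaling, Bernoulli polynomials in v / 2; only the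
    rationality of their coefficients is recorded. *)
Definition rat_poly (f : R -> R) : Prop :=
  exists (n : nat) (c : nat -> R),
    (forall i, is_rat (c i)) /\ forall v, f v = psum (fun i => c i * v ^ i) n.

Lemma rat_poly_value (f : R -> R) (v : R) : rat_poly f -> is_rat v -> is_rat (f v).
Proof.
  intros (n & c & Hc & Hf) Hv; rewrite Hf.
  apply is_rat_psum; intros i _; apply is_rat_mult; [easy|now apply is_rat_pow].
Qed.

Lemma rat_poly_antiderivative (f : R -> R) (k : R) :
  rat_poly f -> is_rat k ->
  exists F, rat_poly F /\ F 1 = k /\ forall v, is_derive F v (f v).
Proof.
  intros (n & c & Hc & Hf) Hk.
  set (d i := match i with O => 0 | S j => c j / INR (S j) end).
  assert (Hd : forall i, is_rat (d i)).
  { intros [|j]; [apply (is_rat_IZR 0)|apply is_rat_div; [easy|apply is_rat_INR]]. }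
  set (G v := psum (fun i => d i * v ^ i) (S n)).
  exists (fun v => (k - G 1) + G v); split; [|split].
  - exists (S n), (fun i => match i with O => k - G 1 | S j => d (S j) end); split.
    + intros [|j]; [|apply Hd]; apply is_rat_minus; [easy|]; unfold G.
      apply is_rat_psum; intros i _; apply is_rat_mult; [easy|].
      apply is_rat_pow, (is_rat_IZR 1).
    + intros v; unfold G at 2; change (S n) with (1 + n)%nat.
      rewrite !psum_add; simpl; lra.
  - lra.
  - intros v.
    assert (HG : is_derive G v (psum (fun i => INR i * d i * v ^ pred i) (S n))).
    { apply (is_derive_psum (fun i w => d i * w ^ i) (fun i w => INR i * d i * w ^ pred i)).
      intros i _; auto_derive; [easy|ring]. }
    rewrite Hf; replace (psum (fun i => c i * v ^ i) n)
      with (0 + psum (fun i => INR i * d i * v ^ pred i) (S n)).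
    + apply (is_derive_plus (fun _ => k - G 1) G); [|exact HG].
      apply (is_derive_const (k - G 1)).
    + change (S n) with (1 + n)%nat; rewrite psum_add.
      cbn [psum]; change (INR 0) with 0.
      rewrite (psum_ext _ (fun i => c i * v ^ i)); [ring|].
      intros i _; change (1 + i)%nat with (S i); cbn [d pred].
      pose proof (INR_S_pos i); field; lra.
Qed.

Lemma rat_poly_scal (c : R) (f : R -> R) :
  is_rat c -> rat_poly f -> rat_poly (fun v => c * f v).
Proof.
  intros Hq (n & d & Hd & Hf); exists n, (fun i => c * d i); split.
  - intros i; now apply is_rat_mult.
  - intros v; rewrite Hf, <- psum_scal; apply psum_ext; intros; ring.
Qed.

(** The interval (0, 2) is one period of v. Its ends are excluded because the sawtooth series of sin
    (PI n v) / n jumps there, so convergence is uniform only on compact subintervals. *)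
Definition loc_unif_cv (u : nat -> R -> R) (l : R -> R) : Prop :=
  forall delta eps, 0 < delta -> 0 < eps ->
  exists N0, forall N v, (N0 <= N)%nat -> delta <= v <= 2 - delta ->
  Rabs (u N v - l v) <= eps.

Lemma loc_unif_cv_lim (u : nat -> R -> R) (l : R -> R) (v : R) :
  loc_unif_cv u l -> 0 < v < 2 -> is_lim_seq (fun N => u N v) (l v).
Proof.
  intros H Hv; apply is_lim_seq_spec; intros eps.
  pose proof (cond_pos eps).
  destruct (H (Rmin v (2 - v)) (eps / 2)) as [N0 HN].
  - apply Rmin_glb_lt; lra.
  - lra.
  - exists N0; intros N Hle; apply Rle_lt_trans with (eps / 2); [|lra].
    apply HN; [easy|]; pose proof (Rmin_l v (2 - v)); pose proof (Rmin_r v (2 - v)); lra.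
Qed.

(** The mean value inequality on the segment from 1 to v, of length at most 1, carries uniform
    smallness of the derivatives over to the functions once they agree in the limit at the base
    point 1. *)
Lemma loc_unif_cv_antiderivative (U u : nat -> R -> R) (L l : R -> R) :
  (forall N v, is_derive (U N) v (u N v)) -> (forall v, is_derive L v (l v)) ->
  loc_unif_cv u l -> is_lim_seq (fun N => U N 1) (L 1) -> loc_unif_cv U L.
Proof.
  intros HU HL Hu H1 delta eps Hd He.
  destruct (Hu delta (eps / 2)) as [N1 HN1]; [easy|lra|].
  apply is_lim_seq_spec in H1.
  destruct (H1 (mkposreal (eps / 2) ltac:(lra))) as [N2 HN2]; simpl in HN2.
  exists (N1 + N2)%nat; intros N v HN Hv.
  assert (HB : norm (minus (U N v - L v) (U N 1 - L 1)) <= eps / 2 * Rabs (v - 1)).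
  { apply (bounded_variation (fun w => U N w - L w) (fun w => u N w - l w)).
    intros t Ht; split; [now apply (is_derive_minus (U N) L)|].
    apply HN1; [lia|].
    assert (Rabs (v - 1) <= 1 - delta) by (apply Rabs_le; lra).
    assert (Ht' : Rabs (t - 1) <= 1 - delta) by lra.
    apply Rabs_le_between in Ht'; lra. }
  assert (Rabs (v - 1) <= 1) by (apply Rabs_le; lra).
  assert (HC := HN2 N ltac:(lia)); apply Rabs_def2 in HC.
  assert (HB' : Rabs ((U N v - L v) - (U N 1 - L 1)) <= eps / 2).
  { eapply Rle_trans; [exact HB|]; nra. }
  apply Rabs_le_between in HB'; apply Rabs_le; lra.
Qed.

Lemma dirichlet_kernel (v : R) (N : nat) :
  2 * sin (PI * v / 2) * (/ 2 + cos_sum 0 v N) = sin (INR (2 * N + 1) * (PI * v / 2)).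
Proof.
  induction N as [|N IH].
  - unfold cos_sum; simpl; rewrite Rmult_1_l; field.
  - unfold cos_sum in *; cbn [psum].
    rewrite <- Rplus_assoc, Rmult_plus_distr_l, IH; cbn [pow]; rewrite Rdiv_1_r.
    replace (INR (2 * S N + 1)) with (2 * INR (S N) + 1)
      by (rewrite plus_INR, mult_INR; simpl; ring).
    replace (INR (2 * N + 1)) with (2 * INR (S N) - 1)
      by (rewrite plus_INR, mult_INR, S_INR; simpl; ring).
    set (y := PI * v / 2).
    replace (PI * INR (S N) * v) with (2 * INR (S N) * y) by (unfold y; field).
    rewrite Rmult_minus_distr_r, Rmult_plus_distr_r, sin_minus, sin_plus, Rmult_1_l; ring.
Qed.

Lemma sin_half_bound (delta v : R) :
  0 < delta -> delta <= v <= 2 - delta -> 0 < sin (PI * delta / 2) <= sin (PI * v / 2).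
Proof.
  intros Hd Hv; pose proof PI_RGT_0 as Hpi; split; [apply sin_gt_0; nra|].
  destruct (Rle_dec v 1) as [H|H].
  - apply sin_incr_1; nra.
  - replace (sin (PI * v / 2)) with (sin (PI * (2 - v) / 2)).
    + apply sin_incr_1; nra.
    + replace (PI * (2 - v) / 2) with (PI - PI * v / 2) by field; apply sin_PI_x.
Qed.

Lemma sin_sum_at_1 (p N : nat) : sin_sum p 1 N = 0.
Proof.
  unfold sin_sum; rewrite (psum_ext _ (fun _ => 0)), psum_const; [ring|].
  intros i _; rewrite Rmult_1_r, sin_INR_PI; unfold Rdiv; ring.
Qed.

(** Integration by parts of the Dirichlet kernel: the derivative of the added cosine quotient
    cancels the oscillating kernel sin (k y) / sin y, and what remains carries the factor 1 / k with
    k = 2 N + 1. *)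
Lemma is_derive_sin_sum_corrected (v : R) (N : nat) :
  sin (PI * v / 2) <> 0 ->
  is_derive (fun w => sin_sum 1 w N + PI / 2 * w
      + / INR (2 * N + 1) * (cos (INR (2 * N + 1) * (PI * w / 2)) / sin (PI * w / 2)))
    v (- (/ INR (2 * N + 1) * (PI / 2)
       * (cos (INR (2 * N + 1) * (PI * v / 2)) * cos (PI * v / 2) / sin (PI * v / 2) ^ 2))).
Proof.
  intros Hs; assert (Hk : 0 < INR (2 * N + 1)) by (apply lt_0_INR; lia).
  pose proof (dirichlet_kernel v N) as HD.
  set (k := INR (2 * N + 1)) in *; clearbody k.
  evar_last.
  - apply (is_derive_plus (fun w => sin_sum 1 w N + PI / 2 * w)).
    + apply (is_derive_plus (fun w => sin_sum 1 w N)); [apply is_derive_sin_sum|].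
      auto_derive; [easy|reflexivity].
    + auto_derive; [easy|reflexivity].
  - unfold plus; simpl.
    replace (cos_sum 0 v N) with (sin (k * (PI * v / 2)) / (2 * sin (PI * v / 2)) - / 2)
      by (rewrite <- HD; field; easy).
    unfold Rdiv; rewrite ?Rmult_1_r, ?Rmult_1_l; fold (PI * v / 2).
    change (PI * v * / 2) with (PI * v / 2); field; lra.
Qed.

Lemma sin_sum_1_cv : loc_unif_cv (fun N v => sin_sum 1 v N) (fun v => PI / 2 * (1 - v)).
Proof.
  intros delta eps Hd He; pose proof PI_RGT_0 as Hpi.
  set (s := sin (PI * delta / 2)).
  assert (Hs1 : forall w, delta <= w <= 2 - delta -> 0 < s <= sin (PI * w / 2))
    by (intros; now apply sin_half_bound).
  (* The part 1 / s bounds the correction term at v, the part PI / 2 / s^2 the variation of the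
     corrected sum between 1 and v; both come with the factor 1 / (2 N + 1). *)
  set (C := / s + PI / 2 * / s ^ 2).
  exists (Z.to_nat (up (C / eps))); intros N v HN Hv.
  assert (Hs : 0 < s) by (destruct (Hs1 v Hv); lra).
  assert (HC : 0 < C).
  { unfold C; pose proof (Rinv_0_lt_compat _ Hs).
    pose proof (Rinv_0_lt_compat (s ^ 2) ltac:(nra)); nra. }
  assert (Hk : C / eps <= INR (2 * N + 1)).
  { destruct (archimed (C / eps)) as [Hup _].
    assert (0 < C / eps) by (apply Rdiv_lt_0_compat; lra).
    assert (Hz : (0 < up (C / eps))%Z) by (apply lt_IZR; lra).
    left; eapply Rlt_le_trans; [exact Hup|].
    rewrite INR_IZR_INZ; apply IZR_le; lia. }
  assert (Hk0 : 0 < INR (2 * N + 1)) by (apply lt_0_INR; lia).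
  assert (HD := fun w (Hw : sin (PI * w / 2) <> 0) => is_derive_sin_sum_corrected w N Hw).
  assert (HkC : / INR (2 * N + 1) * C <= eps).
  { apply Rmult_le_reg_l with (INR (2 * N + 1)); [easy|].
    rewrite <- Rmult_assoc, Rinv_r, Rmult_1_l by lra.
    apply Rmult_le_compat_r with (r := eps) in Hk; [|lra].
    unfold Rdiv in Hk; rewrite Rmult_assoc, Rinv_l in Hk; lra. }
  assert (Hat1 : cos (INR (2 * N + 1) * (PI * 1 / 2)) = 0).
  { rewrite plus_INR, mult_INR; change (INR 1) with 1; change (INR 2) with 2.
    replace ((2 * INR N + 1) * (PI * 1 / 2)) with (PI * INR N + PI / 2) by field.
    rewrite cos_plus, cos_PI2, sin_INR_PI; ring. }
  pose proof (sin_sum_at_1 1 N) as Hsn1.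
  set (k := INR (2 * N + 1)) in *; clearbody k.
  set (F w := sin_sum 1 w N + PI / 2 * w + / k * (cos (k * (PI * w / 2)) / sin (PI * w / 2))).
  set (dF w := - (/ k * (PI / 2)
       * (cos (k * (PI * w / 2)) * cos (PI * w / 2) / sin (PI * w / 2) ^ 2))).
  assert (Hik : 0 < / k) by now apply Rinv_0_lt_compat.
  assert (Hcos : forall x, Rabs (cos x) <= 1).
  { intros x; apply Rabs_le; pose proof (COS_bound x); lra. }
  assert (HB : norm (minus (F v) (F 1)) <= (/ k * (PI / 2 * / s ^ 2)) * Rabs (v - 1)).
  { apply (bounded_variation F dF).
    intros t Ht.
    assert (Rabs (v - 1) <= 1 - delta) by (apply Rabs_le; lra).
    assert (Ht' : Rabs (t - 1) <= 1 - delta) by lra.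
    apply Rabs_le_between in Ht'.
    destruct (Hs1 t ltac:(lra)) as [_ Hst].
    split; [apply HD; lra|].
    change (Rabs (- (/ k * (PI / 2)
       * (cos (k * (PI * t / 2)) * cos (PI * t / 2) * / sin (PI * t / 2) ^ 2)))
       <= / k * (PI / 2 * / s ^ 2)).
    rewrite Rabs_Ropp, !Rabs_mult, (Rabs_pos_eq (/ k)), (Rabs_pos_eq (PI / 2)) by lra.
    rewrite (Rabs_pos_eq (/ sin (PI * t / 2) ^ 2)) by (left; apply Rinv_0_lt_compat; nra).
    assert (Hinv : / sin (PI * t / 2) ^ 2 <= / s ^ 2)
      by (apply Rinv_le_contravar; nra).
    assert (0 < / sin (PI * t / 2) ^ 2) by (apply Rinv_0_lt_compat; nra).
    rewrite (Rmult_assoc (/ k)); apply Rmult_le_compat_l; [lra|].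
    apply Rmult_le_compat_l; [lra|].
    eapply Rle_trans; [|exact Hinv].
    rewrite <- (Rmult_1_l (/ sin (PI * t / 2) ^ 2)) at 2.
    apply Rmult_le_compat_r; [lra|].
    rewrite <- (Rmult_1_l 1); apply Rmult_le_compat; auto using Rabs_pos. }
  assert (HF1 : F 1 = PI / 2).
  { unfold F; rewrite Hat1, Hsn1; unfold Rdiv; ring. }
  assert (Hv1 : Rabs (v - 1) <= 1) by (apply Rabs_le; lra).
  assert (Hq : 0 < PI / 2 * / s ^ 2).
  { apply Rmult_lt_0_compat; [lra|apply Rinv_0_lt_compat; nra]. }
  assert (HB' : Rabs (F v - F 1) <= / k * (PI / 2 * / s ^ 2)).
  { eapply Rle_trans; [exact HB|]; assert (0 < / k * (PI / 2 * / s ^ 2)) by nra; nra. }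
  assert (Hcorr : Rabs (/ k * (cos (k * (PI * v / 2)) / sin (PI * v / 2))) <= / k * / s).
  { destruct (Hs1 v Hv) as [_ Hsv]; unfold Rdiv at 1.
    rewrite !Rabs_mult, (Rabs_pos_eq (/ k)) by lra; apply Rmult_le_compat_l; [lra|].
    rewrite (Rabs_pos_eq (/ sin _)) by (left; apply Rinv_0_lt_compat; lra).
    assert (/ sin (PI * v / 2) <= / s) by (apply Rinv_le_contravar; lra).
    assert (0 < / sin (PI * v / 2)) by (apply Rinv_0_lt_compat; lra).
    specialize (Hcos (k * (PI * v / 2))); pose proof (Rabs_pos (cos (k * (PI * v / 2)))); nra. }
  rewrite HF1 in HB'; unfold F in HB'; unfold C in HkC.
  apply Rabs_le_between in HB', Hcorr; apply Rabs_le; lra.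
Qed.

Lemma Rabs_cos_le_1 (x : R) : Rabs (cos x) <= 1.
Proof. apply Rabs_le; pose proof (COS_bound x); lra. Qed.

Lemma ex_series_cos_sum (p : nat) (v : R) :
  (2 <= p)%nat -> ex_series (fun i => cos (PI * INR (S i) * v) / INR (S i) ^ p).
Proof.
  intros Hp; apply (@ex_series_le R_AbsRing R_CompleteNormedModule _ (fun i => / INR (S i) ^ p)).
  - intros i; change (Rabs (cos (PI * INR (S i) * v) / INR (S i) ^ p) <= / INR (S i) ^ p).
    pose proof (INR_S_pow_pos i p) as H; apply Rinv_0_lt_compat in H.
    unfold Rdiv; rewrite Rabs_mult, (Rabs_pos_eq (/ _)) by lra.
    pose proof (Rabs_cos_le_1 (PI * INR (S i) * v)); nra.
  - now apply ex_series_inv_pow.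
Qed.

(** Shifting v by 1 multiplies the n-th cosine by (-1)^n: odd terms cancel, even terms double. *)
Lemma cos_sum_duplication (p : nat) (v : R) (N : nat) :
  cos_sum p v (2 * N) + cos_sum p (v + 1) (2 * N) = 2 / 2 ^ p * cos_sum p (2 * v) N.
Proof.
  assert (H2 : 2 ^ p <> 0) by (apply pow_nonzero; lra).
  induction N as [|N IH]; [unfold cos_sum; simpl; ring|].
  replace (2 * S N)%nat with (S (S (2 * N))) by lia.
  unfold cos_sum in *; cbn [psum].
  replace (S (S (2 * N))) with (2 * S N)%nat by lia.
  set (k := S N) in *.
  assert (Hk : 0 < INR k) by (apply INR_S_pos).
  assert (HA : cos (PI * INR (S (2 * N)) * (v + 1)) = - cos (PI * INR (S (2 * N)) * v)).
  { replace (PI * INR (S (2 * N)) * (v + 1))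
      with (PI * INR (S (2 * N)) * v + PI + 2 * (IZR (Z.of_nat N) * PI))
      by (rewrite S_INR, mult_INR, IZR_of_nat; simpl; ring).
    rewrite cos_shift_period; apply neg_cos. }
  assert (HB : cos (PI * INR (2 * k) * (v + 1)) = cos (PI * INR k * (2 * v))).
  { replace (PI * INR (2 * k) * (v + 1))
      with (PI * INR k * (2 * v) + 2 * (IZR (Z.of_nat k) * PI))
      by (rewrite mult_INR, IZR_of_nat; simpl; ring).
    apply cos_shift_period. }
  assert (HC : cos (PI * INR (2 * k) * v) = cos (PI * INR k * (2 * v)))
    by (f_equal; rewrite mult_INR; simpl; ring).
  rewrite HA, HB, HC, Rmult_plus_distr_l, <- IH.
  replace (INR (2 * k) ^ p) with (2 ^ p * INR k ^ p)
    by (rewrite mult_INR, Rpow_mult_distr; reflexivity).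
  pose proof (pow_nonzero (INR k) p ltac:(lra)).
  pose proof (INR_S_pow_pos (2 * N) p).
  field; repeat split; lra.
Qed.

Definition cos_series (p : nat) (v : R) : R :=
  Series (fun i => cos (PI * INR (S i) * v) / INR (S i) ^ p).

Lemma cos_sum_cv (p : nat) (v : R) :
  (2 <= p)%nat -> is_lim_seq (cos_sum p v) (cos_series p v).
Proof. intros Hp; apply is_series_psum, Series_correct, ex_series_cos_sum, Hp. Qed.

Lemma cos_series_duplication (p : nat) (v : R) :
  (2 <= p)%nat ->
  cos_series p v + cos_series p (v + 1) = 2 / 2 ^ p * cos_series p (2 * v).
Proof.
  intros Hp.
  assert (Hsub : filterlim (fun N => (2 * N)%nat) eventually eventually)
    by (apply eventually_subseq; intros; lia).
  assert (H1 : is_lim_seq (fun N => cos_sum p v (2 * N) + cos_sum p (v + 1) (2 * N))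
                 (cos_series p v + cos_series p (v + 1))).
  { apply is_lim_seq_plus'; apply (is_lim_seq_subseq (cos_sum p _)); auto using cos_sum_cv. }
  assert (H2 : is_lim_seq (fun N => cos_sum p v (2 * N) + cos_sum p (v + 1) (2 * N))
                 (2 / 2 ^ p * cos_series p (2 * v))).
  { eapply is_lim_seq_ext; [intros N; symmetry; apply cos_sum_duplication|].
    apply (is_lim_seq_scal_l _ _ (cos_series p (2 * v))); now apply cos_sum_cv. }
  exact (is_lim_seq_eq _ _ _ H1 H2).
Qed.

Lemma cos_sum_period (p : nat) (v : R) (k : Z) (N : nat) :
  cos_sum p (v + 2 * IZR k) N = cos_sum p v N.
Proof.
  apply psum_ext; intros i _; f_equal.
  replace (PI * INR (S i) * (v + 2 * IZR k))
    with (PI * INR (S i) * v + 2 * (IZR (Z.of_nat (S i) * k) * PI))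
    by (rewrite mult_IZR, IZR_of_nat; ring).
  apply cos_shift_period.
Qed.

Lemma sin_sum_period (p : nat) (v : R) (k : Z) (N : nat) :
  sin_sum p (v + 2 * IZR k) N = sin_sum p v N.
Proof.
  apply psum_ext; intros i _; f_equal.
  replace (PI * INR (S i) * (v + 2 * IZR k))
    with (PI * INR (S i) * v + 2 * (IZR (Z.of_nat (S i) * k) * PI))
    by (rewrite mult_IZR, IZR_of_nat; ring).
  apply sin_shift_period.
Qed.

Lemma cos_series_period (p : nat) (v : R) (k : Z) :
  cos_series p (v + 2 * IZR k) = cos_series p v.
Proof.
  apply Series_ext; intros i; f_equal.
  replace (PI * INR (S i) * (v + 2 * IZR k))
    with (PI * INR (S i) * v + 2 * (IZR (Z.of_nat (S i) * k) * PI))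
    by (rewrite mult_IZR, IZR_of_nat; ring).
  apply cos_shift_period.
Qed.

Lemma cos_series_opp (p : nat) (v : R) : cos_series p (- v) = cos_series p v.
Proof.
  apply Series_ext; intros i; f_equal; rewrite <- cos_neg; f_equal; ring.
Qed.

Ltac rat := repeat first
  [ assumption | simple apply is_rat_IZR | simple apply is_rat_INR | simple apply is_rat_plus
  | simple apply is_rat_minus | simple apply is_rat_mult | simple apply is_rat_opp
  | simple apply is_rat_div | simple apply is_rat_inv | simple apply is_rat_pow ].

(* Duplication at v = 1/2 and v = 1 determines the values at 1 and 0 from the
   difference of the values at 1/2 and 1. *)
Lemma cos_series_at_1 (p : nat) (k : R) :
  (2 <= p)%nat -> is_rat k ->
  cos_series p (/ 2) - cos_series p 1 = PI ^ p * k ->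
  exists c, is_rat c /\ cos_series p 1 = PI ^ p * c.
Proof.
  intros Hp Hk H.
  pose proof (cos_series_duplication p (/ 2) Hp) as HD.
  replace (/ 2 + 1) with (- / 2 + 2 * IZR 1) in HD by (simpl; field).
  rewrite cos_series_period, cos_series_opp, Rinv_r in HD by lra.
  assert (Hpow : 2 <= 2 ^ p).
  { replace 2 with (2 ^ 1) at 1 by ring; apply Rle_pow; [lra|lia]. }
  exists (k / (/ 2 ^ p - 1)); split; [rat|].
  assert (/ 2 ^ p < 1) by (rewrite <- Rinv_1; apply Rinv_lt_contravar; lra).
  assert (HE : cos_series p 1 * (/ 2 ^ p - 1) = PI ^ p * k) by (unfold Rdiv in HD; nra).
  apply Rmult_eq_reg_r with (/ 2 ^ p - 1); [|lra].
  rewrite HE; field; split; lra.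
Qed.

Lemma cos_series_at_0 (p : nat) (c : R) :
  (2 <= p)%nat -> is_rat c -> cos_series p 1 = PI ^ p * c ->
  exists d, is_rat d /\ cos_series p 0 = PI ^ p * d.
Proof.
  intros Hp Hc H.
  pose proof (cos_series_duplication p 1 Hp) as HD.
  replace (2 * 1) with (0 + 2 * IZR 1) in HD by (simpl; ring).
  replace (1 + 1) with (0 + 2 * IZR 1) in HD by (simpl; ring).
  rewrite cos_series_period, H in HD.
  assert (Hpow : 4 <= 2 ^ p).
  { replace 4 with (2 ^ 2) by ring; apply Rle_pow; [lra|lia]. }
  exists (c / (2 / 2 ^ p - 1)); split; [rat|].
  assert (/ 2 ^ p <= / 4) by (apply Rinv_le_contravar; lra).
  apply Rmult_eq_reg_r with (2 / 2 ^ p - 1); [|unfold Rdiv; lra].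
  transitivity (PI ^ p * c); [lra|field; split; [|lra]].
  intros E; lra.
Qed.

(** Alternate integration starting from the sawtooth. Sine sums vanish at 1, which fixes their
    constant. The constant of a cosine sum is an unknown series value at 1, whose rationality over
    PI^p has to be obtained from the duplication formula. *)
Lemma sin_cos_sums_cv (k : nat) :
  (exists f, rat_poly f /\
     loc_unif_cv (fun N v => sin_sum (2 * k + 1) v N) (fun v => PI ^ (2 * k + 1) * f v)) /\
  (exists g, rat_poly g /\
     loc_unif_cv (fun N v => cos_sum (2 * k + 2) v N) (fun v => PI ^ (2 * k + 2) * g v)).
Proof.
  assert (Hcos : forall p f, (1 <= p)%nat -> rat_poly f ->
    loc_unif_cv (fun N v => sin_sum p v N) (fun v => PI ^ p * f v) ->
    exists g, rat_poly g /\
      loc_unif_cv (fun N v => cos_sum (S p) v N) (fun v => PI ^ S p * g v)).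
  { intros p f Hp Hf Hcv.
    (* A provisional antiderivative vanishing at 1; the limit is PI^(p+1) G plus the still unknown
       value at 1. Comparing 1/2 with 1 then makes that value computable. *)
    destruct (rat_poly_antiderivative (fun v => - (1) * f v) 0) as (G & HG & HG1 & HG').
    { apply rat_poly_scal; [apply is_rat_opp, (is_rat_IZR 1)|easy]. }
    { apply (is_rat_IZR 0). }
    assert (Hcvk : forall K, K 1 = PI ^ S p * 0 + cos_series (S p) 1 ->
       (forall v, is_derive K v (- PI * (PI ^ p * f v))) ->
       loc_unif_cv (fun N v => cos_sum (S p) v N) K).
    { intros K HK HK'.
      apply (loc_unif_cv_antiderivative _ (fun N v => - PI * sin_sum p v N) _
        (fun v => - PI * (PI ^ p * f v))).
      - intros N v; apply is_derive_cos_sum.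
      - exact HK'.
      - intros delta eps Hd He; pose proof PI_RGT_0 as Hpi.
        destruct (Hcv delta (eps / PI) Hd ltac:(apply Rdiv_lt_0_compat; lra)) as [N0 HN0].
        exists N0; intros N v HN Hv; specialize (HN0 N v HN Hv).
        rewrite <- Rmult_minus_distr_l, Rabs_mult, Rabs_Ropp, (Rabs_pos_eq PI) by lra.
        apply Rmult_le_compat_l with (r := PI) in HN0; [|lra].
        replace (PI * (eps / PI)) with eps in HN0 by (field; lra); lra.
      - rewrite HK, Rmult_0_r, Rplus_0_l; apply cos_sum_cv; lia. }
    set (K v := PI ^ S p * G v + cos_series (S p) 1).
    assert (HK : loc_unif_cv (fun N v => cos_sum (S p) v N) K).
    { apply Hcvk; [unfold K; now rewrite HG1|].
      intros v; unfold K; evar_last.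
      - apply (is_derive_plus (fun v => PI ^ S p * G v)); [|apply (is_derive_const (cos_series (S p) 1))].
        apply (is_derive_scal G), HG'.
      - unfold plus, zero; simpl; ring. }
    destruct (cos_series_at_1 (S p) (G (/ 2))) as (c & Hc & Hc1); [lia| | |].
    { apply rat_poly_value; [easy|apply is_rat_inv, (is_rat_IZR 2)]. }
    { pose proof (loc_unif_cv_lim _ _ (/ 2) HK ltac:(lra)) as HL.
      pose proof (cos_sum_cv (S p) (/ 2) ltac:(lia)) as HL'.
      rewrite <- (is_lim_seq_eq _ _ _ HL HL'); unfold K; ring. }
    (* The antiderivative is chosen again, now with the correct rational constant [c]. *)
    destruct (rat_poly_antiderivative (fun v => - (1) * f v) c) as (H & HH & HH1 & HH').
    { apply rat_poly_scal; [apply is_rat_opp, (is_rat_IZR 1)|easy]. }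
    { easy. }
    exists H; split; [easy|]; apply Hcvk; [rewrite HH1, Hc1; ring|].
    intros v; evar_last; [apply (is_derive_scal H), HH'|simpl; ring]. }
  assert (Hsin : forall p g, rat_poly g ->
    loc_unif_cv (fun N v => cos_sum p v N) (fun v => PI ^ p * g v) ->
    exists f, rat_poly f /\
      loc_unif_cv (fun N v => sin_sum (S p) v N) (fun v => PI ^ S p * f v)).
  { intros p g Hg Hcv.
    destruct (rat_poly_antiderivative g 0) as (G & HG & HG1 & HG'); [easy|apply (is_rat_IZR 0)|].
    exists G; split; [easy|].
    apply (loc_unif_cv_antiderivative _ (fun N v => PI * cos_sum p v N) _
        (fun v => PI * (PI ^ p * g v))).
    - intros N v; apply is_derive_sin_sum.
    - intros v; evar_last; [apply (is_derive_scal G), HG'|simpl; ring].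
    - intros delta eps Hd He; pose proof PI_RGT_0 as Hpi.
      destruct (Hcv delta (eps / PI) Hd ltac:(apply Rdiv_lt_0_compat; lra)) as [N0 HN0].
      exists N0; intros N v HN Hv; specialize (HN0 N v HN Hv).
      rewrite <- Rmult_minus_distr_l, Rabs_mult, (Rabs_pos_eq PI) by lra.
      apply Rmult_le_compat_l with (r := PI) in HN0; [|lra].
      replace (PI * (eps / PI)) with eps in HN0 by (field; lra); lra.
    - rewrite HG1, Rmult_0_r; eapply is_lim_seq_ext; [|apply is_lim_seq_const].
      intros N; symmetry; apply sin_sum_at_1. }
  assert (Hboth : forall p f, (1 <= p)%nat -> rat_poly f ->
    loc_unif_cv (fun N v => sin_sum p v N) (fun v => PI ^ p * f v) ->
    (exists f, rat_poly f /\
       loc_unif_cv (fun N v => sin_sum p v N) (fun v => PI ^ p * f v)) /\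
    (exists g, rat_poly g /\
       loc_unif_cv (fun N v => cos_sum (S p) v N) (fun v => PI ^ S p * g v)))
    by (intros p f Hp Hf H; split; eauto).
  induction k as [|k [_ [g [Hg Hgcv]]]].
  - apply (Hboth 1%nat (fun v => / 2 * (1 + - v))); [lia| |].
    + exists 2%nat, (fun i => match i with O => / 2 | _ => - / 2 end); split.
      * intros [|i]; [|apply is_rat_opp]; apply is_rat_inv, (is_rat_IZR 2).
      * intros v; simpl; ring.
    + intros delta eps Hd He; destruct (sin_sum_1_cv delta eps Hd He) as [N0 HN0].
      exists N0; intros N v HN Hv; specialize (HN0 N v HN Hv).
      replace (PI ^ 1 * (/ 2 * (1 + - v))) with (PI / 2 * (1 - v)) by field; exact HN0.
  - destruct (Hsin _ g Hg Hgcv) as (f & Hf & Hfcv).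
    replace (2 * S k + 1)%nat with (S (2 * k + 2)) by lia.
    replace (2 * S k + 2)%nat with (S (S (2 * k + 2))) by lia.
    apply (Hboth _ f); [lia|easy|easy].
Qed.

Lemma is_rat_mod_2 (v : R) :
  is_rat v -> exists (w : R) (k : Z), is_rat w /\ 0 <= w < 2 /\ v = w + 2 * IZR k.
Proof.
  intros Hv; set (k := (up (v / 2) - 1)%Z).
  exists (v - 2 * IZR k), k; split; [|split].
  - rat.
  - destruct (archimed (v / 2)); unfold k; rewrite minus_IZR; lra.
  - ring.
Qed.

Lemma cos_sum_rat_cv (k : nat) (v : R) :
  is_rat v -> exists q, is_rat q /\
  is_lim_seq (cos_sum (2 * k + 2) v) (PI ^ (2 * k + 2) * q).
Proof.
  intros Hv; destruct (is_rat_mod_2 v Hv) as (w & z & Hw & Hw2 & ->).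
  destruct (sin_cos_sums_cv k) as [_ (g & Hg & Hcv)].
  destruct (Req_dec w 0) as [->|Hw0].
  (* The end point 0 lies outside the range of [loc_unif_cv]; the value there follows from the value
     at 1 by duplication. *)
  - destruct (cos_series_at_0 (2 * k + 2) (g 1)) as (d & Hd & Hd0).
    + lia.
    + apply rat_poly_value; [easy|apply (is_rat_IZR 1)].
    + pose proof (loc_unif_cv_lim _ _ 1 Hcv ltac:(lra)) as HL.
      pose proof (cos_sum_cv (2 * k + 2) 1 ltac:(lia)) as HL'.
      exact (is_lim_seq_eq _ _ _ HL' HL).
    + exists d; split; [easy|]; rewrite <- Hd0, <- (cos_series_period _ _ z).
      apply cos_sum_cv; lia.
  - exists (g w); split; [now apply rat_poly_value|].
    eapply is_lim_seq_ext; [intros N; symmetry; apply cos_sum_period|].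
    apply (loc_unif_cv_lim _ _ w Hcv); lra.
Qed.

Lemma sin_sum_rat_cv (k : nat) (v : R) :
  is_rat v -> exists q, is_rat q /\
  is_lim_seq (sin_sum (2 * k + 1) v) (PI ^ (2 * k + 1) * q).
Proof.
  intros Hv; destruct (is_rat_mod_2 v Hv) as (w & z & Hw & Hw2 & ->).
  destruct (sin_cos_sums_cv k) as [(f & Hf & Hcv) _].
  destruct (Req_dec w 0) as [->|Hw0].
  - exists 0; split; [apply (is_rat_IZR 0)|]; rewrite Rmult_0_r.
    eapply is_lim_seq_ext; [|apply is_lim_seq_const].
    intros N; rewrite sin_sum_period; symmetry; unfold sin_sum.
    rewrite (psum_ext _ (fun _ => 0)), psum_const; [ring|].
    intros i _; rewrite Rmult_0_r, sin_0; unfold Rdiv; ring.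
  - exists (f w); split; [now apply rat_poly_value|].
    eapply is_lim_seq_ext; [intros N; symmetry; apply sin_sum_period|].
    apply (loc_unif_cv_lim _ _ w Hcv); lra.
Qed.

(** For even p this is twice the one-sided cosine sum; for odd p, where no polynomial formula is
    available, the terms at n and - n cancel. *)
Lemma tsum_cos_cv (p : nat) (v : R) :
  (1 <= p)%nat -> is_rat v -> exists q, is_rat q /\
  is_lim_seq (tsum (fun n => cos (PI * v * IZR n) / IZR n ^ p)) (PI ^ p * q).
Proof.
  intros Hp Hv.
  assert (Ht : forall N, tsum (fun n => cos (PI * v * IZR n) / IZR n ^ p) N
            = (1 + / (-1) ^ p) * cos_sum p v N).
  { intros N; unfold tsum, cos_sum; rewrite <- psum_scal.
    apply psum_ext; intros i _; rewrite opp_IZR, IZR_of_nat.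
    replace (PI * v * - INR (S i)) with (- (PI * INR (S i) * v)) by ring.
    replace (PI * v * INR (S i)) with (PI * INR (S i) * v) by ring.
    replace (- INR (S i)) with (-1 * INR (S i)) by ring.
    rewrite cos_neg, Rpow_mult_distr.
    pose proof (INR_S_pow_pos i p); pose proof (pow_nonzero (-1) p ltac:(lra)).
    field; lra. }
  destruct (Nat.Even_or_Odd p) as [[k Hk]|[k Hk]].
  - destruct k as [|k]; [lia|]; destruct (cos_sum_rat_cv k v Hv) as (q & Hq & Hcv).
    replace (2 * k + 2)%nat with p in Hcv by lia.
    exists ((1 + / (-1) ^ p) * q); split; [rat|].
    eapply is_lim_seq_ext; [intros N; symmetry; apply Ht|].
    replace (PI ^ p * ((1 + / (-1) ^ p) * q)) with ((1 + / (-1) ^ p) * (PI ^ p * q)) by ring.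
    now apply (is_lim_seq_scal_l _ _ (PI ^ p * q)).
  - exists 0; split; [apply (is_rat_IZR 0)|]; rewrite Rmult_0_r.
    eapply is_lim_seq_ext; [|apply is_lim_seq_const].
    intros N; rewrite Ht, Hk, pow_add, pow_1_even; field.
Qed.

(** The mirror image of the cosine case: even p cancels in pairs, odd p doubles the one-sided
    sum. *)
Lemma tsum_sin_cv (p : nat) (v : R) :
  (1 <= p)%nat -> is_rat v -> exists q, is_rat q /\
  is_lim_seq (tsum (fun n => sin (PI * v * IZR n) / IZR n ^ p)) (PI ^ p * q).
Proof.
  intros Hp Hv.
  assert (Ht : forall N, tsum (fun n => sin (PI * v * IZR n) / IZR n ^ p) N
            = (1 - / (-1) ^ p) * sin_sum p v N).
  { intros N; unfold tsum, sin_sum; rewrite <- psum_scal.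
    apply psum_ext; intros i _; rewrite opp_IZR, IZR_of_nat.
    replace (PI * v * - INR (S i)) with (- (PI * INR (S i) * v)) by ring.
    replace (PI * v * INR (S i)) with (PI * INR (S i) * v) by ring.
    replace (- INR (S i)) with (-1 * INR (S i)) by ring.
    rewrite sin_neg, Rpow_mult_distr.
    pose proof (INR_S_pow_pos i p); pose proof (pow_nonzero (-1) p ltac:(lra)).
    field; lra. }
  destruct (Nat.Even_or_Odd p) as [[k Hk]|[k Hk]].
  - exists 0; split; [apply (is_rat_IZR 0)|]; rewrite Rmult_0_r.
    eapply is_lim_seq_ext; [|apply is_lim_seq_const].
    intros N; rewrite Ht, Hk, pow_1_even; field.
  - destruct (sin_sum_rat_cv k v Hv) as (q & Hq & Hcv).
    replace (2 * k + 1)%nat with p in Hcv by lia.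
    exists ((1 - / (-1) ^ p) * q); split; [rat|].
    eapply is_lim_seq_ext; [intros N; symmetry; apply Ht|].
    replace (PI ^ p * ((1 - / (-1) ^ p) * q)) with ((1 - / (-1) ^ p) * (PI ^ p * q)) by ring.
    now apply (is_lim_seq_scal_l _ _ (PI ^ p * q)).
Qed.

(** * Partial fractions of the secant *)

Definition alt_sum (y : R) (n : nat) : R := psum (fun i => (-1) ^ i / (y + INR i)) n.

(** Removing the first term leaves 1 / y minus the same kind of sum at y + 1, so the bracket
    reproduces itself. *)
Lemma alt_sum_pos (y : R) (n : nat) : 0 < y -> 0 <= alt_sum y n <= / y.
Proof.
  unfold alt_sum; revert y; induction n as [|n IH]; intros y Hy.
  - pose proof (Rinv_0_lt_compat y Hy); simpl; lra.
  - change (S n) with (1 + n)%nat; rewrite psum_add; cbn [psum].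
    rewrite (psum_ext _ (fun i => (-1) * ((-1) ^ i / ((y + 1) + INR i)))), psum_scal.
    + specialize (IH (y + 1) ltac:(lra)).
      assert (/ (y + 1) <= / y) by (apply Rinv_le_contravar; lra).
      rewrite Rplus_0_r; simpl; lra.
    + intros i _; change (1 + i)%nat with (S i); rewrite S_INR; simpl.
      replace (y + (INR i + 1)) with (y + 1 + INR i) by ring; unfold Rdiv; ring.
Qed.

(** With all denominators negative the terms grow in size towards the end, so the last term
    dominates and the induction adds terms at the end. *)
Lemma alt_sum_neg (y : R) (n : nat) :
  y + INR n < 0 -> / (y + INR n) <= (-1) ^ n * alt_sum y (S n) <= 0.
Proof.
  unfold alt_sum; induction n as [|n IH]; intros Hy.
  - simpl in *; pose proof (Rinv_lt_0_compat (y + 0) Hy); lra.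
  - rewrite S_INR in *; cbn [psum]; cbn [psum] in IH; specialize (IH ltac:(lra)).
    rewrite S_INR.
    assert (/ (y + INR n) >= / (y + (INR n + 1))).
    { apply Rle_ge, Ropp_le_cancel; rewrite <- !Rinv_opp; apply Rinv_le_contravar; lra. }
    assert (Hsq : (-1) ^ n * (-1) ^ n = 1)
      by (rewrite <- Rpow_mult_distr; replace (-1 * -1) with 1 by ring; apply pow1).
    set (s := (-1) ^ n) in *; set (T := psum _ n) in *.
    replace ((-1) ^ S n) with (- s) by (unfold s; simpl; ring).
    replace (- s * (T + s / (y + INR n) + - s / (y + (INR n + 1))))
      with (- (s * (T + s / (y + INR n))) + s * s * / (y + (INR n + 1)))
      by (unfold Rdiv; ring).
    rewrite Hsq; lra.
Qed.

Lemma Rabs_pow_m1 (n : nat) : Rabs ((-1) ^ n) = 1.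
Proof. rewrite <- RPow_abs, Rabs_left by lra; replace (- -1) with 1 by ring; apply pow1. Qed.

Lemma alt_sum_neg_abs (y : R) (n : nat) :
  y + INR n < 0 -> Rabs (alt_sum y (S n)) <= / - (y + INR n).
Proof.
  intros Hy; pose proof (alt_sum_neg y n Hy) as H; rewrite Rinv_opp.
  rewrite <- (Rmult_1_l (Rabs _)), <- (Rabs_pow_m1 n), <- Rabs_mult.
  apply Rabs_le; lra.
Qed.

Lemma Rabs_sin_le (x : R) : Rabs (sin x) <= Rabs x.
Proof.
  destruct (Rle_lt_dec 0 x) as [H|H].
  - destruct (Req_dec x 0) as [->|H0]; [rewrite sin_0; lra|].
    rewrite (Rabs_pos_eq x) by easy; apply Rabs_le; split.
    + destruct (Rle_dec 1 x); [pose proof (SIN_bound x); lra|].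
      pose proof PI2_1; pose proof (sin_gt_0 x ltac:(lra) ltac:(lra)); lra.
    + left; apply sin_lt_x; lra.
  - rewrite <- (Rabs_Ropp (sin x)), <- sin_neg, (Rabs_left x) by easy.
    apply Rabs_le; split.
    + destruct (Rle_dec 1 (- x)); [pose proof (SIN_bound (- x)); lra|].
      pose proof PI2_1; pose proof (sin_gt_0 (- x) ltac:(lra) ltac:(lra)); lra.
    + left; apply sin_lt_x; lra.
Qed.

Lemma Rabs_sin_shift (y : R) (i : nat) : Rabs (sin (PI * (y + INR i))) = Rabs (sin (PI * y)).
Proof.
  replace (PI * (y + INR i)) with (PI * y + PI * INR i) by ring.
  assert (H : Rabs (cos (PI * INR i)) = 1).
  { pose proof (sin2_cos2 (PI * INR i)) as H; rewrite sin_INR_PI in H; unfold Rsqr in H.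
    pose proof (Rabs_pos (cos (PI * INR i))).
    assert (Rabs (cos (PI * INR i)) * Rabs (cos (PI * INR i)) = 1)
      by (rewrite <- Rabs_mult, Rabs_pos_eq; nra).
    nra. }
  rewrite sin_plus, sin_INR_PI, Rmult_0_r, Rplus_0_r, Rabs_mult, H; ring.
Qed.

(** An integer shift preserves |sin (PI y)|, and |sin (PI (y + i))| <= PI |y + i|. *)
Lemma inv_dist_le_cosec (y t : R) (i : nat) :
  sin (PI * y) <> 0 -> Rabs t = Rabs (y + INR i) ->
  / Rabs t <= PI * / Rabs (sin (PI * y)).
Proof.
  intros Hs Ht; pose proof PI_RGT_0 as Hpi.
  assert (Hp := Rabs_pos_lt _ Hs).
  pose proof (Rabs_sin_le (PI * (y + INR i))) as H.
  rewrite Rabs_sin_shift, Rabs_mult, (Rabs_pos_eq PI), <- Ht in H by lra.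
  assert (0 < Rabs t) by nra.
  apply Rmult_le_reg_l with (Rabs t); [easy|].
  rewrite Rinv_r by lra.
  apply Rmult_le_reg_r with (Rabs (sin (PI * y))); [easy|].
  rewrite Rmult_assoc, (Rmult_assoc PI), Rinv_l by lra; lra.
Qed.

(** The sum splits where y + i changes sign. Each half is an alternating sum bounded by its term
    nearest to the pole, hence by PI / |sin (PI y)|. Uniformity in n is what later yields domination
    by |sec|. *)
Lemma alt_sum_bound (y : R) (n : nat) :
  sin (PI * y) <> 0 -> Rabs (alt_sum y n) <= 2 * PI * / Rabs (sin (PI * y)).
Proof.
  intros Hs; pose proof PI_RGT_0 as Hpi.
  assert (Hp := Rinv_0_lt_compat _ (Rabs_pos_lt _ Hs)).
  assert (Hpos : forall i m, 0 < y + INR i ->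
            Rabs (alt_sum (y + INR i) m) <= PI * / Rabs (sin (PI * y))).
  { intros i m Hi; destruct (alt_sum_pos _ m Hi) as [H1 H2].
    rewrite Rabs_pos_eq by easy; eapply Rle_trans; [exact H2|].
    rewrite <- (Rabs_pos_eq (y + INR i)) by lra; now apply (inv_dist_le_cosec y _ i). }
  assert (Hneg : forall m, y + INR m < 0 ->
            Rabs (alt_sum y (S m)) <= PI * / Rabs (sin (PI * y))).
  { intros m Hm; eapply Rle_trans; [now apply alt_sum_neg_abs|].
    rewrite <- (Rabs_pos_eq (- (y + INR m))) by lra.
    apply (inv_dist_le_cosec y _ m); [easy|apply Rabs_Ropp]. }
  assert (Hn0 : forall i, y + INR i <> 0).
  { intros i H; apply Hs; pose proof (Rabs_sin_shift y i) as HH.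
    rewrite H, Rmult_0_r, sin_0, Rabs_R0 in HH; symmetry in HH.
    destruct (Req_dec (sin (PI * y)) 0) as [|Hc]; [easy|].
    pose proof (Rabs_pos_lt _ Hc); lra. }
  destruct (Rlt_dec 0 y) as [Hy|Hy].
  { specialize (Hpos O n); simpl in Hpos; rewrite Rplus_0_r in Hpos; nra. }
  destruct (archimed (- y)) as [Hu1 Hu2].
  assert (Hj : exists j, y + INR j < 0 < y + INR (S j)).
  { assert (Hz : (0 < up (- y))%Z) by (apply lt_IZR; lra).
    exists (Z.to_nat (up (- y) - 1)).
    pose proof (Hn0 (Z.to_nat (up (- y) - 1))) as HH.
    rewrite S_INR, <- IZR_of_nat, Z2Nat.id, minus_IZR in * by lia; lra. }
  destruct Hj as [j [Hj1 Hj2]].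
  destruct (le_lt_dec n (S j)) as [Hn|Hn].
  - destruct n as [|m]; [unfold alt_sum; simpl; rewrite Rabs_R0; nra|].
    assert (INR m <= INR j) by (apply le_INR; lia).
    specialize (Hneg m ltac:(lra)); nra.
  - replace n with (S j + (n - S j))%nat by lia.
    unfold alt_sum; rewrite psum_add.
    eapply Rle_trans; [apply Rabs_triang|].
    rewrite (psum_ext (fun i => (-1) ^ (S j + i) / (y + INR (S j + i)))
               (fun i => (-1) ^ S j * ((-1) ^ i / (y + INR (S j) + INR i)))), psum_scal.
    + rewrite Rabs_mult, Rabs_pow_m1, Rmult_1_l.
      specialize (Hneg j Hj1); specialize (Hpos (S j) (n - S j)%nat Hj2).
      unfold alt_sum in *; lra.
    + intros i _; rewrite pow_add, plus_INR, Rplus_assoc; unfold Rdiv; ring.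
Qed.

Lemma sin_lower_bound (x : R) : 0 <= x <= PI / 2 -> x / 3 <= sin x.
Proof.
  intros Hx; pose proof PI_RGT_0; pose proof PI_4.
  pose proof (SIN x ltac:(lra) ltac:(lra)) as [H1 _].
  unfold sin_lb, sin_approx, sin_term in H1; simpl in H1.
  eapply Rle_trans; [|exact H1].
  (* The Taylor bound is x - x^3 / 6 + x^5 (42 - x^2) / 5040; with x <= 2, from PI <= 4, it is at
     least x - 4 x / 6 = x / 3. *)
  assert (0 <= x ^ 5 * (42 - x ^ 2)).
  { apply Rmult_le_pos; [apply pow_le; lra|nra]. }
  assert (x ^ 3 <= 4 * x) by nra.
  field_simplify; lra.
Qed.

(** * Partial sums of the secant expansion as integrals of a Dirichlet kernel *)

Lemma dirichlet_kernel_odd (u : R) (K : nat) :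
  2 * sin (PI * u) * psum (fun k => cos ((2 * INR k + 1) * PI * u)) K
  = sin (2 * INR K * PI * u).
Proof.
  induction K as [|K IH].
  - simpl; rewrite !Rmult_0_r, !Rmult_0_l, sin_0; ring.
  - cbn [psum]; rewrite Rmult_plus_distr_l, IH, S_INR.
    set (k := INR K).
    replace (2 * (k + 1) * PI * u) with ((2 * k + 1) * PI * u + PI * u) by ring.
    replace (2 * k * PI * u) with ((2 * k + 1) * PI * u - PI * u) by ring.
    rewrite sin_plus, sin_minus; ring.
Qed.

(* The antiderivative vanishing at 0 of
   [u |-> cos (2 PI x u) * sum_(k < K) cos ((2k+1) PI u)]. *)
Definition sec_primitive (x : R) (K : nat) (u : R) : R :=
  psum (fun k => / 2 * (sin ((2 * INR k + 1 + 2 * x) * PI * u) / ((2 * INR k + 1 + 2 * x) * PI)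
                 + sin ((2 * INR k + 1 - 2 * x) * PI * u) / ((2 * INR k + 1 - 2 * x) * PI))) K.

Lemma half_odd_neq (x : R) (k : nat) :
  cos (PI * x) <> 0 -> 2 * INR k + 1 + 2 * x <> 0 /\ 2 * INR k + 1 - 2 * x <> 0.
Proof.
  assert (Hk : cos (PI * (INR k + / 2)) = 0).
  { rewrite Rmult_plus_distr_l; change (PI * / 2) with (PI / 2).
    rewrite cos_plus, cos_PI2, sin_INR_PI; ring. }
  intros Hx; split; intros H; apply Hx.
  - rewrite <- Hk, <- cos_neg; f_equal; replace x with (- (INR k + / 2)) by lra; ring.
  - rewrite <- Hk; f_equal; replace x with (INR k + / 2) by lra; ring.
Qed.

Lemma is_derive_sec_primitive (x : R) (K : nat) (u : R) :
  cos (PI * x) <> 0 ->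
  is_derive (sec_primitive x K) u
    (cos (2 * PI * x * u) * psum (fun k => cos ((2 * INR k + 1) * PI * u)) K).
Proof.
  intros Hx; rewrite <- psum_scal; pose proof PI_RGT_0.
  apply (is_derive_psum
    (fun k u => / 2 * (sin ((2 * INR k + 1 + 2 * x) * PI * u) / ((2 * INR k + 1 + 2 * x) * PI)
                 + sin ((2 * INR k + 1 - 2 * x) * PI * u) / ((2 * INR k + 1 - 2 * x) * PI)))
    (fun k u => cos (2 * PI * x * u) * cos ((2 * INR k + 1) * PI * u))).
  intros k _; destruct (half_odd_neq x k Hx) as [H1 H2].
  set (a := 2 * INR k + 1) in *.
  auto_derive; [easy|].
  replace ((a + 2 * x) * PI * u) with (a * PI * u + 2 * PI * x * u) by ring.
  replace ((a + - (2 * x)) * PI * u) with (a * PI * u - 2 * PI * x * u) by ring.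
  replace ((a - 2 * x) * PI * u) with (a * PI * u - 2 * PI * x * u) by ring.
  rewrite cos_plus, cos_minus; field; lra.
Qed.

Lemma sec_primitive_0 (x : R) (K : nat) : sec_primitive x K 0 = 0.
Proof.
  unfold sec_primitive; rewrite (psum_ext _ (fun _ => 0)), psum_const; [ring|].
  intros k _; rewrite !Rmult_0_r, sin_0; unfold Rdiv; ring.
Qed.

Lemma cos_INR_PI (k : nat) : cos (PI * INR k) = (-1) ^ k.
Proof.
  induction k as [|k IH]; [simpl; now rewrite Rmult_0_r, cos_0|].
  rewrite S_INR, Rmult_plus_distr_l, Rmult_1_r, neg_cos, IH; simpl; ring.
Qed.

(** At u = 1/2 both sines become (-1)^k cos (PI x), so the integral over [0, 1/2] is, up to a
    factor, a symmetric partial sum of the expansion of PI sec (PI x). *)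
Lemma sec_primitive_half (x : R) (K : nat) :
  cos (PI * x) <> 0 ->
  sec_primitive x K (/ 2) = cos (PI * x) / (4 * PI)
    * psum (fun k => (-1) ^ k * (/ (INR k + / 2 - x) + / (INR k + / 2 + x))) K.
Proof.
  intros Hx; unfold sec_primitive; rewrite <- psum_scal; apply psum_ext; intros k _.
  destruct (half_odd_neq x k Hx) as [H1 H2]; pose proof PI_RGT_0.
  replace ((2 * INR k + 1 + 2 * x) * PI * / 2) with ((PI * INR k + PI * x) + PI / 2) by field.
  replace ((2 * INR k + 1 - 2 * x) * PI * / 2) with ((PI * INR k - PI * x) + PI / 2) by field.
  rewrite !(sin_plus _ (PI / 2)), cos_PI2, sin_PI2, cos_plus, cos_minus, sin_INR_PI, cos_INR_PI.
  field; repeat split; lra.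
Qed.

Lemma Rabs_sin_sq_le (a u : R) : sin (a * u) ^ 2 <= a ^ 2 * u ^ 2.
Proof.
  pose proof (Rabs_sin_le (a * u)) as H.
  rewrite <- pow2_abs; replace (a ^ 2 * u ^ 2) with (Rabs (a * u) ^ 2)
    by (rewrite pow2_abs; ring).
  apply pow_incr; split; [apply Rabs_pos|easy].
Qed.

(** A quantitative Riemann-Lebesgue lemma. Subtracting the case x = 0 replaces cos (2 PI x u) by - 2
    sin (PI x u)^2, which cancels the singularity of the kernel at u = 0; integration by parts
    against sin (2 K PI u) then gains 1 / K. *)
Lemma sec_primitive_remainder (x : R) (K : nat) :
  cos (PI * x) <> 0 -> (0 < K)%nat ->
  Rabs (sec_primitive x K (/ 2) - sec_primitive 0 K (/ 2))
    <= (2 * (PI * x) ^ 2 + PI * (PI * x) ^ 2 + 1) / (2 * INR K * PI).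
Proof.
  intros Hx HK; pose proof PI_RGT_0 as Hpi; pose proof PI2_3_2 as Hpi3.
  assert (HK0 : 0 < INR K) by (now apply lt_0_INR).
  set (h u := sin (PI * x * u) ^ 2 / sin (PI * u)).
  set (dh u := 2 * (PI * x) * (sin (PI * x * u) * cos (PI * x * u)) / sin (PI * u)
        - PI * (sin (PI * x * u) ^ 2 * cos (PI * u)) / sin (PI * u) ^ 2).
  set (D u := sec_primitive x K u - sec_primitive 0 K u).
  set (L := 2 * INR K * PI).
  assert (HL : 0 < L) by (unfold L; nra).
  (* Since D' = - h sin (L u), subtracting the boundary term of the integration by parts leaves G' =
     - h' cos (L u) / L. *)
  set (G u := D u - h u * (cos (L * u) / L)).
  (* A bound for |h'| on (0, 1/2], from |sin (PI x u)| <= PI |x| u and sin (PI u) >= u. The extra 1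
     in the statement pays for the boundary term, as h (1/2) <= 1. *)
  set (C := 2 * (PI * x) ^ 2 + PI * (PI * x) ^ 2).
  assert (HC : 0 <= C) by (unfold C; nra).
  assert (Hsin : forall u, 0 < u <= / 2 -> u <= sin (PI * u)).
  { intros u Hu; eapply Rle_trans; [|apply sin_lower_bound]; nra. }
  assert (HdD : forall u, is_derive D u ((cos (2 * PI * x * u) - 1)
                 * psum (fun k => cos ((2 * INR k + 1) * PI * u)) K)).
  { intros u; evar_last.
    - apply (is_derive_minus (sec_primitive x K) (sec_primitive 0 K));
        apply is_derive_sec_primitive; [easy|rewrite Rmult_0_r, cos_0; lra].
    - unfold minus, plus, opp; simpl; rewrite Rmult_0_r, Rmult_0_l, cos_0; ring. }
  assert (HdG : forall u, 0 < u <= / 2 -> is_derive G u (- (dh u * (cos (L * u) / L)))).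
  { intros u Hu; pose proof (Hsin u Hu) as Hs.
    pose proof (dirichlet_kernel_odd u K) as HDK.
    evar_last.
    - apply (is_derive_minus D (fun u => h u * (cos (L * u) / L))); [apply HdD|].
      apply (is_derive_mult h (fun u => cos (L * u) / L)).
      + apply (is_derive_ext (fun u => sin (PI * x * u) ^ 2 / sin (PI * u))); [easy|].
        instantiate (1 := dh u); unfold dh; auto_derive; [lra|].
        simpl; field; lra.
      + instantiate (1 := - sin (L * u)); auto_derive; [easy|]; field; lra.
      + intros; apply Rmult_comm.
    - unfold minus, plus, opp, mult; simpl.
      replace (psum (fun k => cos ((2 * INR k + 1) * PI * u)) K)
        with (sin (L * u) / (2 * sin (PI * u))).
      2: { unfold L; rewrite <- HDK; field; lra. }
      replace (2 * PI * x * u) with (2 * (PI * x * u)) by ring.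
      rewrite cos_2a_sin; unfold h; simpl; field; lra. }
  assert (Hdh : forall u, 0 < u <= / 2 -> Rabs (dh u) <= C).
  { intros u Hu; pose proof (Hsin u Hu) as Hs; unfold dh, C.
    pose proof (Rabs_sin_le (PI * x * u)) as Ha; rewrite (Rabs_mult (PI * x)), (Rabs_pos_eq u) in Ha by lra.
    pose proof (Rabs_sin_sq_le (PI * x) u) as Hb.
    pose proof (Rabs_cos_le_1 (PI * x * u)) as Hc; pose proof (Rabs_cos_le_1 (PI * u)) as Hd.
    set (a := PI * x) in *; set (s := sin (PI * u)) in *.
    eapply Rle_trans; [apply Rabs_triang|]; rewrite Rabs_Ropp; apply Rplus_le_compat.
    - unfold Rdiv; rewrite !Rabs_mult, (Rabs_pos_eq (/ s)) by (left; apply Rinv_0_lt_compat; lra).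
      rewrite (Rabs_pos_eq 2) by lra.
      apply Rmult_le_reg_r with s; [lra|].
      rewrite Rmult_assoc, Rinv_l, Rmult_1_r, <- (pow2_abs a) by lra.
      pose proof (Rabs_pos a); pose proof (Rabs_pos (sin (a * u))); pose proof (Rabs_pos (cos (a * u))).
      assert (Rabs (sin (a * u)) * Rabs (cos (a * u)) <= Rabs a * u) by nra.
      assert (Rabs a * u <= Rabs a * s) by nra.
      rewrite Rmult_assoc, (Rmult_assoc 2); apply Rmult_le_compat_l; [lra|].
      simpl; rewrite Rmult_1_r, Rmult_assoc; apply Rmult_le_compat_l; lra.
    - unfold Rdiv; rewrite !Rabs_mult, (Rabs_pos_eq (/ s ^ 2)) by (left; apply Rinv_0_lt_compat; nra).
      rewrite (Rabs_pos_eq PI), (Rabs_pos_eq (_ ^ 2)) by (try lra; apply pow2_ge_0).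
      apply Rmult_le_reg_r with (s ^ 2); [nra|].
      rewrite Rmult_assoc, Rinv_l, Rmult_1_r by nra.
      rewrite Rmult_assoc; apply Rmult_le_compat_l; [lra|].
      pose proof (Rabs_pos (cos (PI * u))); pose proof (pow2_ge_0 (sin (a * u))).
      assert (u ^ 2 <= s ^ 2) by (apply pow_incr; lra).
      pose proof (pow2_ge_0 a); nra. }
  assert (HGb : forall delta, 0 < delta <= / 2 -> Rabs (G (/ 2) - G delta) <= C / L).
  { intros delta Hdel.
    assert (HB : norm (minus (G (/ 2)) (G delta)) <= C / L * Rabs (/ 2 - delta)).
    { destruct (MVT_gen G delta (/ 2) (fun u => - (dh u * (cos (L * u) / L)))) as (c & Hc & HGc).
      - rewrite Rmin_left, Rmax_right by lra; intros u Hu; apply HdG; lra.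
      - rewrite Rmin_left, Rmax_right by lra; intros u Hu.
        apply derivable_continuous_pt; exists (- (dh u * (cos (L * u) / L))).
        apply is_derive_Reals, HdG; lra.
      - rewrite Rmin_left, Rmax_right in Hc by lra.
        change (Rabs (G (/ 2) - G delta) <= C / L * Rabs (/ 2 - delta)).
        rewrite HGc, Rabs_mult; apply Rmult_le_compat_r; [apply Rabs_pos|].
        unfold Rdiv; rewrite Rabs_Ropp, !Rabs_mult, (Rabs_pos_eq (/ L))
          by (left; now apply Rinv_0_lt_compat).
        specialize (Hdh c ltac:(lra)); pose proof (Rabs_cos_le_1 (L * c)).
        pose proof (Rabs_pos (dh c)); pose proof (Rabs_pos (cos (L * c))).
        rewrite <- Rmult_assoc; apply Rmult_le_compat_r; [left; now apply Rinv_0_lt_compat|nra]. }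
    eapply Rle_trans; [exact HB|].
    assert (0 <= C / L) by (apply Rmult_le_pos; [easy|left; now apply Rinv_0_lt_compat]).
    rewrite Rabs_pos_eq by lra; nra. }
  assert (HhL : forall u, Rabs (cos (L * u) / L) <= / L).
  { intros u; unfold Rdiv; rewrite Rabs_mult, (Rabs_pos_eq (/ L))
      by (left; now apply Rinv_0_lt_compat).
    pose proof (Rabs_cos_le_1 (L * u)); pose proof (Rinv_0_lt_compat _ HL); nra. }
  (* The quotient defining h is singular at 0, so the lower limit is a small [delta]: D tends to 0
     by continuity and h (delta) = O(delta). *)
  assert (HGhalf : Rabs (G (/ 2)) <= C / L).
  { apply le_epsilon; intros eps He.
    assert (HD0 : continuity_pt D 0).
    { apply derivable_continuous_pt; eexists; apply is_derive_Reals, HdD. }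
    destruct (HD0 (eps / 2) ltac:(lra)) as [alp [Halp HDc]].
    set (B := (PI * x) ^ 2 * / L).
    assert (HB : 0 <= B).
    { apply Rmult_le_pos; [apply pow2_ge_0|left; now apply Rinv_0_lt_compat]. }
    set (delta := Rmin (/ 2) (Rmin (alp / 2) (eps / (2 * (B + 1))))).
    assert (Hdel : 0 < delta).
    { unfold delta; repeat apply Rmin_glb_lt; try lra.
      apply Rdiv_lt_0_compat; lra. }
    assert (Hd1 : delta <= / 2) by apply Rmin_l.
    assert (Hd2 : delta <= alp / 2) by (eapply Rle_trans; [apply Rmin_r|apply Rmin_l]).
    assert (Hd3 : delta <= eps / (2 * (B + 1))) by (eapply Rle_trans; [apply Rmin_r|apply Rmin_r]).
    assert (HDd : Rabs (D delta) < eps / 2).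
    { specialize (HDc delta); unfold D_x, no_cond, dist in HDc; simpl in HDc.
      unfold Rdist in HDc; replace (D 0) with 0 in HDc
        by (unfold D; rewrite !sec_primitive_0; ring).
      rewrite !Rminus_0_r in HDc; apply HDc; split; [split; [easy|lra]|].
      rewrite Rabs_pos_eq; lra. }
    assert (Hhd : Rabs (h delta * (cos (L * delta) / L)) <= eps / 2).
    { rewrite Rabs_mult; pose proof (Hsin delta ltac:(lra)) as Hs.
      pose proof (Rabs_sin_sq_le (PI * x) delta) as Hsq.
      assert (Hh : Rabs (h delta) <= (PI * x) ^ 2 * delta).
      { unfold h; rewrite Rabs_pos_eq.
        - apply Rmult_le_reg_r with (sin (PI * delta)); [lra|].
          unfold Rdiv; rewrite Rmult_assoc, Rinv_l, Rmult_1_r by lra.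
          pose proof (pow2_ge_0 (PI * x)); nra.
        - apply Rmult_le_pos; [apply pow2_ge_0|left; apply Rinv_0_lt_compat; lra]. }
      specialize (HhL delta).
      apply Rle_trans with ((PI * x) ^ 2 * delta * / L).
      - apply Rmult_le_compat; auto using Rabs_pos.
      - replace ((PI * x) ^ 2 * delta * / L) with (B * delta) by (unfold B; ring).
        apply Rmult_le_compat_l with (r := 2 * (B + 1)) in Hd3; [|lra].
        replace (2 * (B + 1) * (eps / (2 * (B + 1)))) with eps in Hd3 by (field; lra).
        nra. }
    specialize (HGb delta ltac:(lra)).
    assert (HGd : Rabs (G delta) <= Rabs (D delta) + Rabs (h delta * (cos (L * delta) / L))).
    { unfold G; eapply Rle_trans; [apply Rabs_triang|]; rewrite Rabs_Ropp; lra. }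
    replace (G (/ 2)) with ((G (/ 2) - G delta) + G delta) by ring.
    eapply Rle_trans; [apply Rabs_triang|]; lra. }
  replace (sec_primitive x K (/ 2) - sec_primitive 0 K (/ 2))
    with (G (/ 2) + h (/ 2) * (cos (L * / 2) / L)) by (unfold G, D; ring).
  eapply Rle_trans; [apply Rabs_triang|].
  replace ((C + 1) / L) with (C / L + 1 * / L) by (unfold Rdiv; ring).
  apply Rplus_le_compat; [easy|].
  rewrite Rabs_mult; apply Rmult_le_compat; auto using Rabs_pos.
  unfold h; change (PI * / 2) with (PI / 2); rewrite sin_PI2, Rdiv_1_r.
  rewrite Rabs_pos_eq by apply pow2_ge_0.
  pose proof (SIN_bound (PI * x * / 2)); nra.
Qed.

Lemma leibniz_lim :
  is_lim_seq (psum (fun k => (-1) ^ k / (2 * INR k + 1))) (PI / 4).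
Proof.
  assert (H : PI / 4 = Alt_PI / 4) by (now rewrite Alt_PI_eq).
  rewrite H; clear H; unfold Alt_PI; destruct exist_PI as [l Hl].
  replace (4 * l / 4) with l by field.
  apply is_lim_seq_incr_1; apply is_lim_seq_Reals in Hl.
  eapply is_lim_seq_ext; [|exact Hl].
  intros n; unfold tg_alt, PI_tg; induction n as [|n IH].
  - simpl; field.
  - cbn [sum_f_R0]; rewrite IH; cbn [psum]; f_equal.
    unfold Rdiv; f_equal; f_equal; rewrite plus_INR, mult_INR; reflexivity.
Qed.

(** The primitives for x and for 0 have the same limit at 1/2, and for 0 it is 1/4 by Leibniz's
    series. *)
Lemma sec_symmetric_sum (x : R) :
  cos (PI * x) <> 0 ->
  is_lim_seq (psum (fun k => (-1) ^ k * (/ (INR k + / 2 - x) + / (INR k + / 2 + x))))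
    (PI / cos (PI * x)).
Proof.
  intros Hx; pose proof PI_RGT_0 as Hpi.
  set (C := 2 * (PI * x) ^ 2 + PI * (PI * x) ^ 2 + 1).
  assert (Hinv : is_lim_seq (fun K => C / (2 * INR K * PI)) 0).
  { apply is_lim_seq_ext with (fun K => C / (2 * PI) * / INR K).
    - intros K; unfold Rdiv; rewrite !Rinv_mult; ring.
    - replace (Finite 0) with (Rbar_mult (C / (2 * PI)) (Rbar_inv p_infty))
        by (simpl; f_equal; ring).
      apply is_lim_seq_scal_l, is_lim_seq_inv; [apply is_lim_seq_INR|easy]. }
  assert (HD : is_lim_seq (fun K => sec_primitive x K (/ 2) - sec_primitive 0 K (/ 2)) 0).
  { apply is_lim_seq_abs_0, (is_lim_seq_le_le_loc (fun _ => 0) _ (fun K => C / (2 * INR K * PI)));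
      [|apply is_lim_seq_const|easy].
    exists 1%nat; intros K HK; split; [apply Rabs_pos|].
    apply sec_primitive_remainder; [easy|lia]. }
  assert (H0 : is_lim_seq (fun K => sec_primitive 0 K (/ 2)) (/ 4)).
  { replace (/ 4) with (/ PI * (PI / 4)) by (field; lra).
    eapply is_lim_seq_ext; [|apply (is_lim_seq_scal_l (psum (fun k => (-1) ^ k / (2 * INR k + 1))) (/ PI) (PI / 4)), leibniz_lim].
    intros K; rewrite sec_primitive_half, Rmult_0_r, cos_0 by (rewrite Rmult_0_r, cos_0; lra).
    rewrite <- !psum_scal; apply psum_ext; intros k _.
    pose proof (pos_INR k); field; lra. }
  apply is_lim_seq_ext with (fun K => 4 * PI / cos (PI * x)
     * ((sec_primitive x K (/ 2) - sec_primitive 0 K (/ 2)) + sec_primitive 0 K (/ 2))).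
  - intros K; rewrite sec_primitive_half by easy; field; lra.
  - replace (PI / cos (PI * x)) with (4 * PI / cos (PI * x) * (0 + / 4)) by (field; lra).
    apply (is_lim_seq_scal_l _ _ (0 + / 4)); now apply is_lim_seq_plus'.
Qed.

(** * The periodic lattice function *)

Definition zsign (k : Z) : R := if Z.even k then 1 else -1.

Lemma zsign_succ (k : Z) : zsign (Z.succ k) = - zsign k.
Proof.
  unfold zsign; rewrite Z.even_succ, <- Z.negb_even; destruct (Z.even k); simpl; lra.
Qed.

Lemma zsign_add_even (k j : Z) : zsign (k + 2 * j) = zsign k.
Proof. unfold zsign; now rewrite Z.even_add_mul_2. Qed.

Lemma zsign_opp (k : Z) : zsign (- k) = zsign k.
Proof. unfold zsign; now rewrite Z.even_opp. Qed.

Lemma Rabs_zsign (k : Z) : Rabs (zsign k) = 1.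
Proof. unfold zsign; destruct (Z.even k); [apply Rabs_R1|rewrite Rabs_left; lra]. Qed.

Lemma zsign_add_nat (k : Z) (i : nat) : zsign (k + Z.of_nat i) = zsign k * (-1) ^ i.
Proof.
  induction i as [|i IH]; [simpl; rewrite Z.add_0_r; ring|].
  replace (k + Z.of_nat (S i))%Z with (Z.succ (k + Z.of_nat i)) by lia.
  rewrite zsign_succ, IH; simpl; ring.
Qed.

Lemma zsum_add (g : Z -> R) (a : Z) (n m : nat) :
  zsum g a (n + m) = zsum g a n + zsum g (a + Z.of_nat n) m.
Proof.
  unfold zsum; rewrite psum_add; f_equal.
  apply psum_ext; intros i _; f_equal; lia.
Qed.

Lemma zsum_scal (c : R) (g : Z -> R) (a : Z) (n : nat) :
  zsum (fun k => c * g k) a n = c * zsum g a n.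
Proof. apply psum_scal. Qed.

Definition sec_term (x : R) (k : Z) : R := zsign k / (IZR k + / 2 - x).

Lemma zsum_sec_term (x : R) (a : Z) (n : nat) :
  zsum (sec_term x) a n = zsign a * alt_sum (IZR a + / 2 - x) n.
Proof.
  unfold zsum, alt_sum; rewrite <- psum_scal; apply psum_ext; intros i _.
  unfold sec_term; rewrite zsign_add_nat, plus_IZR, IZR_of_nat.
  replace (IZR a + INR i + / 2 - x) with (IZR a + / 2 - x + INR i) by ring.
  unfold Rdiv; ring.
Qed.

Lemma Rabs_sin_half_integer (x : R) (a : Z) :
  Rabs (sin (PI * (IZR a + / 2 - x))) = Rabs (cos (PI * x)).
Proof.
  replace (PI * (IZR a + / 2 - x)) with (IZR a * PI + (PI / 2 - PI * x)) by field.
  assert (H : Rabs (cos (IZR a * PI)) = 1).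
  { pose proof (sin2_cos2 (IZR a * PI)) as H; rewrite sin_IZR_PI in H; unfold Rsqr in H.
    pose proof (Rabs_pos (cos (IZR a * PI))).
    assert (Rabs (cos (IZR a * PI)) * Rabs (cos (IZR a * PI)) = 1)
      by (rewrite <- Rabs_mult, Rabs_pos_eq; nra).
    nra. }
  rewrite sin_plus, sin_IZR_PI, Rmult_0_l, Rplus_0_l, Rabs_mult, H, Rmult_1_l.
  now rewrite sin_shift.
Qed.

Lemma zsum_sec_term_bound (x : R) (a : Z) (n : nat) :
  cos (PI * x) <> 0 -> Rabs (zsum (sec_term x) a n) <= 2 * PI * / Rabs (cos (PI * x)).
Proof.
  intros Hx; rewrite zsum_sec_term, Rabs_mult, Rabs_zsign, Rmult_1_l.
  rewrite <- (Rabs_sin_half_integer x a); apply alt_sum_bound.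
  intros H; pose proof (Rabs_sin_half_integer x a) as HH.
  rewrite H, Rabs_R0 in HH; pose proof (Rabs_pos_lt _ Hx); lra.
Qed.

Lemma zsum_sec_term_symmetric (x : R) (K : nat) :
  zsum (sec_term x) (- Z.of_nat K) (2 * K)
  = psum (fun k => (-1) ^ k * (/ (INR k + / 2 - x) + / (INR k + / 2 + x))) K.
Proof.
  induction K as [|K IH]; [easy|].
  replace (2 * S K)%nat with (1 + (2 * K + 1))%nat by lia.
  rewrite !zsum_add; cbn [psum]; rewrite <- IH.
  replace (- Z.of_nat (S K) + Z.of_nat 1)%Z with (- Z.of_nat K)%Z by lia.
  unfold zsum at 1 3; cbn [psum].
  replace (- Z.of_nat (S K) + Z.of_nat 0)%Z with (- Z.succ (Z.of_nat K))%Z by lia.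
  replace (- Z.of_nat K + Z.of_nat (2 * K) + Z.of_nat 0)%Z with (Z.of_nat K) by lia.
  unfold sec_term; rewrite zsign_opp, zsign_succ.
  pose proof (zsign_add_nat 0 K) as Hs; simpl in Hs; rewrite Hs.
  replace (zsign 0) with 1 by reflexivity.
  rewrite opp_IZR, succ_IZR, IZR_of_nat.
  replace (- (INR K + 1) + / 2 - x) with (- (INR K + / 2 + x)) by field.
  unfold Rdiv; rewrite Rinv_opp; ring.
Qed.

(** A row of the lattice box meets an off-centre block of indices, so symmetric sums do not suffice.
    A wide block is a symmetric core plus two alternating tails, each bounded by its term nearest to
    the core. *)
Lemma zsum_sec_term_cv (x eps : R) :
  cos (PI * x) <> 0 -> 0 < eps ->
  exists M : Z, forall (a : Z) (n : nat), (a <= - M)%Z -> (M <= a + Z.of_nat n)%Z ->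
  Rabs (zsum (sec_term x) a n - PI / cos (PI * x)) < eps.
Proof.
  intros Hx He; pose proof (sec_symmetric_sum x Hx) as HS.
  apply is_lim_seq_spec in HS.
  destruct (HS (mkposreal (eps / 2) ltac:(lra))) as [K1 HK1]; simpl in HK1.
  (* Beyond T every pole is at distance at least 8 / eps from x, so each tail is at most eps / 8. *)
  set (T := Rabs x + 8 / eps).
  assert (H8 : 0 < 8 / eps) by (apply Rdiv_lt_0_compat; lra).
  pose proof (Rabs_pos x).
  assert (HK2 : exists K2, T <= INR K2).
  { exists (Z.to_nat (up T)); destruct (archimed T) as [Hu _].
    assert (0 < up T)%Z by (apply lt_IZR; unfold T in *; lra).
    rewrite <- IZR_of_nat, Z2Nat.id by lia; lra. }
  destruct HK2 as [K2 HK2].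
  set (K := (K1 + K2)%nat).
  assert (HK : T <= INR K) by (unfold K; rewrite plus_INR; pose proof (pos_INR K1); lra).
  assert (Hxb := Rabs_le_between x (Rabs x)); destruct Hxb as [Hxb _].
  specialize (Hxb (Rle_refl _)).
  assert (Hsmall : forall y, 8 / eps <= y -> / y <= eps / 8).
  { intros y Hy; replace (eps / 8) with (/ (8 / eps)) by (field; lra).
    apply Rinv_le_contravar; lra. }
  exists (Z.of_nat K); intros a n H1 H2.
  set (p := Z.to_nat (- Z.of_nat K - a)).
  set (q := Z.to_nat (a + Z.of_nat n - Z.of_nat K)).
  assert (Hn : n = (p + (2 * K + q))%nat) by (unfold p, q; lia).
  rewrite Hn, !zsum_add.
  replace (a + Z.of_nat p)%Z with (- Z.of_nat K)%Z by (unfold p; lia).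
  replace (- Z.of_nat K + Z.of_nat (2 * K))%Z with (Z.of_nat K) by lia.
  assert (Hlow : Rabs (zsum (sec_term x) a p) <= eps / 8).
  { rewrite zsum_sec_term, Rabs_mult, Rabs_zsign, Rmult_1_l.
    destruct p as [|p'] eqn:Hp; [unfold alt_sum; simpl; rewrite Rabs_R0; lra|].
    assert (Hy : IZR a + / 2 - x + INR p' = - (INR K + / 2 + x)).
    { replace p' with (Z.to_nat (- Z.of_nat K - a - 1)) by (unfold p in Hp; lia).
      rewrite <- IZR_of_nat, Z2Nat.id by (unfold p in Hp; lia).
      rewrite !minus_IZR, opp_IZR, IZR_of_nat; field. }
    eapply Rle_trans; [apply alt_sum_neg_abs|]; rewrite Hy; unfold T in *; [lra|].
    rewrite Ropp_involutive; apply Hsmall; lra. }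
  assert (Hup : Rabs (zsum (sec_term x) (Z.of_nat K) q) <= eps / 8).
  { rewrite zsum_sec_term, Rabs_mult, Rabs_zsign, Rmult_1_l, IZR_of_nat.
    destruct (alt_sum_pos (INR K + / 2 - x) q) as [H3 H4]; [unfold T in *; lra|].
    rewrite Rabs_pos_eq by easy; eapply Rle_trans; [exact H4|].
    apply Hsmall; unfold T in *; lra. }
  specialize (HK1 K ltac:(lia)); rewrite <- zsum_sec_term_symmetric in HK1.
  apply Rabs_def2 in HK1; apply Rabs_le_between in Hlow, Hup; apply Rabs_def1; lra.
Qed.

(** Turns a window of integers into a window of indices along the progression supporting [g]; the
    final inequalities locate both ends of the index window. *)
Lemma zsum_progression (g h : Z -> R) (b c a : Z) :
  (0 < b)%Z -> (forall k, g (c + b * k)%Z = h k) ->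
  (forall D, ((D - c) mod b <> 0)%Z -> g D = 0) ->
  exists k1, (c + b * (k1 - 1) < a <= c + b * k1)%Z /\
  forall len, exists len',
    zsum g a len = zsum h k1 len' /\
    (c + b * (k1 + Z.of_nat len' - 1) < a + Z.of_nat len <= c + b * (k1 + Z.of_nat len'))%Z.
Proof.
  intros Hb Hg H0.
  assert (Hk1 : exists k1, (c + b * (k1 - 1) < a <= c + b * k1)%Z).
  { exists (- ((c - a) / b))%Z.
    pose proof (Z.div_mod (c - a) b ltac:(lia)); pose proof (Z.mod_pos_bound (c - a) b Hb).
    nia. }
  destruct Hk1 as [k1 Hk1]; exists k1; split; [easy|].
  induction len as [|len [len' [IH Hl]]].
  - exists O; split; [easy|]; simpl; rewrite !Z.add_0_r; exact Hk1.
  - replace (S len) with (len + 1)%nat by lia; rewrite zsum_add, IH.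
    unfold zsum at 2; cbn [psum]; rewrite Rplus_0_l.
    replace (a + Z.of_nat len + Z.of_nat 0)%Z with (a + Z.of_nat len)%Z by lia.
    destruct (Z.eq_dec (a + Z.of_nat len) (c + b * (k1 + Z.of_nat len'))) as [E|E].
    + exists (len' + 1)%nat; split; [|nia].
      rewrite E, Hg, zsum_add; unfold zsum at 3; cbn [psum].
      now rewrite Rplus_0_l, Z.add_0_r.
    + exists len'; split; [|lia].
      rewrite H0; [ring|]; intros Hm.
      apply Z.mod_divide in Hm; [|lia]; destruct Hm as [z Hz].
      assert (a + Z.of_nat len = c + b * z)%Z by lia.
      assert (k1 + Z.of_nat len' - 1 < z)%Z by nia.
      assert (z < k1 + Z.of_nat len')%Z by nia.
      lia.
Qed.

(* [(-1)^k] at [b (2 k + 1)], and 0 at the other integers: [chi_{-4}] of [D / b]. *)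
Definition lat (b D : Z) : R :=
  if (D mod (2 * b) =? b)%Z then zsign (D / (2 * b)) else 0.

Lemma lat_odd_multiple (b k : Z) : (0 < b)%Z -> lat b (b * (2 * k + 1)) = zsign k.
Proof.
  intros Hb; unfold lat.
  replace (b * (2 * k + 1))%Z with (b + k * (2 * b))%Z by ring.
  rewrite Z.mod_add, Z.mod_small, Z.eqb_refl, Z.div_add, Z.div_small by lia; easy.
Qed.

Lemma lat_support (b D : Z) :
  (0 < b)%Z -> (exists k, D = b * (2 * k + 1))%Z \/ lat b D = 0.
Proof.
  intros Hb; unfold lat; destruct (Z.eqb_spec (D mod (2 * b)) b) as [E|E]; [left|now right].
  exists (D / (2 * b))%Z; pose proof (Z.div_mod D (2 * b) ltac:(lia)); nia.
Qed.

Lemma Rabs_lat_le_1 (b D : Z) : Rabs (lat b D) <= 1.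
Proof.
  unfold lat; destruct (_ =? _)%Z; [rewrite Rabs_zsign; lra|rewrite Rabs_R0; lra].
Qed.

(** Let t = PI D / (2 b). If cos t = 0, then D is an odd multiple of b and all b summands equal the
    sign. Otherwise, multiplication by 2 cos t telescopes the sum to a multiple of sin (PI D) = 0,
    and D is off the support. *)
Lemma lat_fourier (b D : Z) :
  (0 < b)%Z ->
  IZR b * lat b D =
  psum (fun i => (-1) ^ i * sin (INR (2 * i + 1) * (PI * IZR D / (2 * IZR b)))) (Z.to_nat b).
Proof.
  intros Hb; assert (Hb0 : 0 < IZR b) by (now apply (IZR_lt 0)).
  set (t := PI * IZR D / (2 * IZR b)).
  assert (Htel : forall B, 2 * cos t * psum (fun i => (-1) ^ i * sin (INR (2 * i + 1) * t)) B
            = - ((-1) ^ B * sin (2 * INR B * t))).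
  { induction B as [|B IH]; [|].
    { replace (2 * INR 0 * t) with 0 by (simpl; ring); rewrite sin_0; simpl; ring. }
    cbn [psum]; rewrite Rmult_plus_distr_l, IH.
    replace (2 * INR B * t) with (INR (2 * B + 1) * t - t)
      by (rewrite plus_INR, mult_INR; simpl; ring).
    replace (2 * INR (S B) * t) with (INR (2 * B + 1) * t + t)
      by (rewrite S_INR, plus_INR, mult_INR; simpl; ring).
    rewrite sin_minus, sin_plus; simpl; ring. }
  destruct (Req_dec (cos t) 0) as [Hc|Hc].
  - apply cos_eq_0_0 in Hc; destruct Hc as [k Hk].
    assert (HD : D = (b * (2 * k + 1))%Z).
    { apply eq_IZR; rewrite mult_IZR, plus_IZR, mult_IZR.
      pose proof PI_RGT_0; apply Rmult_eq_reg_l with (PI / (2 * IZR b)).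
      2: { apply Rgt_not_eq, Rdiv_lt_0_compat; lra. }
      transitivity t; [unfold t; field; lra|rewrite Hk; field; lra]. }
    rewrite HD, lat_odd_multiple by easy.
    rewrite (psum_ext _ (fun _ => zsign k)).
    + rewrite psum_const, <- IZR_of_nat, Z2Nat.id by lia; ring.
    + intros i _; rewrite Hk.
      replace (INR (2 * i + 1) * (IZR k * PI + PI / 2))
        with (PI * INR i + (IZR k * PI + PI / 2) + 2 * (IZR (Z.of_nat i * k) * PI))
        by (rewrite plus_INR, mult_INR, mult_IZR, IZR_of_nat; simpl; field).
      rewrite sin_shift_period, sin_plus, sin_INR_PI, cos_INR_PI, sin_plus, cos_PI2, sin_PI2.
      assert (Hs : cos (IZR k * PI) = zsign k).
      { unfold zsign; destruct (Z.even k) eqn:Ek.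
        - apply Z.even_spec in Ek; destruct Ek as [j ->]; rewrite mult_IZR, Rmult_assoc.
          apply cos_2IZR_PI.
        - assert (Ho : Z.odd k = true) by (rewrite <- Z.negb_even, Ek; easy).
          apply Z.odd_spec in Ho; destruct Ho as [j ->].
          rewrite plus_IZR, mult_IZR.
          replace ((2 * IZR j + 1) * PI) with (PI + 2 * (IZR j * PI)) by ring.
          rewrite cos_shift_period; apply cos_PI. }
      rewrite Hs.
      assert (Hsq : (-1) ^ i * (-1) ^ i = 1)
        by (rewrite <- Rpow_mult_distr; replace (-1 * -1) with 1 by ring; apply pow1).
      transitivity ((-1) ^ i * (-1) ^ i * zsign k); [ring|rewrite Hsq; ring].
  - assert (Hlat : lat b D = 0).
    { destruct (lat_support b D Hb) as [[k Hk]|]; [|easy]; exfalso; apply Hc.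
      unfold t; rewrite Hk, mult_IZR, plus_IZR, mult_IZR.
      replace (PI * (IZR b * (2 * IZR k + 1)) / (2 * IZR b)) with (IZR k * PI + PI / 2)
        by (field; lra).
      rewrite cos_plus, cos_PI2, sin_IZR_PI; ring. }
    rewrite Hlat, Rmult_0_r; apply Rmult_eq_reg_l with (2 * cos t); [|lra].
    rewrite Htel, Rmult_0_r.
    replace (2 * INR (Z.to_nat b) * t) with (IZR D * PI).
    + rewrite sin_IZR_PI; ring.
    + rewrite <- IZR_of_nat, Z2Nat.id by lia; unfold t; field; lra.
Qed.

(* If [n' - x n = b (2 k + 1)] then [n - x n' = b (2 k' + 1)] with [k' = k + 1] mod 2. *)
Lemma lat_swap (b x g h n n' : Z) :
  (0 < b)%Z -> (x * x = 1 + 4 * g * b)%Z -> (x = 1 + 4 * h)%Z ->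
  lat b (n - x * n') = - lat b (n' - x * n).
Proof.
  intros Hb Hx Hh.
  assert (H : forall m m' k, (m' - x * m = b * (2 * k + 1))%Z ->
    lat b (m - x * m') = - zsign k).
  { intros m m' k Hk.
    (* By 1 - x^2 = - 4 g b and x = 1 mod 4, the cofactor of b is - (2 k + 1) mod 4. It is written
       with [Z.succ k] plus an even number so that the sign can be read off. *)
    replace (m - x * m')%Z
      with (b * (2 * (Z.succ k + 2 * (- g * m - k - 1 - h * (2 * k + 1))) + 1))%Z.
    2: { replace m' with (x * m + b * (2 * k + 1))%Z by lia.
      replace (m - x * (x * m + b * (2 * k + 1)))%Z
        with (m * (1 - x * x) - x * (b * (2 * k + 1)))%Z by ring.
      rewrite Hx, Hh; ring. }
    now rewrite lat_odd_multiple, zsign_add_even, zsign_succ. }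
  destruct (lat_support b (n' - x * n) Hb) as [[k Hk]|H0].
  - now rewrite (H n n' k Hk), Hk, lat_odd_multiple.
  - destruct (lat_support b (n - x * n') Hb) as [[k Hk]|H1]; [|lra].
    rewrite Hk, lat_odd_multiple by easy.
    rewrite (H n' n k Hk); lra.
Qed.

(** For n' = x n + b k with k odd and a = x + 2 b tau, this is chi(k) / (b (k - 2 n tau)). *)
Definition lat_term (b x : Z) (a : R) (n n' : Z) : R :=
  lat b (n' - x * n) / (IZR n' - a * IZR n).

(** On the support the row is 1 / (2 b) times a block of the secant expansion at n tau. The bound,
    uniform in N, serves as the majorant for exchanging limits. *)
Lemma lat_row (b x : Z) (tau : R) (n : Z) :
  (0 < b)%Z -> cos (PI * (IZR n * tau)) <> 0 ->
  let a := IZR x + 2 * IZR b * tau in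
  let row N := zsum (lat_term b x a n) (- Z.of_nat N) (2 * N + 1) in
  (forall N, Rabs (row N) <= PI / IZR b * / Rabs (cos (PI * (IZR n * tau)))) /\
  is_lim_seq row (PI / (2 * IZR b) / cos (PI * (IZR n * tau))).
Proof.
  intros Hb Hc a row; assert (Hb0 : 0 < IZR b) by (now apply (IZR_lt 0)).
  set (y := IZR n * tau) in *.
  assert (Hrow : forall N, exists k1 len,
    row N = / (2 * IZR b) * zsum (sec_term y) k1 len /\
    (x * n + b + 2 * b * (k1 - 1) < - Z.of_nat N)%Z /\
    (- Z.of_nat N + Z.of_nat (2 * N + 1) <= x * n + b + 2 * b * (k1 + Z.of_nat len))%Z).
  { intros N.
    destruct (zsum_progression (lat_term b x a n) (fun k => / (2 * IZR b) * sec_term y k)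
      (2 * b) (x * n + b) (- Z.of_nat N)) as (k1 & Hk1 & Hlen).
    - lia.
    - intros k; unfold lat_term, sec_term, a.
      replace (x * n + b + 2 * b * k - x * n)%Z with (b * (2 * k + 1))%Z by ring.
      rewrite lat_odd_multiple, !plus_IZR, !mult_IZR by easy.
      replace (IZR x * IZR n + IZR b + 2 * IZR b * IZR k - (IZR x + 2 * IZR b * tau) * IZR n)
        with (2 * IZR b * (IZR k + / 2 - y)) by (unfold y; field).
      unfold Rdiv; rewrite Rinv_mult; ring.
    - intros D HD; unfold lat_term.
      destruct (lat_support b (D - x * n) Hb) as [[k Hk]| ->]; [|unfold Rdiv; ring].
      exfalso; apply HD; replace (D - (x * n + b))%Z with (k * (2 * b))%Z by lia.
      apply Z.mod_mul; lia.
    - destruct (Hlen (2 * N + 1)%nat) as (len & Hz & Hl).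
      exists k1, len; split; [|lia].
      unfold row; rewrite Hz; apply zsum_scal. }
  split.
  - intros N; destruct (Hrow N) as (k1 & len & -> & _).
    rewrite Rabs_mult, Rabs_pos_eq by (left; apply Rinv_0_lt_compat; lra).
    replace (PI / IZR b * / Rabs (cos (PI * y)))
      with (/ (2 * IZR b) * (2 * PI * / Rabs (cos (PI * y))))
      by (field; split; [apply Rabs_no_R0|]; lra).
    apply Rmult_le_compat_l; [left; apply Rinv_0_lt_compat; lra|].
    now apply zsum_sec_term_bound.
  - apply is_lim_seq_spec; intros eps; pose proof (cond_pos eps) as He.
    destruct (zsum_sec_term_cv y (2 * IZR b * eps) Hc ltac:(nra)) as [M HM].
    (* Large enough that the index window, of offset x n + b and step 2 b, contains [- M, M) with
       room for rounding. *)
    exists (Z.to_nat (Z.abs (x * n + b) + 2 * b * (Z.abs M + 2))).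
    intros N HN; destruct (Hrow N) as (k1 & len & -> & H1 & H2).
    specialize (HM k1 len ltac:(nia) ltac:(nia)).
    replace (/ (2 * IZR b) * zsum (sec_term y) k1 len - PI / (2 * IZR b) / cos (PI * y))
      with (/ (2 * IZR b) * (zsum (sec_term y) k1 len - PI / cos (PI * y))) by (field; lra).
    rewrite Rabs_mult, Rabs_pos_eq by (left; apply Rinv_0_lt_compat; lra).
    apply Rmult_lt_reg_l with (2 * IZR b); [lra|].
    rewrite <- Rmult_assoc, Rinv_r, Rmult_1_l by lra; exact HM.
Qed.

(** * Convergence at quadratic irrationals *)

Lemma psum_indicator_le_1 (f : nat -> nat) (v L : nat) :
  (forall i j, (i < L)%nat -> (j < L)%nat -> f i = f j -> i = j) ->
  psum (fun i => if (f i =? v)%nat then 1 else 0) L <= 1.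
Proof.
  induction L as [|L IH]; intros H; [simpl; lra|]; cbn [psum].
  destruct (Nat.eqb_spec (f L) v) as [E|E].
  - rewrite (psum_ext _ (fun _ => 0)), psum_const; [lra|].
    intros i Hi; destruct (Nat.eqb_spec (f i) v) as [E'|]; [|easy].
    specialize (H i L ltac:(lia) ltac:(lia) ltac:(congruence)); lia.
  - specialize (IH ltac:(intros; apply H; lia)); lra.
Qed.

Lemma psum_inv_injective (f : nat -> nat) (L B : nat) :
  (forall i j, (i < L)%nat -> (j < L)%nat -> f i = f j -> i = j) ->
  (forall i, (i < L)%nat -> (1 <= f i <= B)%nat) ->
  psum (fun i => / INR (f i)) L <= psum (fun b => / INR (S b)) B.
Proof.
  intros Hinj HB.
  apply Rle_trans with
    (psum (fun i => psum (fun b => / INR (S b) * (if (f i =? S b)%nat then 1 else 0)) B) L).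
  - apply psum_le; intros i Hi; specialize (HB i Hi).
    assert (Hpos : forall b, 0 <= / INR (S b) * (if (f i =? S b)%nat then 1 else 0)).
    { intros b; apply Rmult_le_pos; [left; apply Rinv_0_lt_compat, INR_S_pos|].
      destruct (f i =? S b)%nat; lra. }
    apply Rle_trans with
      (psum (fun b => / INR (S b) * (if (f i =? S b)%nat then 1 else 0)) (f i)).
    + destruct (f i) as [|b]; [lia|]; cbn [psum]; rewrite Nat.eqb_refl.
      pose proof (psum_nonneg _ b Hpos); lra.
    + apply psum_mono; [easy|lia].
  - rewrite psum_swap; apply psum_le; intros b _; rewrite psum_scal.
    pose proof (psum_indicator_le_1 f (S b) L Hinj).
    pose proof (Rinv_0_lt_compat _ (INR_S_pos b)); nra.
Qed.

(** A square root is used instead of a logarithm: it is easier to handle and loses little enough for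
    the block sums to stay summable against 1 / n^2. *)
Lemma harmonic_le_sqrt (B : nat) : psum (fun b => / INR (S b)) B <= 2 * sqrt (INR B).
Proof.
  induction B as [|B IH]; [simpl; rewrite sqrt_0; lra|]; cbn [psum].
  pose proof (INR_S_pos B) as HS; pose proof (pos_INR B) as HB.
  assert (Hu := sqrt_sqrt (INR B) HB); assert (Hv := sqrt_sqrt (INR (S B)) (Rlt_le _ _ HS)).
  assert (0 <= sqrt (INR B)) by apply sqrt_pos.
  assert (0 < sqrt (INR (S B))) by now apply sqrt_lt_R0.
  rewrite S_INR in *; set (u := sqrt (INR B)) in *; set (v := sqrt (INR B + 1)) in *.
  assert (1 <= v) by nra.
  assert (Hinv : / (INR B + 1) <= 2 * (v - u)); [|lra].
  rewrite <- Hv; apply Rmult_le_reg_l with (v * v); [nra|].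
  rewrite Rinv_r by nra; assert (u <= v) by nra; assert ((v - u) * (v + u) = 1) by nra; nra.
Qed.

(** The integer parts of y i / d are distinct because of the spacing, and lie between 1 and 1 / d.
    So the sum is at most 1 / d times a harmonic sum. *)
Lemma spaced_inv_sum (y : nat -> R) (d : R) (L : nat) :
  0 < d -> (forall i, (i < L)%nat -> d <= y i <= 1) ->
  (forall i j, (i < L)%nat -> (j < L)%nat -> i <> j -> d <= Rabs (y i - y j)) ->
  psum (fun i => / y i) L <= 2 * / d * sqrt (/ d).
Proof.
  intros Hd Hy Hs; pose proof (Rinv_0_lt_compat d Hd) as Hid.
  set (f i := nfloor (Rabs (y i) / d) (Rmult_le_pos _ _ (Rabs_pos _) (Rlt_le _ _ Hid))).
  assert (Hf : forall i, (i < L)%nat -> INR (f i) * d <= y i < (INR (f i) + 1) * d).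
  { intros i Hi; specialize (Hy i Hi); unfold f, nfloor.
    destruct (nfloor_ex _ _) as [n Hn]; simpl; rewrite Rabs_pos_eq in Hn by lra.
    replace (y i) with (y i / d * d) by (field; lra).
    split; [apply Rmult_le_compat_r|apply Rmult_lt_compat_r]; lra. }
  assert (Hf1 : forall i, (i < L)%nat -> (1 <= f i)%nat).
  { intros i Hi; specialize (Hf i Hi); specialize (Hy i Hi).
    destruct (f i); [simpl in Hf; lra|lia]. }
  destruct (nfloor_ex (/ d) ltac:(lra)) as [B HB].
  apply Rle_trans with (psum (fun i => / d * / INR (f i)) L).
  - apply psum_le; intros i Hi; specialize (Hf i Hi); specialize (Hf1 i Hi).
    assert (0 < INR (f i)) by (apply lt_0_INR; lia).
    rewrite <- Rinv_mult; apply Rinv_le_contravar; nra.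
  - rewrite psum_scal, (Rmult_comm 2), Rmult_assoc; apply Rmult_le_compat_l; [lra|].
    apply Rle_trans with (2 * sqrt (INR B)).
    + eapply Rle_trans; [|apply harmonic_le_sqrt]; apply psum_inv_injective.
      * intros i j Hi Hj E; destruct (Nat.eq_dec i j) as [|Hij]; [easy|exfalso].
        pose proof (Hf i Hi) as H1; pose proof (Hf j Hj) as H2; rewrite E in H1.
        specialize (Hs i j Hi Hj Hij).
        assert (Rabs (y i - y j) < d) by (apply Rabs_def1; lra); lra.
      * intros i Hi; split; [auto|]; specialize (Hf i Hi); specialize (Hy i Hi).
        assert (INR (f i) < INR (S B)).
        { rewrite S_INR; apply Rmult_lt_reg_r with d; [easy|].
          assert (/ d * d = 1) by (field; lra); nra. }
        apply INR_lt in H; lia.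
    + apply Rmult_le_compat_l; [lra|]; apply sqrt_le_1_alt; lra.
Qed.

Lemma psum_half_pow (J : nat) : psum (fun j => (/ 2) ^ j) J = 2 - 2 * (/ 2) ^ J.
Proof. induction J as [|J IH]; [simpl; ring|cbn [psum]; rewrite IH; simpl; field]. Qed.

(* On the block [4^j, 4^(j+1)) the sum of [/ y n] is [O(8^j)]. *)
Lemma spaced_series (y : nat -> R) (c : R) :
  0 < c -> (forall n, c / (4 * INR (S n)) <= y (S n) <= 1) ->
  (forall n m k, (n = m + S k)%nat -> c / INR (S k) <= Rabs (y n - y m)) ->
  ex_series (fun n => / y (S n) * / INR (S n) ^ 2).
Proof.
  intros Hc Hy Hs.
  (* With N = 4^j and 1 / d = 16 N / c, the bound N^(-2) (2 / d) sqrt (1 / d) equals C / sqrt N = C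
     / 2^j. *)
  set (C := 128 * / c * sqrt (/ c)).
  pose proof (Rinv_0_lt_compat c Hc) as Hic.
  assert (HC : 0 < C) by (unfold C; pose proof (sqrt_lt_R0 _ Hic); nra).
  assert (Hypos : forall n, 0 < y (S n)).
  { intros n; eapply Rlt_le_trans; [|apply Hy]; apply Rdiv_lt_0_compat; [easy|].
    pose proof (INR_S_pos n); lra. }
  set (a n := match n with O => 0 | S k => / y n * / INR n ^ 2 end).
  assert (Ha : forall n, 0 <= a n).
  { intros [|n]; simpl; [lra|]; left; apply Rmult_lt_0_compat; apply Rinv_0_lt_compat; [easy|].
    apply (INR_S_pow_pos n 2). }
  assert (Hblock : forall j, psum (fun i => a (4 ^ j + i)%nat) (3 * 4 ^ j) <= C * (/ 2) ^ j).
  { intros j; set (N := (4 ^ j)%nat).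
    assert (HN : (0 < N)%nat) by (apply Nat.neq_0_lt_0, Nat.pow_nonzero; lia).
    assert (HN0 : 0 < INR N) by now apply lt_0_INR.
    (* Indices in the block are at most 4 N, so c / (4 n) >= d, and they differ by less than 3 N, so
       the spacing is also at least d. *)
    set (d := c * / (16 * INR N)).
    assert (Hi16 : 0 < / (16 * INR N)) by (apply Rinv_0_lt_compat; lra).
    assert (Hd : 0 < d) by (unfold d; nra).
    assert (Hsub : forall i, (i < 3 * N)%nat -> exists k, (N + i = S k)%nat /\ INR (S k) <= 4 * INR N
              /\ INR N <= INR (S k)).
    { intros i Hi; exists (N + i - 1)%nat; split; [lia|].
      replace (S (N + i - 1)) with (N + i)%nat by lia.
      split; [replace 4 with (INR 4) by (simpl; ring); rewrite <- mult_INR|]; apply le_INR; lia. }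
    apply Rle_trans with (psum (fun i => / INR N ^ 2 * / y (N + i)%nat) (3 * N)).
    { apply psum_le; intros i Hi; destruct (Hsub i Hi) as (k & -> & H1 & H2).
      cbn [a]; rewrite Rmult_comm; apply Rmult_le_compat_r.
      - left; now apply Rinv_0_lt_compat.
      - apply Rinv_le_contravar; [now apply pow_lt|apply pow_incr; lra]. }
    rewrite psum_scal.
    assert (HS : psum (fun i => / y (N + i)%nat) (3 * N) <= 2 * / d * sqrt (/ d)).
    { assert (Hgap : forall i j, (i < 3 * N)%nat -> (j < i)%nat ->
                d <= Rabs (y (N + i)%nat - y (N + j)%nat)).
      { intros i k Hi Hk; eapply Rle_trans; [|apply (Hs _ _ (i - k - 1)%nat); lia].
        unfold d; apply Rmult_le_compat_l; [lra|].
        apply Rinv_le_contravar; [apply INR_S_pos|].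
        replace 16 with (INR 16) by (simpl; ring); rewrite <- mult_INR; apply le_INR; lia. }
      apply spaced_inv_sum; [easy| |].
      - intros i Hi; destruct (Hsub i Hi) as (k & -> & H1 & H2); specialize (Hy k).
        split; [|easy]; eapply Rle_trans; [|apply Hy].
        apply Rmult_le_compat_l; [lra|]; apply Rinv_le_contravar; [|lra].
        pose proof (INR_S_pos k); lra.
      - intros i k Hi Hk Hik; destruct (Nat.lt_total i k) as [H|[H|H]]; [|easy|].
        + rewrite Rabs_minus_sym; now apply Hgap.
        + now apply Hgap. }
    apply Rle_trans with (/ INR N ^ 2 * (2 * / d * sqrt (/ d))).
    { apply Rmult_le_compat_l; [left; now apply Rinv_0_lt_compat, pow_lt|easy]. }
    assert (HNj : INR N = 2 ^ j * 2 ^ j).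
    { unfold N; rewrite pow_INR, <- Rpow_mult_distr; f_equal; simpl; ring. }
    assert (H2 : 0 < 2 ^ j) by (apply pow_lt; lra).
    assert (Hsq : sqrt (/ d) = 4 * 2 ^ j * sqrt (/ c)).
    { replace (/ d) with ((4 * 2 ^ j) * (4 * 2 ^ j) * / c)
        by (unfold d; rewrite HNj; field; lra).
      rewrite sqrt_mult_alt, sqrt_square by nra; ring. }
    right; rewrite Hsq, pow_inv; unfold C, d; rewrite HNj; field; lra. }
  assert (Hpow : forall J, psum a (4 ^ J) <= a O + C * psum (fun j => (/ 2) ^ j) J).
  { induction J as [|J IH]; [simpl; lra|].
    replace (4 ^ S J)%nat with (4 ^ J + 3 * 4 ^ J)%nat by (simpl; lia).
    rewrite psum_add; cbn [psum]; specialize (Hblock J); lra. }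
  apply (ex_series_incr_1 a), (ex_series_psum_bounded a (2 * C)); [easy|].
  intros n; apply Rle_trans with (psum a (4 ^ n)).
  - apply psum_mono; [easy|]; apply Nat.lt_le_incl, Nat.pow_gt_lin_r; lia.
  - eapply Rle_trans; [apply Hpow|]; rewrite psum_half_pow; cbn [a].
    pose proof (pow_lt (/ 2) n ltac:(lra)); nra.
Qed.

(** |cos (PI n theta)| is at least the distance from n theta - 1/2 to the nearest integer, i.e. the
    smaller of y and 1 - y for its fractional part y. Bad approximability at n - m spaces these
    numbers, and at 2 n keeps them away from 0 and 1; the reciprocals of y and 1 - y are summed
    separately. *)
Lemma ex_series_sec_pow (theta c : R) (s : nat) :
  0 < c -> (forall k j, c / INR (S k) <= Rabs (INR (S k) * theta - IZR j)) -> (2 <= s)%nat ->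
  (forall n, cos (PI * INR (S n) * theta) <> 0) /\
  ex_series (fun n => / Rabs (cos (PI * INR (S n) * theta)) * / INR (S n) ^ s).
Proof.
  intros Hc Hbad Hs; pose proof PI_RGT_0 as Hpi; pose proof PI2_3_2 as Hpi3.
  set (y n := frac_part (INR n * theta - / 2)).
  set (j n := Int_part (INR n * theta - / 2)).
  assert (Hyj : forall n, y n = INR n * theta - / 2 - IZR (j n)) by reflexivity.
  assert (Hy01 : forall n, 0 <= y n < 1) by (intros n; destruct (base_fp (INR n * theta - / 2)); unfold y; lra).
  assert (Hmin : forall n m, c / (4 * INR (S n)) <= Rabs (INR (S n) * theta - / 2 - IZR m)).
  { intros n m; specialize (Hbad (2 * n + 1)%nat (2 * m + 1)%Z).
    replace (INR (S (2 * n + 1))) with (2 * INR (S n)) in Hbad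
      by (rewrite !S_INR, plus_INR, mult_INR; simpl; ring).
    rewrite plus_IZR, mult_IZR in Hbad.
    replace (2 * INR (S n) * theta - (2 * IZR m + 1))
      with (2 * (INR (S n) * theta - / 2 - IZR m)) in Hbad by field.
    rewrite Rabs_mult, (Rabs_pos_eq 2) in Hbad by lra.
    pose proof (INR_S_pos n).
    replace (c / (4 * INR (S n))) with (/ 2 * (c / (2 * INR (S n)))) by (field; lra); lra. }
  assert (Hgap : forall n m k, (n = m + S k)%nat -> c / INR (S k) <= Rabs (y n - y m)).
  { intros n m k ->; rewrite !Hyj, plus_INR.
    replace ((INR m + INR (S k)) * theta - / 2 - IZR (j (m + S k)%nat)
              - (INR m * theta - / 2 - IZR (j m)))
      with (INR (S k) * theta - IZR (j (m + S k)%nat - j m)) by (rewrite minus_IZR; ring).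
    apply Hbad. }
  assert (Hlow : forall n, c / (4 * INR (S n)) <= y (S n)).
  { intros n; rewrite <- (Rabs_pos_eq (y (S n))) by apply Hy01; rewrite Hyj; apply Hmin. }
  assert (Hupp : forall n, c / (4 * INR (S n)) <= 1 - y (S n)).
  { intros n; rewrite <- (Rabs_pos_eq (1 - y (S n))) by (specialize (Hy01 (S n)); lra).
    rewrite Hyj, <- Rabs_Ropp.
    replace (- (1 - (INR (S n) * theta - / 2 - IZR (j (S n)))))
      with (INR (S n) * theta - / 2 - IZR (j (S n) + 1)) by (rewrite plus_IZR; ring).
    apply Hmin. }
  assert (Hcpos : forall n, 0 < c / (4 * INR (S n))).
  { intros n; apply Rdiv_lt_0_compat; [easy|]; pose proof (INR_S_pos n); lra. }
  assert (Hcos : forall n, Rmin (y (S n)) (1 - y (S n)) <= Rabs (cos (PI * INR (S n) * theta))).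
  { intros n; set (Y := y (S n)).
    replace (PI * INR (S n) * theta) with (PI * (INR (S n) * theta)) by ring.
    rewrite <- (Rabs_sin_half_integer _ (- j (S n) - 1)), <- Rabs_Ropp, <- sin_neg.
    rewrite minus_IZR, opp_IZR.
    replace (- (PI * (- IZR (j (S n)) - 1 + / 2 - INR (S n) * theta)))
      with (PI * Y + 2 * (IZR (j (S n)) * PI) + PI) by (unfold Y; rewrite Hyj; field).
    rewrite neg_sin, Rabs_Ropp, sin_shift_period.
    specialize (Hy01 (S n)); fold Y in Hy01.
    rewrite Rabs_pos_eq by (apply sin_ge_0; nra).
    (* The lower bound gives sin (PI Y) >= PI Y / 3 >= Y as PI > 3; the right half is reflected. *)
    destruct (Rle_dec Y (/ 2)).
    - eapply Rle_trans; [apply Rmin_l|].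
      eapply Rle_trans; [|apply sin_lower_bound]; nra.
    - eapply Rle_trans; [apply Rmin_r|]; rewrite <- sin_PI_x.
      eapply Rle_trans; [|apply sin_lower_bound]; nra. }
  assert (Hcos0 : forall n, 0 < Rabs (cos (PI * INR (S n) * theta))).
  { intros n; eapply Rlt_le_trans; [|apply Hcos].
    specialize (Hcpos n); specialize (Hlow n); specialize (Hupp n); apply Rmin_glb_lt; lra. }
  split.
  { intros n H; specialize (Hcos0 n); rewrite H, Rabs_R0 in Hcos0; lra. }
  assert (H1 : ex_series (fun n => / y (S n) * / INR (S n) ^ 2)).
  { apply (spaced_series y c); [easy| |easy].
    intros n; specialize (Hy01 (S n)); specialize (Hlow n); lra. }
  assert (H2 : ex_series (fun n => / (1 - y (S n)) * / INR (S n) ^ 2)).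
  { apply (spaced_series (fun n => 1 - y n) c); [easy| |].
    - intros n; specialize (Hy01 (S n)); specialize (Hupp n); lra.
    - intros n m k H; rewrite Rabs_minus_sym.
      replace (1 - y m - (1 - y n)) with (y n - y m) by ring; now apply Hgap. }
  apply (@ex_series_le R_AbsRing R_CompleteNormedModule _
    (fun n => / y (S n) * / INR (S n) ^ 2 + / (1 - y (S n)) * / INR (S n) ^ 2)).
  2: now apply (ex_series_plus (fun n => / y (S n) * / INR (S n) ^ 2)).
  intros n; change (Rabs (/ Rabs (cos (PI * INR (S n) * theta)) * / INR (S n) ^ s)
    <= / y (S n) * / INR (S n) ^ 2 + / (1 - y (S n)) * / INR (S n) ^ 2).
  specialize (Hcos n); specialize (Hcos0 n); specialize (Hlow n); specialize (Hupp n).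
  specialize (Hcpos n); specialize (Hy01 (S n)).
  pose proof (INR_S_pow_pos n s) as Hps; pose proof (INR_S_pow_pos n 2) as Hp2.
  assert (Hle : / INR (S n) ^ s <= / INR (S n) ^ 2).
  { apply Rinv_le_contravar; [easy|]; apply Rle_pow; [|easy].
    rewrite S_INR; pose proof (pos_INR n); lra. }
  apply Rinv_0_lt_compat in Hps, Hp2.
  pose proof (Rinv_0_lt_compat _ Hcos0).
  rewrite Rabs_pos_eq by nra.
  rewrite <- Rmult_plus_distr_r; apply Rmult_le_compat; [lra|lra| |easy].
  assert (0 < / y (S n)) by (apply Rinv_0_lt_compat; lra).
  assert (0 < / (1 - y (S n))) by (apply Rinv_0_lt_compat; lra).
  unfold Rmin in Hcos; destruct (Rle_dec _ _).
  - assert (/ Rabs (cos (PI * INR (S n) * theta)) <= / y (S n))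
      by (apply Rinv_le_contravar; lra); lra.
  - assert (/ Rabs (cos (PI * INR (S n) * theta)) <= / (1 - y (S n)))
      by (apply Rinv_le_contravar; lra); lra.
Qed.

(** Liouville's argument: the norm (K tau - j) (K tau + j), times the denominator of r, is a nonzero
    integer. If the first factor is below 1, the second is at most K (2 |tau| + 1). *)
Lemma sqrt_badly_approximable (r : Q) (tau : R) :
  tau * tau = Q2R r -> ~ is_rat tau ->
  exists c, 0 < c /\ forall k j, c / INR (S k) <= Rabs (INR (S k) * tau - IZR j).
Proof.
  intros Hr Hirr; destruct r as [P q]; unfold Q2R in Hr; simpl in Hr.
  assert (Hq : 1 <= IZR (Zpos q)) by (apply IZR_le; lia).
  pose proof (Rabs_pos tau) as Ht.
  set (W := IZR (Zpos q) * (2 * Rabs tau + 1)).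
  assert (HW : 1 <= W) by (unfold W; nra).
  exists (/ W); split; [apply Rinv_0_lt_compat; lra|].
  intros k j; pose proof (INR_S_pos k) as HK0.
  assert (HK : 1 <= INR (S k)) by (rewrite S_INR; pose proof (pos_INR k); lra).
  unfold Rdiv; rewrite <- Rinv_mult.
  set (K := INR (S k)) in *; set (e := Rabs (K * tau - IZR j)).
  destruct (Rle_dec 1 e) as [He|He].
  { rewrite <- Rinv_1 in He; eapply Rle_trans; [|exact He]; apply Rinv_le_contravar; nra. }
  assert (Hnorm : 1 <= Rabs ((K * tau - IZR j) * (K * tau + IZR j) * IZR (Zpos q))).
  { replace ((K * tau - IZR j) * (K * tau + IZR j) * IZR (Zpos q))
      with (IZR (Z.of_nat (S k) * Z.of_nat (S k) * P - j * j * Zpos q)).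
    - rewrite <- abs_IZR; apply IZR_le.
      set (D := (Z.of_nat (S k) * Z.of_nat (S k) * P - j * j * Zpos q)%Z).
      destruct (Z.eq_dec D 0) as [E|]; [exfalso|lia].
      assert (HE : (K * tau - IZR j) * (K * tau + IZR j) = 0).
      { apply Rmult_eq_reg_r with (IZR (Zpos q)); [|lra]; rewrite Rmult_0_l.
        assert (HD : IZR D = 0) by (now rewrite E).
        unfold D in HD; rewrite minus_IZR, !mult_IZR, IZR_of_nat in HD; fold K in HD.
        transitivity (K * K * (tau * tau) * IZR (Zpos q) - IZR j * IZR j * IZR (Zpos q)); [ring|].
        rewrite Hr; replace (K * K * (IZR P * / IZR (Zpos q)) * IZR (Zpos q)) with (K * K * IZR P)
          by (field; lra); lra. }
      apply Hirr; apply Rmult_integral in HE; destruct HE as [HE|HE].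
      + replace tau with (IZR j / K) by (apply Rmult_eq_reg_l with K; [field_simplify; lra|lra]).
        apply is_rat_div; [apply is_rat_IZR|apply is_rat_INR].
      + replace tau with (- IZR j / K) by (apply Rmult_eq_reg_l with K; [field_simplify; lra|lra]).
        apply is_rat_div; [apply is_rat_opp, is_rat_IZR|apply is_rat_INR].
    - rewrite minus_IZR, !mult_IZR, IZR_of_nat; fold K.
      transitivity (K * K * (tau * tau) * IZR (Zpos q) - IZR j * IZR j * IZR (Zpos q)); [|ring].
      rewrite Hr; field; lra. }
  rewrite !Rabs_mult in Hnorm; fold e in Hnorm; rewrite (Rabs_pos_eq (IZR _)) in Hnorm by lra.
  assert (He0 : 0 <= e) by apply Rabs_pos.
  assert (Hplus : Rabs (K * tau + IZR j) <= K * (2 * Rabs tau + 1)).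
  { replace (K * tau + IZR j) with (2 * (K * tau) - (K * tau - IZR j)) by ring.
    eapply Rle_trans; [apply Rabs_triang|]; rewrite Rabs_Ropp; fold e.
    rewrite !Rabs_mult, (Rabs_pos_eq 2), (Rabs_pos_eq K) by lra; nra. }
  apply Rmult_le_reg_l with (W * K); [nra|]; rewrite Rinv_r by nra.
  eapply Rle_trans; [exact Hnorm|]; unfold W.
  replace (IZR (Zpos q) * (2 * Rabs tau + 1) * K * e)
    with (e * (K * (2 * Rabs tau + 1)) * IZR (Zpos q)) by ring.
  apply Rmult_le_compat_r; [lra|]; now apply Rmult_le_compat_l.
Qed.

(** * Pell's equation *)

Lemma pigeonhole (f : nat -> nat) (L B : nat) :
  (B < L)%nat -> (forall i, (i < L)%nat -> (f i < B)%nat) ->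
  exists i j, (i < j < L)%nat /\ f i = f j.
Proof.
  intros HBL Hf; apply NNPP; intros Hn.
  assert (Hinj : forall i j, (i < L)%nat -> (j < L)%nat -> f i = f j -> i = j).
  { intros i j Hi Hj E; destruct (Nat.lt_total i j) as [H|[H|H]]; [exfalso|easy|exfalso];
      apply Hn; [exists i, j|exists j, i]; split; auto; lia. }
  assert (H : INR L * 1 <= INR B * 1).
  { rewrite <- !psum_const.
    rewrite (psum_ext _ (fun i => psum (fun b => if (f i =? b)%nat then 1 else 0) B)).
    - rewrite psum_swap; apply psum_le; intros b _; now apply psum_indicator_le_1.
    - intros i Hi; specialize (Hf i Hi); clear - Hf.
      induction B as [|B IH]; [lia|]; cbn [psum].
      destruct (Nat.eqb_spec (f i) B) as [E|E].
      + rewrite (psum_ext _ (fun _ => 0)), psum_const; [ring|].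
        intros b Hb; destruct (Nat.eqb_spec (f i) b); [lia|easy].
      + rewrite <- IH by lia; ring. }
  rewrite !Rmult_1_r in H; apply INR_le in H; lia.
Qed.

Lemma dirichlet_approximation (theta : R) (M : nat) :
  (0 < M)%nat ->
  exists h k : Z, (1 <= k <= Z.of_nat M)%Z /\ Rabs (IZR k * theta - IZR h) < / INR M.
Proof.
  intros HM; assert (HM0 : 0 < INR M) by now apply lt_0_INR.
  set (y i := frac_part (INR i * theta)).
  assert (Hy : forall i, 0 <= y i < 1) by (intros i; destruct (base_fp (INR i * theta)); unfold y; lra).
  assert (HyM : forall i, 0 <= y i * INR M) by (intros i; specialize (Hy i); nra).
  set (f i := nfloor (y i * INR M) (HyM i)).
  assert (Hf : forall i, INR (f i) <= y i * INR M < INR (f i) + 1).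
  { intros i; unfold f, nfloor; destruct (nfloor_ex _ _) as [n Hn]; exact Hn. }
  destruct (pigeonhole f (S M) M) as (i & j & Hij & E); [lia| |].
  { intros i _; apply INR_lt; specialize (Hf i); specialize (Hy i); nra. }
  exists (Int_part (INR j * theta) - Int_part (INR i * theta))%Z, (Z.of_nat (j - i)).
  split; [lia|].
  rewrite IZR_of_nat, minus_INR, minus_IZR by lia.
  replace ((INR j - INR i) * theta - (IZR (Int_part (INR j * theta)) - IZR (Int_part (INR i * theta))))
    with (y j - y i) by (unfold y, frac_part; ring).
  pose proof (Hf i) as Hi; pose proof (Hf j) as Hj; rewrite E in Hi.
  apply Rmult_lt_reg_r with (INR M); [easy|]; rewrite Rinv_l by lra.
  rewrite <- (Rabs_pos_eq (INR M)) at 1 by lra; rewrite <- Rabs_mult.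
  apply Rabs_def1; lra.
Qed.

(** Dirichlet approximation supplies arbitrarily many pairs (h, k) of bounded norm h^2 - D k^2. Two
    of them share the norm N and the residues mod |N|; their quotient is then an integral unit of
    norm 1. *)
Lemma pell (D : Z) :
  (0 < D)%Z -> (forall h k : Z, k <> 0 -> h * h <> D * (k * k))%Z ->
  exists x w : Z, (0 < w)%Z /\ (0 < x)%Z /\ (x * x = 1 + D * (w * w))%Z.
Proof.
  intros HD Hns.
  assert (HD0 : 0 < IZR D) by now apply (IZR_lt 0).
  set (theta := sqrt (IZR D)).
  assert (Hth : theta * theta = IZR D) by (apply sqrt_sqrt; lra).
  assert (Hth0 : 0 < theta) by now apply sqrt_lt_R0.
  assert (Hne : forall h k : Z, k <> 0%Z -> IZR k * theta - IZR h <> 0).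
  { intros h k Hk H; apply (Hns h k Hk), eq_IZR; rewrite !mult_IZR.
    replace (IZR h) with (IZR k * theta) by lra.
    rewrite <- Hth; ring. }
  set (good h k := (1 <= k)%Z /\ Rabs (IZR k * theta - IZR h) < / IZR k).
  assert (Hsmall : forall delta, 0 < delta -> exists h k, good h k /\
            Rabs (IZR k * theta - IZR h) < delta).
  { intros delta Hdel; destruct (archimed_cor1 delta Hdel) as (M & HM1 & HM2).
    destruct (dirichlet_approximation theta M HM2) as (h & k & Hk & Hhk).
    exists h, k; split; [|lra]; split; [lia|].
    eapply Rlt_le_trans; [exact Hhk|]; apply Rinv_le_contravar.
    - apply (IZR_lt 0); lia.
    - rewrite <- IZR_of_nat; apply IZR_le; lia. }
  (* Each new pair approximates strictly better than all earlier ones, hence is distinct from them;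
     [delta] keeps a lower bound for the errors so far. *)
  assert (Hseq : forall L : nat, exists (h k : nat -> Z) (delta : R), 0 < delta /\
    (forall i, (i < L)%nat -> good (h i) (k i) /\
       delta <= Rabs (IZR (k i) * theta - IZR (h i))) /\
    (forall i j, (i < j < L)%nat -> (h i, k i) <> (h j, k j))).
  { induction L as [|L (h & k & delta & Hdel & H1 & H2)].
    - exists (fun _ => 0%Z), (fun _ => 0%Z), 1; split; [lra|split; intros; lia].
    - destruct (Hsmall delta Hdel) as (h' & k' & Hg & Hlt).
      exists (fun i => if (i =? L)%nat then h' else h i),
             (fun i => if (i =? L)%nat then k' else k i),
             (Rabs (IZR k' * theta - IZR h')).
      split; [|split].
      + apply Rabs_pos_lt, Hne; destruct Hg; lia.
      + intros i Hi; destruct (Nat.eqb_spec i L); [split; [easy|lra]|].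
        destruct (H1 i ltac:(lia)); split; [easy|lra].
      + intros i j Hij; destruct (Nat.eqb_spec i L); [lia|].
        destruct (Nat.eqb_spec j L); [|apply H2; lia].
        intros E; injection E as Eh Ek; destruct (H1 i ltac:(lia)) as [_ H].
        rewrite Eh, Ek in H; lra. }
  set (nm h k := (h * h - D * (k * k))%Z).
  (* With error e and |e| < 1 / k, the norm is at most |e| (2 k theta + |e|) < 2 theta + 1. *)
  set (B := up (2 * theta + 1)).
  destruct (archimed (2 * theta + 1)) as [HB _]; fold B in HB.
  assert (HB0 : (0 < B)%Z) by (apply lt_IZR; lra).
  assert (Hnorm : forall h k, good h k -> (Z.abs (nm h k) < B)%Z).
  { intros h k [Hk Hhk]; apply lt_IZR; rewrite abs_IZR.
    assert (Hk1 : 1 <= IZR k) by now apply IZR_le.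
    assert (Hik : / IZR k <= 1) by (rewrite <- Rinv_1; apply Rinv_le_contravar; lra).
    unfold nm; rewrite minus_IZR, !mult_IZR, <- Hth.
    set (e := IZR k * theta - IZR h) in *.
    replace (IZR h * IZR h - theta * theta * (IZR k * IZR k))
      with (- (e * (2 * IZR k * theta - e))) by (unfold e; ring).
    rewrite Rabs_Ropp, Rabs_mult.
    assert (Hb : Rabs (2 * IZR k * theta - e) <= 2 * IZR k * theta + Rabs e).
    { eapply Rle_trans; [apply Rabs_triang|]; rewrite Rabs_Ropp, (Rabs_pos_eq (_ * _)) by nra; lra. }
    pose proof (Rabs_pos e).
    assert (Rabs e * IZR k < 1).
    { replace 1 with (/ IZR k * IZR k) by (field; lra); apply Rmult_lt_compat_r; lra. }
    eapply Rle_lt_trans; [apply Rmult_le_compat_l; [easy|exact Hb]|]; nra. }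
  assert (Hnm0 : forall h k, good h k -> nm h k <> 0%Z).
  { intros h k [Hk _] E; apply (Hns h k); unfold nm in E; lia. }
  (* The triple of norm and two residues as base-B digits, the norm shifted by B to be positive;
     there are fewer than 2 B^3 codes. *)
  set (code h k := Z.to_nat
    (((nm h k + B) * B + h mod Z.abs (nm h k)) * B + k mod Z.abs (nm h k))).
  set (L := S (Z.to_nat (2 * B * B * B))).
  destruct (Hseq L) as (h & k & delta & _ & Hgood & Hdist).
  destruct (pigeonhole (fun i => code (h i) (k i)) L (Z.to_nat (2 * B * B * B)))
    as (i & j & Hij & E).
  { unfold L; lia. }
  { intros i Hi; destruct (Hgood i Hi) as [Hg _].
    pose proof (Hnorm _ _ Hg); pose proof (Hnm0 _ _ Hg); unfold code.
    pose proof (Z.mod_pos_bound (h i) (Z.abs (nm (h i) (k i))) ltac:(lia)).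
    pose proof (Z.mod_pos_bound (k i) (Z.abs (nm (h i) (k i))) ltac:(lia)).
    set (N := nm (h i) (k i)) in *; set (a := (h i mod _)%Z) in *; set (c := (k i mod _)%Z) in *.
    apply Z2Nat.inj_lt; nia. }
  destruct (Hgood i ltac:(lia)) as [Hgi _]; destruct (Hgood j ltac:(lia)) as [Hgj _].
  specialize (Hdist i j ltac:(lia)).
  pose proof (Hnorm _ _ Hgi) as Hni; pose proof (Hnm0 _ _ Hgi) as Hni0.
  pose proof (Hnorm _ _ Hgj) as Hnj; pose proof (Hnm0 _ _ Hgj) as Hnj0.
  destruct Hgi as [Hki _]; destruct Hgj as [Hkj _].
  set (h1 := h i) in *; set (k1 := k i) in *; set (h2 := h j) in *; set (k2 := k j) in *.
  unfold code in E.
  pose proof (Z.mod_pos_bound h1 (Z.abs (nm h1 k1)) ltac:(lia)).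
  pose proof (Z.mod_pos_bound k1 (Z.abs (nm h1 k1)) ltac:(lia)).
  pose proof (Z.mod_pos_bound h2 (Z.abs (nm h2 k2)) ltac:(lia)).
  pose proof (Z.mod_pos_bound k2 (Z.abs (nm h2 k2)) ltac:(lia)).
  apply Z2Nat.inj in E; [|nia|nia].
  assert (Hcode : forall a c a' c', (0 <= c < B)%Z -> (0 <= c' < B)%Z ->
            (a * B + c = a' * B + c')%Z -> a = a' /\ c = c').
  { intros a c a' c' Hc Hc' H'; assert (a = a') by nia; subst; lia. }
  apply Hcode in E; [|lia|lia]; destruct E as [E Ek].
  apply Hcode in E; [|lia|lia]; destruct E as [E Eh].
  assert (EN : nm h1 k1 = nm h2 k2) by lia; clear E.
  rewrite <- EN in Eh, Ek; set (N := nm h1 k1) in *.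
  assert (Hcong : forall a b : Z, (a mod Z.abs N = b mod Z.abs N)%Z -> exists z, (b = a + z * N)%Z).
  { intros a b Hab.
    pose proof (Z.div_mod a (Z.abs N) ltac:(lia)); pose proof (Z.div_mod b (Z.abs N) ltac:(lia)).
    exists (Z.sgn N * (b / Z.abs N - a / Z.abs N))%Z.
    replace (Z.sgn N * (b / Z.abs N - a / Z.abs N) * N)%Z
      with ((b / Z.abs N - a / Z.abs N) * (N * Z.sgn N))%Z by ring.
    rewrite <- Z.abs_sgn; lia. }
  destruct (Hcong _ _ Eh) as [u Hu]; destruct (Hcong _ _ Ek) as [v Hv].
  assert (HN1 : N = (h1 * h1 - D * (k1 * k1))%Z) by reflexivity.
  assert (HN2 : N = (h2 * h2 - D * (k2 * k2))%Z) by (rewrite EN; reflexivity).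
  (* The coordinates of (h2 + k2 sqrt D) / (h1 + k1 sqrt D), integral thanks to h2 = h1 + u N and k2
     = k1 + v N. *)
  set (x := (1 + u * h1 - D * k1 * v)%Z); set (w := (h1 * v - u * k1)%Z).
  assert (Hx : (x * N = h1 * h2 - D * (k1 * k2))%Z).
  { rewrite Hu, Hv; unfold x.
    transitivity (N + N * (u * h1 - D * k1 * v))%Z; [ring|rewrite HN1 at 1; ring]. }
  assert (Hw : (w * N = h1 * k2 - h2 * k1)%Z) by (rewrite Hu, Hv; unfold w; ring).
  assert (Hxw : (x * x = 1 + D * (w * w))%Z).
  { apply Z.mul_reg_r with (N * N)%Z; [now apply Z.neq_mul_0|].
    replace (x * x * (N * N))%Z with ((x * N) * (x * N))%Z by ring.
    replace ((1 + D * (w * w)) * (N * N))%Z with (N * N + D * ((w * N) * (w * N)))%Z by ring.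
    rewrite Hx, Hw; rewrite HN1 at 1; rewrite HN2; ring. }
  (* If w = 0 the pairs are proportional; equal norms and positive k then make them equal, against
     their distinctness. *)
  assert (Hw0 : w <> 0%Z).
  { intros Hw0; apply Hdist; rewrite Hw0, Z.mul_0_l in Hw.
    assert (Hkk : (k1 * k1 = k2 * k2)%Z).
    { apply Z.mul_reg_r with N; [easy|].
      transitivity ((h2 * k1) * (h2 * k1) - D * (k1 * k1 * (k2 * k2)))%Z.
      - rewrite HN2; ring.
      - replace (h2 * k1)%Z with (h1 * k2)%Z by lia; rewrite HN1; ring. }
    assert (Ek12 : ((k1 - k2) * (k1 + k2) = 0)%Z).
    { transitivity (k1 * k1 - k2 * k2)%Z; [ring|rewrite Hkk; ring]. }
    apply Z.mul_eq_0 in Ek12; assert (Hk12 : k1 = k2) by lia.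
    assert (Eh12 : ((h1 - h2) * k2 = 0)%Z).
    { transitivity (h1 * k2 - h2 * k1)%Z; [rewrite Hk12; ring|now rewrite <- Hw]. }
    apply Z.mul_eq_0 in Eh12; assert (Hh12 : h1 = h2) by lia; now rewrite Hk12, Hh12. }
  exists (Z.abs x), (Z.abs w); split; [lia|split].
  - assert (x <> 0%Z) by (intros H'; rewrite H' in Hxw; clear - Hxw HD; nia); lia.
  - rewrite !Z.abs_square; exact Hxw.
Qed.

(** * The reciprocity relation at a quadratic irrational *)

Lemma rat_multiple_lim_psum (u : nat -> nat -> R) (c : R) (n : nat) :
  (forall i, (i < n)%nat -> exists q, is_rat q /\ is_lim_seq (fun N => u N i) (c * q)) ->
  exists q, is_rat q /\ is_lim_seq (fun N => psum (u N) n) (c * q).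
Proof.
  induction n as [|n IH]; intros H.
  - exists 0; split; [apply (is_rat_IZR 0)|]; rewrite Rmult_0_r; apply is_lim_seq_const.
  - destruct IH as (q & Hq & Hl); [auto with arith|].
    destruct (H n ltac:(lia)) as (q' & Hq' & Hl').
    exists (q + q'); split; [rat|]; rewrite Rmult_plus_distr_l; now apply is_lim_seq_plus'.
Qed.

(** Both coordinates are truncated at the same N: for p = 1 or q = 1 absolute convergence may fail,
    and the later exchange of n and n' must be exact. *)
Definition lat_box (b x : Z) (p q N : nat) : R :=
  tsum (fun n => tsum (fun n' => lat b (n' - x * n) / (IZR n ^ p * IZR n' ^ q)) N) N.

(** After Fourier expansion of [lat], sin (alpha n' - beta n) splits by the addition formula, so the
    box is a finite combination of products of one-dimensional sums at rational points. *)
Lemma lat_box_cv (b x : Z) (p q : nat) :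
  (0 < b)%Z -> (1 <= p)%nat -> (1 <= q)%nat ->
  exists t, is_rat t /\ is_lim_seq (lat_box b x p q) (PI ^ (p + q) * t).
Proof.
  intros Hb Hp Hq; assert (Hb0 : 0 < IZR b) by (now apply (IZR_lt 0)).
  set (v i := INR (2 * i + 1) / (2 * IZR b)).
  assert (Hv : forall i, is_rat (v i)) by (intros i; unfold v; rat).
  set (cs p w N := tsum (fun n => cos (PI * w * IZR n) / IZR n ^ p) N).
  set (sn p w N := tsum (fun n => sin (PI * w * IZR n) / IZR n ^ p) N).
  assert (Hbox : forall N, lat_box b x p q N = psum (fun i => / IZR b * (-1) ^ i *
            (cs p (v i * IZR x) N * sn q (v i) N + - (1) * (sn p (v i * IZR x) N * cs q (v i) N)))
            (Z.to_nat b)).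
  { intros N; unfold lat_box.
    assert (Hprod : forall F G, tsum F N * tsum G N = tsum (fun n => tsum (fun n' => F n * G n') N) N).
    { intros F G; rewrite Rmult_comm, <- tsum_scal; apply tsum_ext; intros n _.
      now rewrite tsum_scal, Rmult_comm. }
    rewrite (psum_ext _ (fun i => tsum (fun n => tsum (fun n' => / IZR b * (-1) ^ i *
        (cos (PI * (v i * IZR x) * IZR n) / IZR n ^ p * (sin (PI * v i * IZR n') / IZR n' ^ q)
         + - (1) * (sin (PI * (v i * IZR x) * IZR n) / IZR n ^ p
                    * (cos (PI * v i * IZR n') / IZR n' ^ q)))) N) N)).
    2: { intros i _; unfold cs, sn; rewrite !Hprod.
      rewrite <- (tsum_scal (- (1))), <- tsum_plus, <- tsum_scal.
      apply tsum_ext; intros n _.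
      rewrite <- (tsum_scal (- (1))), <- tsum_plus, <- tsum_scal; reflexivity. }
    rewrite <- tsum_psum; apply tsum_ext; intros n Hn.
    rewrite <- tsum_psum; apply tsum_ext; intros n' Hn'; cbv beta.
    assert (IZR n ^ p <> 0) by (now apply pow_nonzero, not_0_IZR).
    assert (IZR n' ^ q <> 0) by (now apply pow_nonzero, not_0_IZR).
    apply Rmult_eq_reg_l with (IZR b); [|lra].
    unfold Rdiv at 1; rewrite <- Rmult_assoc, lat_fourier by easy.
    rewrite Rmult_comm, <- !psum_scal; apply psum_ext; intros i _.
    replace (INR (2 * i + 1) * (PI * IZR (n' - x * n) / (2 * IZR b)))
      with (PI * v i * IZR n' - PI * (v i * IZR x) * IZR n)
      by (unfold v; rewrite minus_IZR, mult_IZR; field; lra).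
    rewrite sin_minus; field; lra. }
  destruct (rat_multiple_lim_psum (fun N i => / IZR b * (-1) ^ i *
            (cs p (v i * IZR x) N * sn q (v i) N + - (1) * (sn p (v i * IZR x) N * cs q (v i) N)))
            (PI ^ (p + q)) (Z.to_nat b)) as (t & Ht & Hlim).
  - intros i _.
    destruct (tsum_cos_cv p (v i * IZR x) Hp) as (c1 & Hc1 & L1); [rat; auto|].
    destruct (tsum_sin_cv p (v i * IZR x) Hp) as (s1 & Hs1 & L2); [rat; auto|].
    destruct (tsum_cos_cv q (v i) Hq (Hv i)) as (c2 & Hc2 & L3).
    destruct (tsum_sin_cv q (v i) Hq (Hv i)) as (s2 & Hs2 & L4).
    exists (/ IZR b * (-1) ^ i * (c1 * s2 + - (1) * (s1 * c2))); split; [rat|].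
    replace (PI ^ (p + q) * (/ IZR b * (-1) ^ i * (c1 * s2 + - (1) * (s1 * c2))))
      with (/ IZR b * (-1) ^ i * (PI ^ p * c1 * (PI ^ q * s2) + - (1) * (PI ^ p * s1 * (PI ^ q * c2))))
      by (rewrite pow_add; ring).
    apply (is_lim_seq_scal_l _ _ (Finite _)), is_lim_seq_plus'; [now apply is_lim_seq_mult'|].
    apply (is_lim_seq_scal_l _ _ (Finite _)); now apply is_lim_seq_mult'.
  - exists t; split; [easy|]; eapply is_lim_seq_ext; [|exact Hlim].
    intros N; symmetry; apply Hbox.
Qed.

(** The column n' = 0, which belongs to the full rows but is absent from the box. *)
Definition lat_axis (b x : Z) (p N : nat) : R :=
  tsum (fun n => lat b (0 - x * n) / IZR n ^ p) N.

Lemma lat_axis_cv (b x : Z) (p : nat) :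
  (0 < b)%Z -> (1 <= p)%nat ->
  exists t, is_rat t /\ is_lim_seq (lat_axis b x p) (PI ^ p * t).
Proof.
  intros Hb Hp; assert (Hb0 : 0 < IZR b) by (now apply (IZR_lt 0)).
  set (v i := - (INR (2 * i + 1) / (2 * IZR b) * IZR x)).
  assert (Hv : forall i, is_rat (v i)) by (intros i; unfold v; rat).
  set (sn w N := tsum (fun n => sin (PI * w * IZR n) / IZR n ^ p) N).
  assert (Hax : forall N, lat_axis b x p N
            = psum (fun i => / IZR b * (-1) ^ i * sn (v i) N) (Z.to_nat b)).
  { intros N; unfold lat_axis.
    rewrite (psum_ext _ (fun i => tsum (fun n =>
        / IZR b * (-1) ^ i * (sin (PI * v i * IZR n) / IZR n ^ p)) N))
      by (intros i _; symmetry; apply tsum_scal).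
    rewrite <- tsum_psum; apply tsum_ext; intros n Hn; cbv beta.
    assert (IZR n ^ p <> 0) by (now apply pow_nonzero, not_0_IZR).
    apply Rmult_eq_reg_l with (IZR b); [|lra].
    unfold Rdiv at 1; rewrite <- Rmult_assoc, lat_fourier by easy.
    rewrite Rmult_comm, <- !psum_scal; apply psum_ext; intros i _.
    replace (INR (2 * i + 1) * (PI * IZR (0 - x * n) / (2 * IZR b))) with (PI * v i * IZR n)
      by (unfold v; rewrite minus_IZR, mult_IZR; field; lra).
    field; lra. }
  destruct (rat_multiple_lim_psum (fun N i => / IZR b * (-1) ^ i * sn (v i) N)
            (PI ^ p) (Z.to_nat b)) as (t & Ht & Hlim).
  - intros i _; destruct (tsum_sin_cv p (v i) Hp (Hv i)) as (s1 & Hs1 & L).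
    exists (/ IZR b * (-1) ^ i * s1); split; [rat|].
    replace (PI ^ p * (/ IZR b * (-1) ^ i * s1)) with (/ IZR b * (-1) ^ i * (PI ^ p * s1)) by ring.
    now apply (is_lim_seq_scal_l _ _ (Finite _)).
  - exists t; split; [easy|]; eapply is_lim_seq_ext; [|exact Hlim].
    intros N; symmetry; apply Hax.
Qed.

Definition sec_box (b x : Z) (s : nat) (a : R) (N : nat) : R :=
  tsum (fun n => / IZR n ^ s * tsum (lat_term b x a n) N) N.

Lemma ex_series_psi_term_abs (s : nat) (tau : R) :
  ex_series (fun n => / Rabs (cos (PI * INR (S n) * tau)) * / INR (S n) ^ s) ->
  ex_series (psi_term s tau).
Proof.
  apply (@ex_series_le R_AbsRing R_CompleteNormedModule).
  intros n; unfold psi_term, sec, Rdiv; right.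
  pose proof (Rinv_0_lt_compat _ (INR_S_pow_pos n s)) as Hp.
  change (Rabs (/ cos (PI * INR (S n) * tau) * / INR (S n) ^ s)
    = / Rabs (cos (PI * INR (S n) * tau)) * / INR (S n) ^ s).
  now rewrite Rabs_mult, Rabs_inv, (Rabs_pos_eq (/ INR (S n) ^ s)) by lra.
Qed.

(** Rows n and - n each contribute PI / (2 b) sec (PI n tau) / n^s, since s is even, whence PI / b
    times psi. Removing n' = 0 subtracts lat / (- a n^(s+1)), whence + E / a. The row bounds
    O(|sec|) dominate. *)
Lemma sec_box_cv (b x : Z) (s : nat) (tau E : R) :
  let a := IZR x + 2 * IZR b * tau in
  (0 < b)%Z -> Nat.Even s -> (2 <= s)%nat -> a <> 0 ->
  (forall n, cos (PI * INR (S n) * tau) <> 0) ->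
  ex_series (fun n => / Rabs (cos (PI * INR (S n) * tau)) * / INR (S n) ^ s) ->
  is_lim_seq (lat_axis b x (S s)) E ->
  is_lim_seq (sec_box b x s a) (PI / IZR b * psi s tau + / a * E).
Proof.
  intros a Hb Hs Hs2 Ha Hcos Hex HE; assert (Hb0 : 0 < IZR b) by (now apply (IZR_lt 0)).
  pose proof PI_RGT_0 as Hpi.
  assert (Hneg : forall y, (- y) ^ s = y ^ s).
  { intros y; destruct Hs as [k ->]; rewrite !pow_mult; f_equal; ring. }
  assert (Hcz : forall n : Z, n <> 0%Z ->
     exists i, n = Z.of_nat (S i) \/ n = (- Z.of_nat (S i))%Z).
  { intros n Hn; exists (Z.abs_nat n - 1)%nat; lia. }
  assert (Hcabs : forall i (n : Z), n = Z.of_nat (S i) \/ n = (- Z.of_nat (S i))%Z ->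
     cos (PI * (IZR n * tau)) = cos (PI * INR (S i) * tau)).
  { intros i n [-> | ->]; [|rewrite opp_IZR, <- cos_neg]; f_equal; rewrite IZR_of_nat; ring. }
  set (rest n := lat b (0 - x * n) / (IZR 0 - a * IZR n)).
  assert (Hrow : forall n N, tsum (lat_term b x a n) N
     = zsum (lat_term b x a n) (- Z.of_nat N) (2 * N + 1) - rest n).
  { intros n N; rewrite zsum_tsum; unfold rest, lat_term; ring. }
  set (L n := PI / (2 * IZR b) / cos (PI * (IZR n * tau)) - rest n).
  assert (HL : forall n, n <> 0%Z -> is_lim_seq (tsum (lat_term b x a n)) (L n)).
  { intros n Hn; destruct (Hcz n Hn) as [i Hi].
    destruct (lat_row b x tau n Hb) as [_ HR].
    { rewrite (Hcabs i n Hi); apply Hcos. }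
    eapply is_lim_seq_ext; [intros N; symmetry; apply Hrow|].
    apply is_lim_seq_minus'; [exact HR|apply is_lim_seq_const]. }
  assert (Habs : forall i (n : Z) N, n = Z.of_nat (S i) \/ n = (- Z.of_nat (S i))%Z ->
     Rabs (tsum (lat_term b x a n) N)
       <= PI / IZR b * / Rabs (cos (PI * INR (S i) * tau)) + / Rabs a).
  { intros i n N Hi; rewrite Hrow; eapply Rle_trans; [apply Rabs_triang|].
    apply Rplus_le_compat.
    - destruct (lat_row b x tau n Hb) as [HR _].
      { rewrite (Hcabs i n Hi); apply Hcos. }
      rewrite <- (Hcabs i n Hi); apply HR.
    - rewrite Rabs_Ropp; unfold rest, Rdiv.
      rewrite Rabs_mult, Rabs_inv.
      replace (Rabs (IZR 0 - a * IZR n)) with (Rabs a * INR (S i)).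
      + pose proof (Rabs_lat_le_1 b (0 - x * n)) as H1.
        pose proof (Rabs_pos_lt _ Ha) as H2.
        assert (H3 : 1 <= INR (S i)) by (rewrite S_INR; pose proof (pos_INR i); lra).
        assert (H4 : / (Rabs a * INR (S i)) <= / Rabs a) by (apply Rinv_le_contravar; nra).
        assert (0 < / (Rabs a * INR (S i))) by (apply Rinv_0_lt_compat; nra).
        pose proof (Rabs_pos (lat b (0 - x * n))); nra.
      + replace (IZR 0 - a * IZR n) with (- (a * IZR n)) by (simpl; ring).
        rewrite Rabs_Ropp, Rabs_mult; f_equal; rewrite <- abs_IZR.
        replace (Z.abs n) with (Z.of_nat (S i)) by lia; now rewrite IZR_of_nat. }
  set (l i := / IZR (Z.of_nat (S i)) ^ s * L (Z.of_nat (S i))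
            + / IZR (- Z.of_nat (S i)) ^ s * L (- Z.of_nat (S i))%Z).
  destruct (is_lim_seq_dominated
    (fun N i => / IZR (Z.of_nat (S i)) ^ s * tsum (lat_term b x a (Z.of_nat (S i))) N
            + / IZR (- Z.of_nat (S i)) ^ s * tsum (lat_term b x a (- Z.of_nat (S i))) N)
    l (fun i => 2 * (PI / IZR b) * (/ Rabs (cos (PI * INR (S i) * tau)) * / INR (S i) ^ s)
              + 2 * / Rabs a * / INR (S i) ^ s)) as [Hexl Hlim].
  - intros N i; rewrite opp_IZR, Hneg, !IZR_of_nat.
    pose proof (Rinv_0_lt_compat _ (INR_S_pow_pos i s)) as Hp.
    pose proof (Habs i _ N (or_introl eq_refl)) as H1.
    pose proof (Habs i _ N (or_intror eq_refl)) as H2.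
    eapply Rle_trans; [apply Rabs_triang|]; rewrite !Rabs_mult, (Rabs_pos_eq (/ _)) by lra.
    apply Rmult_le_compat_l with (r := / INR (S i) ^ s) in H1, H2; try lra.
  - apply (ex_series_plus (fun i =>
      2 * (PI / IZR b) * (/ Rabs (cos (PI * INR (S i) * tau)) * / INR (S i) ^ s))).
    + now apply (@ex_series_scal R_AbsRing R_NormedModule (2 * (PI / IZR b))).
    + apply (@ex_series_scal R_AbsRing R_NormedModule (2 * / Rabs a)); now apply ex_series_inv_pow.
  - intros i; apply is_lim_seq_plus'; apply (is_lim_seq_scal_l _ _ (Finite _)), HL; lia.
  - replace (PI / IZR b * psi s tau + / a * E) with (Series l); [exact Hlim|].
    assert (Hpsi : is_lim_seq (psum (psi_term s tau)) (psi s tau)).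
    { apply is_series_psum, Series_correct.
      now apply ex_series_psi_term_abs. }
    apply (is_lim_seq_eq (psum l)).
    { apply is_series_psum, Series_correct, Hexl. }
    apply is_lim_seq_ext with
      (fun N => PI / IZR b * psum (psi_term s tau) N + / a * lat_axis b x (S s) N).
    2: { apply is_lim_seq_plus'; now apply (is_lim_seq_scal_l _ _ (Finite _)). }
    intros N; unfold lat_axis, tsum; rewrite <- !psum_scal, <- psum_plus.
    apply psum_ext; intros i _; unfold l, L, rest, psi_term, sec.
    rewrite !(Hcabs i) by auto; rewrite opp_IZR, Hneg; cbn [pow]; rewrite Hneg, !IZR_of_nat.
    specialize (Hcos i); pose proof (INR_S_pow_pos i s); pose proof (INR_S_pos i).
    field; repeat split; lra.
Qed.

(** A geometric sum in a y / z, divided by y^s z. *)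
Lemma partial_fraction (s : nat) (a y z : R) :
  y <> 0 -> z <> 0 -> z - a * y <> 0 ->
  / (y ^ s * (z - a * y)) - a ^ s / (z ^ s * (z - a * y))
  = psum (fun j => a ^ j / (y ^ (s - j) * z ^ S j)) s.
Proof.
  intros Hy Hz Hd; induction s as [|s IH]; [simpl; field; easy|].
  cbn [psum].
  rewrite (psum_ext _ (fun j => / y * (a ^ j / (y ^ (s - j) * z ^ S j)))), psum_scal, <- IH.
  - rewrite Nat.sub_succ_l, Nat.sub_diag by easy; simpl.
    pose proof (pow_nonzero y s Hy); pose proof (pow_nonzero z s Hz); field; easy.
  - intros j Hj; rewrite Nat.sub_succ_l by lia; simpl.
    pose proof (pow_nonzero y (s - j) Hy); pose proof (pow_nonzero z j Hz); field; easy.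
Qed.

(** After exchanging n and n' in the box for a', two minus signs cancel, one from [lat_swap] and one
    from n - a' n' = - (n' - a n) / a. The remaining factor a raises a^(s-1) to the a^s of the
    partial fraction identity, which then applies term by term. *)
Lemma sec_box_relation (b x g h : Z) (s : nat) (tau : R) (N : nat) :
  let a := IZR x + 2 * IZR b * tau in
  let a' := IZR x - 2 * IZR b * tau in
  (0 < b)%Z -> (x * x = 1 + 4 * g * b)%Z -> (x = 1 + 4 * h)%Z -> (1 <= s)%nat ->
  a * a' = 1 -> ~ is_rat tau ->
  sec_box b x s a N - a ^ pred s * sec_box b x s a' N
  = psum (fun j => a ^ j * lat_box b x (s - j) (S j) N) s.
Proof.
  intros a a' Hb Hx Hh Hs Haa Hirr; assert (Hb0 : 0 < IZR b) by (now apply (IZR_lt 0)).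
  assert (Hden : forall n n', n <> 0%Z -> IZR n' - a * IZR n <> 0).
  { intros n n' Hn H; apply Hirr.
    assert (Hn0 : IZR n <> 0) by now apply not_0_IZR.
    replace tau with ((IZR n' / IZR n - IZR x) / (2 * IZR b)); [rat|].
    replace (IZR n') with (a * IZR n) by lra; unfold a; field; lra. }
  assert (H1 : sec_box b x s a' N = tsum (fun n => tsum (fun n' =>
            a * (lat b (n' - x * n) / (IZR n' ^ s * (IZR n' - a * IZR n)))) N) N).
  { rewrite tsum_swap; apply tsum_ext; intros n Hn; rewrite <- tsum_scal.
    apply tsum_ext; intros n' Hn'; unfold lat_term.
    rewrite (lat_swap b x g h n' n Hb Hx Hh).
    assert (IZR n ^ s <> 0) by (now apply pow_nonzero, not_0_IZR).
    pose proof (Hden n' n Hn') as Hd.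
    assert (Ha : a <> 0) by (intros H'; rewrite H' in Haa; lra).
    replace (IZR n' - a' * IZR n) with (- (IZR n - a * IZR n') * / a).
    2: { replace a' with (/ a) by (apply Rmult_eq_reg_l with a; [|easy]; now rewrite Rinv_r).
         field; easy. }
    field; repeat split; auto. }
  rewrite H1; unfold sec_box, lat_box.
  rewrite (psum_ext (fun j => a ^ j * _)
    (fun j => tsum (fun n => tsum (fun n' =>
       a ^ j * (lat b (n' - x * n) / (IZR n ^ (s - j) * IZR n' ^ S j))) N) N)).
  2: { intros j _; rewrite <- tsum_scal; apply tsum_ext; intros n _; symmetry; apply tsum_scal. }
  rewrite <- tsum_psum.
  rewrite Rminus_def, Ropp_mult_distr_l, <- tsum_scal, <- tsum_plus.
  apply tsum_ext; intros n Hn; rewrite <- !tsum_scal, <- tsum_plus, <- tsum_psum.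
  apply tsum_ext; intros n' Hn'; unfold lat_term.
  rewrite (psum_ext _ (fun j => lat b (n' - x * n) * (a ^ j / (IZR n ^ (s - j) * IZR n' ^ S j)))).
  2: { intros j _; unfold Rdiv; ring. }
  assert (IZR n <> 0) by now apply not_0_IZR.
  assert (IZR n' <> 0) by now apply not_0_IZR.
  pose proof (Hden n n' Hn) as Hd.
  rewrite psum_scal, <- partial_fraction by easy.
  assert (IZR n ^ s <> 0) by now apply pow_nonzero.
  assert (IZR n' ^ s <> 0) by now apply pow_nonzero.
  replace (a ^ s) with (a * a ^ pred s) by (destruct s; [lia|reflexivity]).
  field; easy.
Qed.

(** * Rationality *)

(* [F tau] and [F (- tau)] are conjugate elements of Q(tau), for [tau ^ 2] rational. *)
Definition conj_rat (tau : R) (F : R -> R) : Prop :=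
  exists u v, is_rat u /\ is_rat v /\ F tau = u + v * tau /\ F (- tau) = u - v * tau.

Lemma conj_rat_const (tau c : R) : is_rat c -> conj_rat tau (fun _ => c).
Proof.
  intros Hc; exists c, 0; repeat split; [easy|apply (is_rat_IZR 0)| |]; ring.
Qed.

Lemma conj_rat_plus (tau : R) (F G : R -> R) :
  conj_rat tau F -> conj_rat tau G -> conj_rat tau (fun t => F t + G t).
Proof.
  intros (u & v & Hu & Hv & H1 & H2) (u' & v' & Hu' & Hv' & H1' & H2').
  exists (u + u'), (v + v'); repeat split; [rat|rat| |].
  - rewrite H1, H1'; ring.
  - rewrite H2, H2'; ring.
Qed.

Lemma conj_rat_mult (tau : R) (F G : R -> R) :
  is_rat (tau * tau) ->
  conj_rat tau F -> conj_rat tau G -> conj_rat tau (fun t => F t * G t).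
Proof.
  intros Ht (u & v & Hu & Hv & H1 & H2) (u' & v' & Hu' & Hv' & H1' & H2').
  exists (u * u' + v * v' * (tau * tau)), (u * v' + v * u'); repeat split; [rat|rat| |].
  - rewrite H1, H1'; ring.
  - rewrite H2, H2'; ring.
Qed.

Lemma conj_rat_pow (tau : R) (F : R -> R) (n : nat) :
  is_rat (tau * tau) -> conj_rat tau F -> conj_rat tau (fun t => F t ^ n).
Proof.
  intros Ht HF; induction n as [|n IH]; [apply conj_rat_const, (is_rat_IZR 1)|].
  now apply (conj_rat_mult tau F).
Qed.

Lemma conj_rat_psum (tau : R) (F : nat -> R -> R) (n : nat) :
  (forall i, (i < n)%nat -> conj_rat tau (F i)) ->
  conj_rat tau (fun t => psum (fun i => F i t) n).
Proof.
  induction n as [|n IH]; intros H; [apply conj_rat_const, (is_rat_IZR 0)|].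
  apply (conj_rat_plus tau (fun t => psum (fun i => F i t) n)); auto with arith.
Qed.

(** Adding and subtracting the two equations gives X z0 = y0 and X z1 = y1 for the rational
    coordinates, and z0, z1 are not both 0. *)
Lemma conj_rat_quotient (tau X : R) (Y Z : R -> R) :
  tau <> 0 -> conj_rat tau Y -> conj_rat tau Z -> Z tau <> 0 ->
  X * Z tau = Y tau -> X * Z (- tau) = Y (- tau) -> is_rat X.
Proof.
  intros Ht (y0 & y1 & Hy0 & Hy1 & HY & HY') (z0 & z1 & Hz0 & Hz1 & HZ & HZ') Hne H1 H2.
  rewrite HZ, HY in H1; rewrite HZ', HY' in H2; rewrite HZ in Hne.
  destruct (Req_dec z0 0) as [H0|H0].
  - assert (z1 <> 0) by (intros H; apply Hne; rewrite H0, H; ring).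
    assert (HX : X = y1 / z1); [|rewrite HX; rat].
    apply Rmult_eq_reg_r with (z1 * tau); [|now apply Rmult_integral_contrapositive].
    transitivity (y1 * tau); [lra|field; easy].
  - assert (HX : X = y0 / z0); [|rewrite HX; rat].
    apply Rmult_eq_reg_r with z0; [|easy].
    transitivity y0; [lra|field; easy].
Qed.

Lemma psi_opp (s : nat) (tau : R) : psi s (- tau) = psi s tau.
Proof.
  apply Series_ext; intros n; unfold psi_term, sec; f_equal; f_equal.
  rewrite <- cos_neg; f_equal; ring.
Qed.

(** With tau^2 = P / Q, the unit a = x + 2 b tau is the square of x0 + 2 w0 sqrt (P Q). Squaring
    makes its rational part 1 + 8 P Q w0^2, thus 1 mod 4, and its irrational part 4 x0 w0 sqrt (P Q)
    = 2 b tau. *)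
Lemma pell_matrix (P Q : Z) :
  (0 < P)%Z -> (0 < Q)%Z -> (forall h k : Z, k <> 0 -> h * h * Q <> P * (k * k))%Z ->
  exists b x g h : Z, (0 < b)%Z /\ (0 < x)%Z /\ (x * x = 1 + 4 * g * b)%Z /\
    (x = 1 + 4 * h)%Z /\ (g * Q = P * b)%Z.
Proof.
  intros HP HQ Hns.
  destruct (pell (4 * P * Q)) as (x0 & w0 & Hw & Hx & He); [lia| |].
  { intros h k Hk E; apply (Hns h (2 * Q * k)%Z); [lia|].
    rewrite E; ring. }
  exists (Q * (2 * x0 * w0))%Z, (1 + 4 * (2 * P * Q * (w0 * w0)))%Z,
    (P * (2 * x0 * w0))%Z, (2 * P * Q * (w0 * w0))%Z.
  repeat split; [nia|nia| |ring].
  replace (4 * (P * (2 * x0 * w0)) * (Q * (2 * x0 * w0)))%Z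
    with (16 * P * Q * (x0 * x0) * (w0 * w0))%Z by ring.
  rewrite He; ring.
Qed.

Lemma ex_series_psi_term (r : Q) (tau : R) (s : nat) :
  tau * tau = Q2R r -> ~ is_rat tau -> (2 <= s)%nat ->
  (forall n, cos (PI * INR (S n) * tau) <> 0) /\
  ex_series (fun n => / Rabs (cos (PI * INR (S n) * tau)) * / INR (S n) ^ s) /\
  ex_series (psi_term s tau).
Proof.
  intros Hr Hirr Hs.
  destruct (sqrt_badly_approximable r tau Hr Hirr) as (c & Hc & Hbad).
  destruct (ex_series_sec_pow tau c s Hc Hbad Hs) as [H1 H2].
  split; [easy|split; [easy|now apply ex_series_psi_term_abs]].
Qed.

(** The limit of the box relation divided by PI^(s+1). The box for a' is the one at - tau, and
    evenness of psi lets both boxes contribute the same value. The sign of [tau] is left free so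
    that the relation can be conjugated. *)
Lemma psi_relation (b x g h : Z) (r : Q) (s : nat) (tau e : R) (t : nat -> R) :
  let a := IZR x + 2 * IZR b * tau in
  let a' := IZR x - 2 * IZR b * tau in
  (0 < b)%Z -> (x * x = 1 + 4 * g * b)%Z -> (x = 1 + 4 * h)%Z ->
  Nat.Even s -> (2 <= s)%nat -> tau * tau = Q2R r -> a * a' = 1 -> ~ is_rat tau ->
  is_lim_seq (lat_axis b x (S s)) (PI ^ S s * e) ->
  (forall j, (j < s)%nat -> is_lim_seq (lat_box b x (s - j) (S j)) (PI ^ S s * t j)) ->
  psi s tau / PI ^ s * (/ IZR b * (1 + - (1) * a ^ pred s))
  = psum (fun j => a ^ j * t j) s + - (1) * e * (a' + - (1) * a ^ s).
Proof.
  intros a a' Hb Hx Hh Hs Hs2 Hr Haa Hirr He Ht.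
  assert (Hb0 : 0 < IZR b) by (now apply (IZR_lt 0)).
  assert (Hirr' : ~ is_rat (- tau)).
  { intros H; apply Hirr; rewrite <- (Ropp_involutive tau); now apply is_rat_opp. }
  assert (Ha : a <> 0) by (intros H; rewrite H in Haa; lra).
  assert (Ha' : a' <> 0) by (intros H; rewrite H in Haa; lra).
  destruct (ex_series_psi_term r tau s Hr Hirr Hs2) as (Hc & Hex & _).
  destruct (ex_series_psi_term r (- tau) s) as (Hc' & Hex' & _); [lra|easy|easy|].
  pose proof (sec_box_cv b x s tau _ Hb Hs Hs2 Ha Hc Hex He) as L1; fold a in L1.
  replace a' with (IZR x + 2 * IZR b * (- tau)) in Ha' by (unfold a'; ring).
  pose proof (sec_box_cv b x s (- tau) _ Hb Hs Hs2 Ha' Hc' Hex' He) as L2.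
  replace (IZR x + 2 * IZR b * (- tau)) with a' in * by (unfold a'; ring).
  rewrite psi_opp in L2.
  assert (L3 : is_lim_seq (fun N => psum (fun j => a ^ j * lat_box b x (s - j) (S j) N) s)
            (psum (fun j => a ^ j * (PI ^ S s * t j)) s)).
  { apply (is_lim_seq_psum (fun N j => a ^ j * lat_box b x (s - j) (S j) N)).
    intros j Hj; apply (is_lim_seq_scal_l _ _ (Finite _)); auto. }
  assert (L4 : is_lim_seq (fun N => psum (fun j => a ^ j * lat_box b x (s - j) (S j) N) s)
     ((PI / IZR b * psi s tau + / a * (PI ^ S s * e))
       - a ^ pred s * (PI / IZR b * psi s tau + / a' * (PI ^ S s * e)))).
  { eapply is_lim_seq_ext.
    - intros N; apply (sec_box_relation b x g h); auto; lia.
    - apply is_lim_seq_minus'; [exact L1|]; now apply (is_lim_seq_scal_l _ _ (Finite _)). }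
  pose proof (is_lim_seq_eq _ _ _ L3 L4) as HE.
  rewrite (psum_ext _ (fun j => PI ^ S s * (a ^ j * t j))), psum_scal in HE by (intros; ring).
  pose proof PI_RGT_0 as Hpi; assert (Hps : PI ^ S s <> 0) by (apply pow_nonzero; lra).
  apply Rmult_eq_reg_l with (PI ^ S s); [|easy].
  rewrite (Rmult_plus_distr_l (PI ^ S s) (psum _ s)), HE.
  replace (/ a) with a' by (apply Rmult_eq_reg_l with a; [|easy]; now rewrite Rinv_r).
  replace (/ a') with a by (apply Rmult_eq_reg_r with a'; [|easy]; now rewrite Rinv_l).
  replace (a ^ s) with (a * a ^ pred s) by (destruct s; [lia|reflexivity]).
  assert (PI ^ s <> 0) by (apply pow_nonzero; lra).
  cbn [pow]; field; lra.
Qed.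

Lemma psi_sqrt_irrational (r : Q) (s : nat) :
  Nat.Even s -> (2 <= s)%nat -> (0 < r)%Q -> ~ is_rat (sqrt (Q2R r)) ->
  ex_series (psi_term s (sqrt (Q2R r))) /\ is_rat (psi s (sqrt (Q2R r)) / PI ^ s).
Proof.
  intros Hs Hs2 Hr0 Hirr; pose proof PI_RGT_0 as Hpi.
  assert (Hrpos : 0 < Q2R r) by (apply Qlt_Rlt in Hr0; rewrite RMicromega.Q2R_0 in Hr0; easy).
  set (tau := sqrt (Q2R r)) in *.
  assert (Htau : tau * tau = Q2R r) by (apply sqrt_sqrt; lra).
  assert (Htpos : 0 < tau) by now apply sqrt_lt_R0.
  split; [now apply (ex_series_psi_term r)|].
  set (P := Qnum r); set (q := Zpos (Qden r)).
  assert (Hq : (0 < q)%Z) by (unfold q; lia).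
  assert (HP : (0 < P)%Z) by (unfold Qlt in Hr0; simpl in Hr0; unfold P; lia).
  assert (Hq0 : 0 < IZR q) by now apply (IZR_lt 0).
  assert (Htau' : tau * tau * IZR q = IZR P).
  { rewrite Htau; unfold Q2R; fold P; fold q; field; lra. }
  destruct (pell_matrix P q HP Hq) as (b & x & g & h & Hb & Hx0 & Hx & Hh & Hg).
  { intros h k Hk E; apply Hirr.
    assert (Hk0 : IZR k <> 0) by now apply not_0_IZR.
    assert (HE : (IZR k * tau - IZR h) * (IZR k * tau + IZR h) = 0).
    { apply Rmult_eq_reg_r with (IZR q); [|lra]; rewrite Rmult_0_l.
      apply (f_equal IZR) in E; rewrite !mult_IZR in E.
      transitivity (IZR k * IZR k * (tau * tau * IZR q) - IZR h * IZR h * IZR q); [ring|].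
      rewrite Htau', E; ring. }
    apply Rmult_integral in HE; destruct HE as [HE|HE].
    - replace tau with (IZR h / IZR k) by (apply Rmult_eq_reg_l with (IZR k); [field_simplify; lra|easy]).
      rat.
    - replace tau with (- IZR h / IZR k) by (apply Rmult_eq_reg_l with (IZR k); [field_simplify; lra|easy]).
      rat. }
  assert (Hb0 : 0 < IZR b) by (now apply (IZR_lt 0)).
  assert (HgR : IZR g = tau * tau * IZR b).
  { apply Rmult_eq_reg_r with (IZR q); [|lra].
    rewrite <- mult_IZR, Hg, mult_IZR, <- Htau'; ring. }
  assert (HxR : IZR x * IZR x = 1 + 4 * IZR g * IZR b)
    by (rewrite <- mult_IZR, Hx, plus_IZR, !mult_IZR; reflexivity).
  destruct (lat_axis_cv b x (S s) Hb ltac:(lia)) as (e & He & Le).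
  (* Reading the rational numbers off the limits yields one function of j, independent of tau, to be
     used at both tau and - tau. *)
  set (t j := real (Lim_seq (lat_box b x (s - j) (S j))) / PI ^ S s).
  assert (Hps : PI ^ S s <> 0) by (apply pow_nonzero; lra).
  assert (Ht : forall j, (j < s)%nat -> is_rat (t j) /\
            is_lim_seq (lat_box b x (s - j) (S j)) (PI ^ S s * t j)).
  { intros j Hj; destruct (lat_box_cv b x (s - j) (S j)) as (c & Hc & Lc); [easy|lia|lia|].
    replace (s - j + S j)%nat with (S s) in Lc by lia.
    assert (Hcj : t j = c).
    { unfold t; rewrite (is_lim_seq_unique _ _ Lc).
      change (PI ^ S s * c / PI ^ S s = c); field; easy. }
    now rewrite Hcj. }
  set (A u := IZR x + 2 * IZR b * u); set (A' u := IZR x + - (2 * IZR b) * u).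
  assert (Hrat2 : is_rat (tau * tau)) by (exists r; exact Htau).
  assert (HA : conj_rat tau A).
  { exists (IZR x), (2 * IZR b); unfold A; repeat split; [rat|rat|ring]. }
  assert (HA' : conj_rat tau A').
  { exists (IZR x), (- (2 * IZR b)); unfold A'; repeat split; [rat|rat|ring]. }
  assert (Hrel : forall u, u * u = tau * tau -> ~ is_rat u ->
    psi s u / PI ^ s * (/ IZR b * (1 + - (1) * A u ^ pred s))
    = psum (fun j => A u ^ j * t j) s + - (1) * e * (A' u + - (1) * A u ^ s)).
  { intros u Hu Huirr.
    pose proof (psi_relation b x g h r s u e t Hb Hx Hh Hs Hs2) as HH; cbv zeta in HH.
    replace (A' u) with (IZR x - 2 * IZR b * u) by (unfold A'; ring).
    apply HH; [lra| |easy|exact Le|intros j Hj; now apply Ht].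
    transitivity (IZR x * IZR x - 4 * (u * u * IZR b) * IZR b); [ring|].
    rewrite Hu, <- HgR, HxR; ring. }
  apply (conj_rat_quotient tau (psi s tau / PI ^ s)
    (fun u => psum (fun j => A u ^ j * t j) s + - (1) * e * (A' u + - (1) * A u ^ s))
    (fun u => / IZR b * (1 + - (1) * A u ^ pred s))).
  - lra.
  - apply conj_rat_plus.
    + apply (conj_rat_psum tau (fun j u => A u ^ j * t j)); intros j Hj.
      apply (conj_rat_mult tau (fun u => A u ^ j)); [easy|now apply conj_rat_pow|].
      apply conj_rat_const; now apply Ht.
    + apply (conj_rat_mult tau (fun _ => - (1) * e)); [easy|apply conj_rat_const; rat|].
      apply conj_rat_plus; [easy|].
      apply (conj_rat_mult tau (fun _ => - (1))); [easy|apply conj_rat_const; rat|].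
      now apply conj_rat_pow.
  - apply (conj_rat_mult tau (fun _ => / IZR b)); [easy|apply conj_rat_const; rat|].
    apply conj_rat_plus; [apply conj_rat_const; rat|].
    apply (conj_rat_mult tau (fun _ => - (1))); [easy|apply conj_rat_const; rat|].
    now apply conj_rat_pow.
  - cbv beta; apply Rmult_integral_contrapositive_currified.
    + apply Rinv_neq_0_compat; lra.
    (* The unit exceeds 1 because x >= 1 and b tau > 0, so 1 - a^(s-1) does not vanish. *)
    + assert (1 < A tau).
      { unfold A; assert (1 <= IZR x) by (apply IZR_le; lia); nra. }
      assert (1 < A tau ^ pred s) by (apply Rlt_pow_R1; [easy|lia]).
      lra.
  - now apply Hrel.
  (* The conjugate equation is the relation at - tau, with the same unknown by evenness of psi. *)
  - rewrite <- psi_opp; apply Hrel; [ring|].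
    intros H; apply Hirr; rewrite <- (Ropp_involutive tau); now apply is_rat_opp.
Qed.

(** The kernel identity cos (d t) = (-1)^e cos t (1 + 2 sum (-1)^i cos (2 i t)), multiplied by cos
    (d t). When cos (d t) is 1 or -1 it expresses sec t as a finite sum of cosines. *)
Lemma sec_odd_expansion (e : nat) (t : R) :
  let d := 2 * INR e + 1 in
  cos t * (cos (d * t) + psum (fun i => (-1) ^ S i *
     (cos ((d + 2 * INR (S i)) * t) + cos ((d - 2 * INR (S i)) * t))) e)
  = (-1) ^ e * cos (d * t) ^ 2.
Proof.
  intros d; set (c := cos (d * t)).
  rewrite (psum_ext _ (fun i => 2 * c * ((-1) ^ S i * cos (2 * INR (S i) * t)))), psum_scal.
  2: { intros i _; rewrite Rmult_plus_distr_r, Rmult_minus_distr_r, cos_plus, cos_minus.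
       unfold c; ring. }
  assert (H : forall n, cos t * (1 + 2 * psum (fun i => (-1) ^ S i * cos (2 * INR (S i) * t)) n)
            = (-1) ^ n * cos ((2 * INR n + 1) * t)).
  { induction n as [|n IH].
    - simpl; replace ((2 * 0 + 1) * t) with t by ring; ring.
    - cbn [psum].
      transitivity ((-1) ^ n * cos ((2 * INR n + 1) * t)
        + (-1) ^ S n * (2 * cos t * cos (2 * INR (S n) * t))); [rewrite <- IH; ring|].
      replace ((2 * INR n + 1) * t) with (2 * INR (S n) * t - t) by (rewrite S_INR; ring).
      rewrite Rmult_plus_distr_r, Rmult_1_l, cos_plus, cos_minus; simpl; ring. }
  transitivity (c * (cos t * (1 + 2 * psum (fun i => (-1) ^ S i * cos (2 * INR (S i) * t)) e)));
    [ring|rewrite H; unfold c, d; ring].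
Qed.

Lemma psi_rational_odd (s : nat) (p d : Z) :
  Nat.Even s -> (2 <= s)%nat -> (0 < d)%Z -> Z.Odd d ->
  ex_series (psi_term s (IZR p / IZR d)) /\ is_rat (psi s (IZR p / IZR d) / PI ^ s).
Proof.
  intros Hs Hs2 Hd Hodd; pose proof PI_RGT_0 as Hpi.
  destruct Hodd as [ez Hez]; set (e := Z.to_nat ez).
  assert (Hd0 : 0 < IZR d) by now apply (IZR_lt 0).
  assert (HdR : 2 * INR e + 1 = IZR d).
  { unfold e; rewrite <- IZR_of_nat, Z2Nat.id, Hez, plus_IZR, mult_IZR by lia; ring. }
  set (v k := k * (IZR p / IZR d)).
  assert (Hsum : forall N, psum (psi_term s (IZR p / IZR d)) N
    = (-1) ^ e * (cos_sum s (v (IZR d)) N + psum (fun i => (-1) ^ S i *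
        (cos_sum s (v (IZR d + 2 * INR (S i))) N + cos_sum s (v (IZR d - 2 * INR (S i))) N)) e)).
  { intros N; unfold cos_sum.
    rewrite (psum_ext (fun i => (-1) ^ S i * _)
      (fun i => psum (fun n => (-1) ^ S i *
         (cos (PI * INR (S n) * v (IZR d + 2 * INR (S i))) / INR (S n) ^ s
          + cos (PI * INR (S n) * v (IZR d - 2 * INR (S i))) / INR (S n) ^ s)) N)).
    2: { intros i _; now rewrite <- psum_plus, psum_scal. }
    rewrite psum_swap, <- psum_plus, <- psum_scal; apply psum_ext; intros n _.
    unfold psi_term, sec; set (t := PI * INR (S n) * (IZR p / IZR d)).
    pose proof (sec_odd_expansion e t) as HE; cbv zeta in HE; rewrite HdR in HE.
    (* Here d t = PI n p is an integral multiple of PI. *)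
    assert (Hc : cos (IZR d * t) ^ 2 = 1).
    { replace (IZR d * t) with (IZR (Z.of_nat (S n) * p) * PI)
        by (unfold t; rewrite mult_IZR, IZR_of_nat; field; lra).
      pose proof (sin2_cos2 (IZR (Z.of_nat (S n) * p) * PI)) as H.
      rewrite sin_IZR_PI in H; unfold Rsqr in H; rewrite <- Rsqr_pow2; unfold Rsqr; lra. }
    rewrite Hc, Rmult_1_r in HE.
    assert (Ht : forall k, PI * INR (S n) * v k = k * t) by (intros k; unfold v, t; ring).
    pose proof (INR_S_pow_pos n s) as Hp.
    assert (Hsq : (-1) ^ e * (-1) ^ e = 1)
      by (rewrite <- Rpow_mult_distr; replace (-1 * -1) with 1 by ring; apply pow1).
    rewrite (psum_ext _ (fun i => / INR (S n) ^ s * ((-1) ^ S i *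
       (cos ((IZR d + 2 * INR (S i)) * t) + cos ((IZR d - 2 * INR (S i)) * t))))), psum_scal.
    2: { intros i _; rewrite !Ht; unfold Rdiv; ring. }
    rewrite Ht; set (S0 := psum _ e) in *.
    (* The product of cos t with the bracket is 1 or -1, so the secant has no pole; this is where
       the oddness of the denominator acts. *)
    assert (Hct : cos t <> 0) by (intros H; rewrite H, Rmult_0_l in HE; rewrite <- HE in Hsq; lra).
    apply Rmult_eq_reg_l with (cos t); [|easy].
    transitivity ((-1) ^ e * (cos t * (cos (IZR d * t) + S0)) * / INR (S n) ^ s).
    - rewrite HE, Hsq; field; split; [lra|easy].
    - unfold Rdiv; ring. }
  assert (Hcos : forall k, is_rat k -> exists q, is_rat q /\
            is_lim_seq (cos_sum s (v k)) (PI ^ s * q)).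
  { intros k Hk; destruct Hs as [j Hj]; destruct j as [|j]; [lia|].
    replace s with (2 * j + 2)%nat by lia; apply cos_sum_rat_cv; unfold v; rat. }
  destruct (Hcos (IZR d)) as (q0 & Hq0 & L0); [rat|].
  destruct (rat_multiple_lim_psum (fun N i => (-1) ^ S i *
        (cos_sum s (v (IZR d + 2 * INR (S i))) N + cos_sum s (v (IZR d - 2 * INR (S i))) N))
        (PI ^ s) e) as (q1 & Hq1 & L1).
  { intros i _.
    destruct (Hcos (IZR d + 2 * INR (S i))) as (c1 & Hc1 & M1); [rat|].
    destruct (Hcos (IZR d - 2 * INR (S i))) as (c2 & Hc2 & M2); [rat|].
    exists ((-1) ^ S i * (c1 + c2)); split; [rat|].
    replace (PI ^ s * ((-1) ^ S i * (c1 + c2))) with ((-1) ^ S i * (PI ^ s * c1 + PI ^ s * c2))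
      by ring.
    apply (is_lim_seq_scal_l _ _ (Finite _)); now apply is_lim_seq_plus'. }
  assert (HS : is_series (psi_term s (IZR p / IZR d)) (PI ^ s * ((-1) ^ e * (q0 + q1)))).
  { apply is_series_psum; eapply is_lim_seq_ext; [intros N; symmetry; apply Hsum|].
    replace (PI ^ s * ((-1) ^ e * (q0 + q1))) with ((-1) ^ e * (PI ^ s * q0 + PI ^ s * q1)) by ring.
    apply (is_lim_seq_scal_l _ _ (Finite _)); now apply is_lim_seq_plus'. }
  split; [now exists (PI ^ s * ((-1) ^ e * (q0 + q1)))|].
  unfold psi; rewrite (is_series_unique _ _ HS).
  replace (PI ^ s * ((-1) ^ e * (q0 + q1)) / PI ^ s) with ((-1) ^ e * (q0 + q1)); [rat|].
  field; apply pow_nonzero; lra.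
Qed.

Theorem theorem3 (m : nat) (r : Q)
  (hm : (0 < m)%nat)
  (hr : (0 < r)%Q)
  (hsqrt : ~ rational_with_even_denominator (sqrt (Q2R r))) :
  ex_series (psi_term (2 * m) (sqrt (Q2R r))) /\
  exists q : Q, psi (2 * m) (sqrt (Q2R r)) = PI ^ (2 * m) * Q2R q.
Proof.
  assert (Hs : Nat.Even (2 * m)) by (now exists m).
  assert (H : ex_series (psi_term (2 * m) (sqrt (Q2R r))) /\
              is_rat (psi (2 * m) (sqrt (Q2R r)) / PI ^ (2 * m))).
  { destruct (classic (is_rat (sqrt (Q2R r)))) as [[q Hq]|Hirr].
    - assert (Hodd : Z.Odd (Zpos (Qden (Qred q)))).
      { destruct (Z.Even_or_Odd (Zpos (Qden (Qred q)))) as [He|]; [|easy].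
        exfalso; apply hsqrt; now exists q. }
      rewrite Hq, <- (Qeq_eqR _ _ (Qred_correct q)).
      apply psi_rational_odd; [easy|lia|lia|easy].
    - apply psi_sqrt_irrational; [easy|lia|easy|easy]. }
  destruct H as [Hex [q Hq]]; split; [easy|]; exists q; rewrite <- Hq.
  pose proof PI_RGT_0; field; apply pow_nonzero; lra.
Qed.
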